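(* Let $N\geq 2$ and $m<m^*(2)$. Then for every $\alpha\in\mathbb R$ the quadratic form $\mathcal F_\alpha$ on $L^2_{\mathrm f}(\mathbb R^{3N})$ is unbounded from below.
   Context: Setting: $N\geq 2$ identical fermions of unit mass interacting with a different particle of mass $m>0$ via a zero-range interaction, in relative coordinates $\mathbf y_1,\dots,\mathbf y_N\in\mathbb R^3$. $L^2_{\mathrm f}$, $H^1_{\mathrm f}$, $H^{1/2}_{\mathrm f}$ denote the subspaces of $L^2$, $H^1$, $H^{1/2}$ of functions totally antisymmetric under exchange of the $\mathbb R^3$-variables. Fourier transform: $\hat f(\mathbf k)=(2\pi)^{-d/2}\int e^{-i\mathbf k\cdot\mathbf x}f(\mathbf x)\,d\mathbf x$. For $\lambda>0$: $G_\lambda(\mathbf k_1,\dots,\mathbf k_N)=\big[\sum_{i}k_i^2+\tfrac{2}{m+1}\sum_{i<j}\mathbf k_i\cdot\mathbf k_j+\lambda\big]^{-1}$, $L_\lambda(\mathbf k_1,\dots,\mathbf k_{N-1})=2\pi^2\big(\tfrac{m(m+2)}{(m+1)^2}\sum_{i=1}^{N-1}k_i^2+\tfrac{2m}{(m+1)^2}\sum_{i<j}\mathbf k_i\cdot\mathbf k_j+\lambda\big)^{1/2}$. For $\xi\in H^{1/2}_{\mathrm f}(\mathbb R^{3N-3})$, $\widehat{\mathcal G^\lambda\xi}(\mathbf k_1,\dots,\mathbf k_N)=\sum_{i=1}^N(-1)^{i+1}G_\lambda(\mathbf k_1,\dots,\mathbf k_N)\hat\xi(\breve{\mathbf k}_i)$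 with $\breve{\mathbf k}_i$ the $(N-1)$-tuple with $\mathbf k_i$ removed. $\Phi^\lambda_\alpha[\xi]=\int|\hat\xi(\mathbf k_1,\dots,\mathbf k_{N-1})|^2[\alpha+L_\lambda(\mathbf k_1,\dots,\mathbf k_{N-1})]+(N-1)\int\hat\xi^*(\mathbf s,\mathbf k_2,\dots,\mathbf k_{N-1})\hat\xi(\mathbf t,\mathbf k_2,\dots,\mathbf k_{N-1})G_\lambda(\mathbf s,\mathbf t,\mathbf k_2,\dots,\mathbf k_{N-1})$, on $H^{1/2}_{\mathrm f}(\mathbb R^{3N-3})$. With $\mathcal F_0[\phi]=\int(\sum_i k_i^2+\tfrac{2}{m+1}\sum_{i<j}\mathbf k_i\cdot\mathbf k_j)|\hat\phi|^2$ and fixed $\lambda>0$: $\mathcal D(\mathcal F_\alpha)=\{\psi\in L^2_{\mathrm f}(\mathbb R^{3N}):\exists\,\xi\in H^{1/2}_{\mathrm f}(\mathbb R^{3N-3}),\ \phi^\lambda:=\psi-\mathcal G^\lambda\xi\in H^1_{\mathrm f}(\mathbb R^{3N})\}$, $\mathcal F_\alpha[\psi]=\mathcal F_0[\phi^\lambda]+\lambda\|\phi^\lambda\|^2-\lambda\|\psi\|^2+N\Phi^\lambda_\alpha[\xi]$. Let $\Lambda(m,N)=2\pi^{-1}(N-1)(m+1)^2\big[\tfrac{1}{\sqrt{m(m+2)}}-\arcsin\tfrac{1}{m+1}\big]$, strictly decreasing in $m$ from $+\infty$ to $0$; $m^*(2)$ is the unique solution of $\Lambda(m,2)=1$. *)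

(* Defs.v *)
From HB Require Import structures.
From mathcomp Require Import all_boot all_order all_algebra all_fingroup.
From mathcomp Require Import all_classical all_reals all_analysis.
Set Implicit Arguments. Unset Strict Implicit. Unset Printing Implicit Defensive.
Import Order.TTheory GRing.Theory Num.Theory numFieldNormedType.Exports.
Local Open Scope ring_scope.
Local Open Scope classical_set_scope.

Section Defs.
Variable R : realType.

Definition cfg (n : nat) := {ptws 'I_n -> 'rV[R]_3}.
HB.instance Definition _ (n : nat) :=
  Topological.copy (cfg n) (prod_topology (fun _ : 'I_n => 'rV[R]_3)).

Definition borel_fun (n : nat) (u : cfg n -> R) : Prop :=
  @measurable_fun _ _ (g_sigma_algebraType (@open (cfg n))) R setT u.

Definition dot3 (a b : 'rV[R]_3) : R := \sum_(c < 3) a 0 c * b 0 c.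

Definition sumsq (n : nat) (k : cfg n) : R := \sum_(i < n) dot3 (k i) (k i).
Definition sumdot (n : nat) (k : cfg n) : R :=
  \sum_(i < n) \sum_(j < n | (i < j)%N) dot3 (k i) (k j).

Definition kin (m : R) (n : nat) (k : cfg n) : R :=
  sumsq k + 2 / (m + 1) * sumdot k.
Definition Gl (m lam : R) (n : nat) (k : cfg n) : R := (kin m k + lam)^-1.
Definition Ll (m lam : R) (n : nat) (k : cfg n) : R :=
  2 * pi ^+ 2 * Num.sqrt (m * (m + 2) / (m + 1) ^+ 2 * sumsq k
                          + 2 * m / (m + 1) ^+ 2 * sumdot k + lam).

Definition antisym (n : nat) (u : cfg n -> R) : Prop :=
  forall (s : 'S_n) (k : cfg n), u (fun i => k (s i)) = (-1) ^+ odd_perm s * u k.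

Definition rem (n : nat) (i : 'I_n.+1) (k : cfg n.+1) : cfg n :=
  fun j => k (lift i j).

Definition int3 (g : 'rV[R]_3 -> \bar R) : \bar R :=
  (\int[lebesgue_measure]_x1 \int[lebesgue_measure]_x2 \int[lebesgue_measure]_x3
     g (\row_(c < 3) (if nat_of_ord c == 0%N then x1
                      else if nat_of_ord c == 1%N then x2 else x3)))%E.

Definition consP (n : nat) (k : 'rV[R]_3) (ks : cfg n) : cfg n.+1 :=
  fun i => if unlift ord0 i is Some j then ks j else k.

Fixpoint intP (n : nat) : (cfg n -> \bar R) -> \bar R :=
  match n return (cfg n -> \bar R) -> \bar R with
  | 0%N => fun f => f (fun _ => 0)
  | n'.+1 => fun f => int3 (fun k => intP (fun ks => f (consP k ks)))
  end.

(* ---- complex-valued functions are represented by (real part, imaginary part) *)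

Definition nrm2 (n : nat) (u v : cfg n -> R) : \bar R :=
  intP (fun k => (u k ^+ 2 + v k ^+ 2)%:E).
Definition wint (n : nat) (w : cfg n -> R) (u v : cfg n -> R) : \bar R :=
  intP (fun k => (w k * (u k ^+ 2 + v k ^+ 2))%:E).
Definition rint (n : nat) (f : cfg n -> R) : \bar R :=
  (intP (fun k => (Num.max (f k) 0)%:E) - intP (fun k => (Num.max (- f k) 0)%:E))%E.

(* Fourier transform of G^lambda xi, for N = n.+2 particles *)
Definition Gxi (m lam : R) (n : nat) (u : cfg n.+1 -> R) (k : cfg n.+2) : R :=
  Gl m lam k * \sum_(i < n.+2) (-1) ^+ i * u (rem i k).

Definition phiR (m lam : R) (n : nat) (psiR : cfg n.+2 -> R) (xiR : cfg n.+1 -> R)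
  : cfg n.+2 -> R := fun k => psiR k - Gxi m lam xiR k.

Definition ord_1 (n : nat) : 'I_n.+2 := lift ord0 ord0.

(* real part of  xi^*(s,k_2..) xi(t,k_2..) G(s,t,k_2..), with q = (s,t,k_2,..) *)
Definition cross (m lam : R) (n : nat) (xiR xiI : cfg n.+1 -> R) (q : cfg n.+2) : R :=
  (xiR (rem (ord_1 n) q) * xiR (rem ord0 q) + xiI (rem (ord_1 n) q) * xiI (rem ord0 q))
  * Gl m lam q.

Definition Phi (m lam alpha : R) (n : nat) (xiR xiI : cfg n.+1 -> R) : \bar R :=
  (alpha%:E * nrm2 xiR xiI + wint (@Ll m lam n.+1) xiR xiI
   + n.+1%:R%:E * rint (cross m lam xiR xiI))%E.

(* D(F_alpha) (in momentum space), with xi the charge of psi *)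
Definition FDom (m lam : R) (n : nat) (psiR psiI : cfg n.+2 -> R) (xiR xiI : cfg n.+1 -> R)
  : Prop :=
  [/\ [/\ borel_fun psiR, borel_fun psiI, antisym psiR, antisym psiI
        & (nrm2 psiR psiI < +oo)%E],
      [/\ borel_fun xiR, borel_fun xiI, antisym xiR, antisym xiI
        & (wint (fun k => (Num.sqrt (1 + sumsq k))%R) xiR xiI < +oo)%E],
      (wint (fun k => (1 + sumsq k)%R) (phiR m lam psiR xiR) (phiR m lam psiI xiI) < +oo)%E
    & (intP (fun q => `|cross m lam xiR xiI q|%:E) < +oo)%E].

Definition Fform (m lam alpha : R) (n : nat) (psiR psiI : cfg n.+2 -> R)
  (xiR xiI : cfg n.+1 -> R) : \bar R :=
  (wint (@kin m n.+2) (phiR m lam psiR xiR) (phiR m lam psiI xiI)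
   + lam%:E * nrm2 (phiR m lam psiR xiR) (phiR m lam psiI xiI)
   - lam%:E * nrm2 psiR psiI
   + n.+2%:R%:E * Phi m lam alpha xiR xiI)%E.

Definition LambdaMN (m : R) (N : nat) : R :=
  2 / pi * (N%:R - 1) * (m + 1) ^+ 2
  * ((Num.sqrt (m * (m + 2)))^-1 - asin ((m + 1)^-1)).
End Defs.

(* Main.v *)
(* The test states have no regular part: psi = G xi, so that F_alpha reduces to
   N Phi[xi] - lam |psi|^2.  The charge xi is a Slater determinant built from one
   p-wave x_1 / |x|^3, cut off to the slab d <= |x_1| <= K, and from orthonormal
   functions of bounded momentum (normalized indicators of disjoint cells) for the
   other n particles.  The mass J of the p-wave, with respect to the weight |x|, grows
   like ln (K / d).  The diagonal term of Phi is 2 pi^2 sqrt (1 - kap^2) J up to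
   O(J / d), where kap = 1 / (m + 1).  For the cross term, a Feynman parameter gives
   the integral of the kernel G against the p-wave over the whole space in closed
   form, hence the contribution - 4 pi kap A(kap) J, up to O(J / d) from the
   spectators and O(1) from the cut-offs at d and K.  The condition m < m*(2) says
   that the negative term wins, by a definite factor; one fixes d large, and then lets
   K tend to infinity.  Since |psi|^2 = O(J / d) too, the energy is below - C |psi|^2
   for any prescribed C. *)

From Pilot Require Import Defs.
From HB Require Import structures.
From mathcomp Require Import all_boot all_order all_algebra all_fingroup.
From mathcomp Require Import all_classical all_reals all_analysis.
From mathcomp Require Import measurable_realfun ring lra.
(* Again, since ssrint also defines an [intP]. *)
Import Pilot.Defs.
Import Order.TTheory GRing.Theory Num.Theory numFieldNormedType.Exports.
Local Open Scope ring_scope.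
Local Open Scope classical_set_scope.
Set Implicit Arguments. Unset Strict Implicit. Unset Printing Implicit Defensive.

(** All integrals are iterated Lebesgue integrals with values in [\bar R], where subtraction is
    unsafe. Signed quantities are therefore split into positive and negative parts, comparisons are
    stated additively (positive part + gain <= negative part + loss), and a difference is taken only
    once finiteness is known. The cut-off acts on [x_1] and not on [|x|], so that the integrals over
    [x_2] and [x_3] stay complete and have elementary antiderivatives. In the Feynman integral the
    half-spaces [x_1 > 0] and [x_1 < 0] produce the same square root, which cancels in their
    difference; what remains is linear in the first coordinate of the shift [kap (s + V)], with [V]
    the total spectator momentum. The part from [s] is the gain, the part from [V] a loss. The
    orbitals have disjoint supports, not merely vanishing inner products, so products of
    determinants collapse pointwise. The diagonal term carries the factor [(n+1)!] and the cross
    term [(n+1) n!], which is the same number; this is why the threshold is that of two fermions for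
    every number of them. *)

Section Measurability.
Context {R : realType}.

Lemma measurable_invr : measurable_fun setT (@GRing.inv R).
Proof.
have mN0 : measurable [set x : R | x != 0].
  apply: open_measurable; rewrite (_ : [set _ | _] = ~` [set 0]).
    by apply: closed_openC; exact: closed_eq.
  by apply/seteqP; split=> x /= /eqP.
rewrite (_ : @GRing.inv R = (fun x => if x != 0 then x^-1 else 0)); last first.
  by apply/funext => x; case: eqP => [->|//]; rewrite invr0.
apply: measurable_fun_if => //.
- apply: (measurable_fun_bool true); rewrite setTI.
  by rewrite (_ : _ @^-1` _ = [set x : R | x != 0]).
- rewrite setTI; apply: (@measurable_funS _ _ _ _ [set x : R | x != 0]) => //.
  apply: open_continuous_measurable_fun.
    rewrite (_ : [set _ | _] = ~` [set 0]).
      by apply: closed_openC; exact: closed_eq.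
    by apply/seteqP; split=> x /= /eqP.
  by move=> x; rewrite inE => /= x0; exact: inv_continuous.
Qed.

Context d (T : measurableType d).
Implicit Types f g : T -> R.

Lemma measurable_fun_const d' (T' : measurableType d') (k : T') :
  measurable_fun [set: T] (fun=> k).
Proof. exact: measurable_cst. Qed.
Lemma measurable_fun_addr f g : measurable_fun setT f -> measurable_fun setT g ->
  measurable_fun setT (fun t => f t + g t).
Proof. exact: measurable_funD. Qed.
Lemma measurable_fun_mulr f g : measurable_fun setT f -> measurable_fun setT g ->
  measurable_fun setT (fun t => f t * g t).
Proof. exact: measurable_funM. Qed.
Lemma measurable_fun_oppr f : measurable_fun setT f ->
  measurable_fun setT (fun t => - f t).
Proof. exact: measurable_funN. Qed.
Lemma measurable_fun_invr f : measurable_fun setT f ->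
  measurable_fun setT (fun t => (f t)^-1).
Proof. by move=> mf; exact: (measurableT_comp measurable_invr mf). Qed.
Lemma measurable_fun_exprn f n : measurable_fun setT f ->
  measurable_fun setT (fun t => f t ^+ n).
Proof. exact: measurable_funX. Qed.
Lemma measurable_fun_sqrtr f : measurable_fun setT f ->
  measurable_fun setT (fun t => Num.sqrt (f t)).
Proof.
have ms : measurable_fun setT (@Num.sqrt R).
  by apply: continuous_measurable_fun => x; exact: sqrt_continuous.
by move=> mf; exact: (measurableT_comp ms mf).
Qed.
Lemma measurable_fun_normr f : measurable_fun setT f ->
  measurable_fun setT (fun t => `|f t|).
Proof. by move=> mf; exact: (measurableT_comp (@normr_measurable R setT) mf). Qed.
Lemma measurable_fun_maxr f g : measurable_fun setT f -> measurable_fun setT g ->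
  measurable_fun setT (fun t => Num.max (f t) (g t)).
Proof. exact: measurable_maxr. Qed.
Lemma measurable_fun_natr_bool (b : T -> bool) : measurable_fun setT b ->
  measurable_fun setT (fun t => (b t)%:R : R).
Proof.
move=> mb; rewrite (_ : (fun _ => _) = (fun t => if b t then 1 else 0 : R)).
  exact: measurable_fun_ifT.
by apply/funext => t; case: (b t).
Qed.
Lemma measurable_fun_sumr (I : Type) (s : seq I) (P : pred I) (F : I -> T -> R) :
  (forall i, measurable_fun setT (F i)) ->
  measurable_fun setT (fun t => \sum_(i <- s | P i) F i t).
Proof.
move=> mF; elim: s => [|a s IH].
  by under eq_fun do rewrite big_nil; exact: measurable_cst.
under eq_fun do rewrite big_cons.
by case: (P a) => //; exact: measurable_fun_addr.
Qed.
Lemma measurable_fun_prodr (I : Type) (s : seq I) (P : pred I) (F : I -> T -> R) :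
  (forall i, measurable_fun setT (F i)) ->
  measurable_fun setT (fun t => \prod_(i <- s | P i) F i t).
Proof.
move=> mF; elim: s => [|a s IH].
  by under eq_fun do rewrite big_nil; exact: measurable_cst.
under eq_fun do rewrite big_cons.
by case: (P a) => //; exact: measurable_fun_mulr.
Qed.
End Measurability.

(** * Tactics for measurability and nonnegativity goals *)

Ltac mfun_step :=
  lazymatch goal with
  | |- measurable_fun _ fst => exact: measurable_fst
  | |- measurable_fun _ snd => exact: measurable_snd
  | |- measurable_fun _ id => exact: measurable_id
  (* Eta-reduced partial applications need their own cases, as they do not match the patterns under
     [fun t]. *)
  | |- measurable_fun _ (Order.le ?a) =>
      exact: (measurable_fun_ler (measurable_cst a) (@measurable_id _ _ _))
  | |- measurable_fun _ (Order.lt ?a) =>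
      exact: (measurable_fun_ltr (measurable_cst a) (@measurable_id _ _ _))
  | |- measurable_fun _ (GRing.mul ?a) =>
      exact: (measurable_fun_mulr (measurable_cst a) (@measurable_id _ _ _))
  | |- measurable_fun _ (fun t => EFin _) => apply/measurable_EFinP
  | |- measurable_fun _ (fun t => _ + _)%R => apply: measurable_fun_addr
  | |- measurable_fun _ (fun t => - _)%R => apply: measurable_fun_oppr
  | |- measurable_fun _ (fun t => _ * _)%R => apply: measurable_fun_mulr
  | |- measurable_fun _ (fun t => _ ^+ _)%R => apply: measurable_fun_exprn
  | |- measurable_fun _ (fun t => _^-1)%R => apply: measurable_fun_invr
  | |- measurable_fun _ (fun t => Num.sqrt _) => apply: measurable_fun_sqrtr
  | |- measurable_fun _ (fun t => `|_|)%R => apply: measurable_fun_normr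
  | |- measurable_fun _ (fun t => Num.max _ _) => apply: measurable_fun_maxr
  | |- measurable_fun _ (fun t => (nat_of_bool _)%:R) =>
      apply: measurable_fun_natr_bool
  | |- measurable_fun _ (fun t => (_ <= _)%R) => apply: measurable_fun_ler
  | |- measurable_fun _ (fun t => (_ < _)%R) => apply: measurable_fun_ltr
  | |- measurable_fun _ (fun t => _ && _) => apply: measurable_and
  | |- measurable_fun _ (fun t => \sum_(i <- _ | _) _)%R =>
      apply: measurable_fun_sumr => ?
  | |- measurable_fun _ (fun t => \prod_(i <- _ | _) _)%R =>
      apply: measurable_fun_prodr => ?
  | |- measurable_fun _ (fun t => t.1) => exact: measurable_fst
  | |- measurable_fun _ (fun t => t.2) => exact: measurable_snd
  | |- measurable_fun _ (fun t => fst (@?f t)) =>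
      apply: (@measurableT_comp _ _ _ _ _ _ fst _ f); [exact: measurable_fst|]
  | |- measurable_fun _ (fun t => snd (@?f t)) =>
      apply: (@measurableT_comp _ _ _ _ _ _ snd _ f); [exact: measurable_snd|]
  | |- measurable_fun _ (fun t => ?c) => exact: measurable_cst
  end.
Ltac mfun := repeat first
  [assumption | simple apply measurable_fun_const | mfun_step | match goal with H : forall _, _ |- _ => apply: H end].

Ltac nneg := repeat first
  [ assumption | exact: sqr_ge0 | exact: sqrtr_ge0 | exact: pi_ge0
  | exact: ler0n | exact: normr_ge0 | exact: lexx
  | lazymatch goal with
    | |- is_true (0 <= _ * _)%R => apply: mulr_ge0
    | |- is_true (0 <= _ - _)%R => rewrite subr_ge0
    | |- is_true (0 <= _ + _)%R => apply: addr_ge0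
    | |- is_true (0 <= _ ^+ _)%R => apply: exprn_ge0
    | |- is_true (0 <= _^-1)%R => rewrite invr_ge0
    | |- is_true (0 <= Num.max _ 0)%R => rewrite le_max lexx orbT
    | |- is_true (0 <= \prod_(i <- _ | _) _)%R => apply: prodr_ge0 => ? _
    | |- is_true (0 <= \sum_(i <- _ | _) _)%R => apply: sumr_ge0 => ? _
    end
  | by [] ].

(** * Products of sigma-finite measures *)

Section SigmaFiniteProduct.
Context d1 d2 (T1 : measurableType d1) (T2 : measurableType d2) (R : realType).
Variables (m1 : {sigma_finite_measure set T1 -> \bar R}).
Variables (m2 : {sigma_finite_measure set T2 -> \bar R}).

(** A named copy of the product measure, to which sigma-finiteness is attached as an instance so
    that products can be nested. *)
Definition prod_meas : set (T1 * T2) -> \bar R := (m1 \x m2)%E.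

HB.instance Definition _ := Measure.copy prod_meas (m1 \x m2)%E.

Lemma prod_meas_sigma_finite : sigma_finite setT prod_meas.
Proof.
have /sigma_finiteP[F [FT ndF Foo]] := sigma_finiteT m1.
have /sigma_finiteP[G [GT ndG Goo]] := sigma_finiteT m2.
exists (fun n => F n `*` G n) => [|n].
  apply/seteqP; split=> // -[x y] _.
  have [i _ Fx] : (\bigcup_n F n) x by rewrite -FT.
  have [j _ Gy] : (\bigcup_n G n) y by rewrite -GT.
  exists (maxn i j) => //; split => /=.
    by move: Fx; apply/subsetPset/ndF; exact: leq_maxl.
  by move: Gy; apply/subsetPset/ndG; exact: leq_maxr.
have [mF Fn] := Foo n; have [mG Gn] := Goo n.
split; first exact: measurableX.
by rewrite /prod_meas product_measure1E// lte_mul_pinfty// ge0_fin_numE.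
Qed.

HB.instance Definition _ := Measure_isSigmaFinite.Build _ _ _ prod_meas
  prod_meas_sigma_finite.

Lemma prod_measE (f : T1 * T2 -> \bar R) : measurable_fun setT f ->
  (forall p, 0 <= f p)%E ->
  (\int[prod_meas]_p f p = \int[m1]_x \int[m2]_y f (x, y))%E.
Proof. by move=> mf f0; exact: (@fubini_tonelli1 _ _ _ _ _ m1 m2 f mf f0). Qed.

End SigmaFiniteProduct.

(** * Iterated integrals as integrals against a single measure *)

Section IteratedIntegrals.
Context {R : realType}.
Local Notation mu := (@lebesgue_measure R).
Local Notation mu3 := (prod_meas mu (prod_meas mu mu)).

Definition row3 (x y z : R) : 'rV[R]_3 :=
  \row_(c < 3) (if nat_of_ord c == 0%N then x else if nat_of_ord c == 1%N then y else z).

Definition row3p (p : R * (R * R)) : 'rV[R]_3 := row3 p.1 p.2.1 p.2.2.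

(** Measurability is tested by composition with all coordinatewise measurable maps. This stands in
    for a choice of sigma-algebra on vectors and configurations, and it composes directly with
    [consP], [rem] and the parametrizations of the integrals. *)
Definition rmeasurable (g : 'rV[R]_3 -> \bar R) := forall d (T : measurableType d)
  (h : T -> 'rV[R]_3), (forall c, measurable_fun setT (fun t => h t 0 c)) ->
  measurable_fun setT (fun t => g (h t)).

Definition cmeasurable n (f : cfg R n -> \bar R) := forall d (T : measurableType d)
  (h : T -> cfg R n), (forall i c, measurable_fun setT (fun t => h t i 0 c)) ->
  measurable_fun setT (fun t => f (h t)).

Lemma measurable_row3 d (T : measurableType d) (a b c : T -> R) :
  measurable_fun setT a -> measurable_fun setT b -> measurable_fun setT c ->
  forall j, measurable_fun setT (fun t => row3 (a t) (b t) (c t) 0 j).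
Proof.
move=> ma mb mc [[|[|j]] hj]; under eq_fun do rewrite mxE //=; by [].
Qed.

Lemma measurable_row3p c : measurable_fun setT (fun p => row3p p 0 c).
Proof. by apply: measurable_row3; mfun. Qed.

Lemma measurable_consP n d (T : measurableType d) (a : T -> 'rV[R]_3) (h : T -> cfg R n) :
  (forall c, measurable_fun setT (fun t => a t 0 c)) ->
  (forall i c, measurable_fun setT (fun t => h t i 0 c)) ->
  forall i c, measurable_fun setT (fun t => consP (a t) (h t) i 0 c).
Proof.
move=> ma mh i c; rewrite /consP.
by case: (unlift ord0 i) => [j|]; [exact: mh|exact: ma].
Qed.

Lemma int3E (g : 'rV[R]_3 -> \bar R) : rmeasurable g -> (forall x, 0 <= g x)%E ->
  int3 g = (\int[mu3]_p g (row3p p))%E.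
Proof.
move=> mg g0.
have m1 : measurable_fun setT (fun p => g (row3p p)).
  by apply: mg => c; exact: measurable_row3p.
rewrite prod_measE//.
apply: eq_integral => x _; rewrite prod_measE//.
apply: (mg _ _ (fun p => row3p (x, p))) => c.
by rewrite /row3p/=; apply: measurable_row3; mfun.
Qed.

(** The domain is a nested product depending on [n], hence the existential. One measure and one
    parametrization serve all admissible integrands, which transfers the theory of a single integral
    to the recursively defined [intP]. *)
Lemma intP_measure n : exists d (T : measurableType d)
    (nu : {sigma_finite_measure set T -> \bar R}) (h : T -> cfg R n),
  (forall i c, measurable_fun setT (fun t => h t i 0 c)) /\
  forall f, cmeasurable f -> (forall k, 0 <= f k)%E -> intP f = (\int[nu]_t f (h t))%E.
Proof.
elim: n => [|n [d [T [nu [h [mh nuE]]]]]].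
  (* No particles: a Dirac mass on one point, matching the base case of [intP]. *)
  exists _, unit, (\d_tt : {sigma_finite_measure set unit -> \bar R}), (fun _ _ => 0).
  split=> [[]//|f mf f0 /=].
  by rewrite integral_dirac//= diracT mul1e.
exists _, _, (prod_meas mu3 nu),
  (fun p => consP (row3p p.1) (h p.2)); split.
  apply: measurable_consP => [c|i c].
    exact: (measurableT_comp (measurable_row3p c) measurable_fst).
  exact: (measurableT_comp (mh i c) measurable_snd).
move=> f mf f0 /=; set g := fun k : 'rV[R]_3 => _.
have gE k : g k = (\int[nu]_t f (consP k (h t)))%E.
  rewrite /g nuE// => e U q mq; apply: mf; apply: measurable_consP => //.
have mg : rmeasurable g.
  move=> e U q mq; under eq_fun do rewrite gE.
  apply: (@measurable_fun_fubini_tonelli_F _ _ _ _ _ nu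
    (fun p : U * T => f (consP (q p.1) (h p.2)))) => //.
  apply: mf; apply: measurable_consP => [c|i c].
    exact: (measurableT_comp (mq c) measurable_fst).
  exact: (measurableT_comp (mh i c) measurable_snd).
rewrite int3E// => [|k]; last by rewrite gE; exact: integral_ge0.
rewrite [RHS]prod_measE//; last first.
  apply: mf; apply: measurable_consP => [c|i c].
    exact: (measurableT_comp (measurable_row3p c) measurable_fst).
  exact: (measurableT_comp (mh i c) measurable_snd).
by apply: eq_integral => p _; rewrite gE.
Qed.

End IteratedIntegrals.

(** * Monotonicity, linearity, Tonelli and factorization for [int3] and [intP] *)

Section IteratedIntegralsTheory.
Context {R : realType}.
Local Notation mu := (@lebesgue_measure R).
Local Notation mu3 := (prod_meas mu (prod_meas mu mu)).
Implicit Types (f g : 'rV[R]_3 -> \bar R).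
Local Open Scope ereal_scope.

Lemma rmeasurable_row3p g : rmeasurable g -> measurable_fun setT (fun p => g (row3p p)).
Proof. by apply; exact: measurable_row3p. Qed.

Lemma int3_ge0 g : (forall x, 0 <= g x) -> 0 <= int3 g.
Proof. by move=> g0; do 3!apply: integral_ge0 => ? _. Qed.

Lemma int3_le f g : rmeasurable f -> rmeasurable g ->
  (forall x, 0 <= f x) -> (forall x, f x <= g x) -> int3 f <= int3 g.
Proof.
move=> mf mg f0 fg; have g0 x : 0 <= g x by exact: le_trans (fg x).
by rewrite !int3E//; apply: ge0_le_integral => //; exact: rmeasurable_row3p.
Qed.

Lemma int3D f g : rmeasurable f -> rmeasurable g ->
  (forall x, 0 <= f x) -> (forall x, 0 <= g x) ->
  int3 (fun x => f x + g x) = int3 f + int3 g.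
Proof.
move=> mf mg f0 g0; rewrite !int3E//; last 2 first.
- by move=> d T h mh; apply: emeasurable_funD; [exact: mf|exact: mg].
- by move=> x; rewrite adde_ge0.
by rewrite ge0_integralD//; exact: rmeasurable_row3p.
Qed.

Lemma int3Z f (c : R) : rmeasurable f -> (forall x, 0 <= f x) -> (0 <= c)%R ->
  int3 (fun x => c%:E * f x) = c%:E * int3 f.
Proof.
move=> mf f0 c0; rewrite !int3E//; last 2 first.
- by move=> d T h mh; apply: measurable_funeM; exact: mf.
- by move=> x; rewrite mule_ge0.
by rewrite ge0_integralZl_EFin//; exact: rmeasurable_row3p.
Qed.

Section intP.
Variable n : nat.
Implicit Types u v : cfg R n -> \bar R.

Lemma intP_ge0 u : (forall k, 0 <= u k) -> 0 <= intP u.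
Proof.
elim: n u => [|m IH] u u0 /=; first exact: u0.
by apply: int3_ge0 => k; exact: IH.
Qed.

Lemma intP_le u v : cmeasurable u -> cmeasurable v ->
  (forall x, 0 <= u x) -> (forall x, u x <= v x) -> intP u <= intP v.
Proof.
move=> mu mv u0 uv; have v0 x : 0 <= v x by exact: le_trans (uv x).
have [d [T [nu [h [mh nuE]]]]] := @intP_measure R n.
by rewrite !nuE//; apply: ge0_le_integral => //; [exact: mu|exact: mv].
Qed.

Lemma intPD u v : cmeasurable u -> cmeasurable v ->
  (forall x, 0 <= u x) -> (forall x, 0 <= v x) ->
  intP (fun x => u x + v x) = intP u + intP v.
Proof.
move=> mu mv u0 v0; have [d [T [nu [h [mh nuE]]]]] := @intP_measure R n.
rewrite !nuE//; last 2 first.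
- by move=> e U q mq; apply: emeasurable_funD; [exact: mu|exact: mv].
- by move=> x; rewrite adde_ge0.
by rewrite ge0_integralD//; [exact: mu|exact: mv].
Qed.

Lemma intPZ u (c : R) : cmeasurable u -> (forall x, 0 <= u x) -> (0 <= c)%R ->
  intP (fun x => c%:E * u x) = c%:E * intP u.
Proof.
move=> mu u0 c0; have [d [T [nu [h [mh nuE]]]]] := @intP_measure R n.
rewrite !nuE//; last 2 first.
- by move=> e U q mq; apply: measurable_funeM; exact: mu.
- by move=> x; rewrite mule_ge0.
by rewrite ge0_integralZl_EFin//; exact: mu.
Qed.

Lemma intP_sum (I : Type) (s : seq I) (u : I -> cfg R n -> \bar R) :
  (forall i, cmeasurable (u i)) -> (forall i x, 0 <= u i x) ->
  intP (fun x => \sum_(i <- s) u i x) = \sum_(i <- s) intP (u i).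
Proof.
move=> mu u0; have [d [T [nu [h [mh nuE]]]]] := @intP_measure R n.
rewrite !nuE//; last 2 first.
- by move=> e U q mq; apply: emeasurable_sum => i; exact: mu.
- by move=> x; rewrite sume_ge0.
rewrite ge0_integral_sum//; last by move=> i; exact: mu.
by apply: eq_bigr => i _; rewrite nuE.
Qed.

Variable F : 'rV[R]_3 -> cfg R n -> \bar R.
Hypothesis mF : forall d (T : measurableType d) (a : T -> 'rV[R]_3) (h : T -> cfg R n),
  (forall c, measurable_fun setT (fun t => a t 0%R c)) ->
  (forall i c, measurable_fun setT (fun t => h t i 0%R c)) ->
  measurable_fun setT (fun t => F (a t) (h t)).
Hypothesis F0 : forall a k, 0 <= F a k.

Let mFl a : cmeasurable (F a).
Proof. by move=> d T h mh; apply: mF => // c; exact: measurable_cst. Qed.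

Let mFr k : rmeasurable (F ^~ k).
Proof. by move=> d T h mh; apply: mF => // i c; exact: measurable_cst. Qed.

Lemma rmeasurable_intP : rmeasurable (fun a => intP (F a)).
Proof.
have [d [T [nu [h [mh nuE]]]]] := @intP_measure R n.
move=> e U q mq; under eq_fun do rewrite nuE//.
apply: (@measurable_fun_fubini_tonelli_F _ _ _ _ _ nu
  (fun p : U * T => F (q p.1) (h p.2))) => //.
apply: mF => [c|i c].
  exact: (measurableT_comp (mq c) measurable_fst).
exact: (measurableT_comp (mh i c) measurable_snd).
Qed.

Lemma cmeasurable_int3 : cmeasurable (fun k => int3 (F ^~ k)).
Proof.
move=> e U q mq; under eq_fun do rewrite int3E//.
apply: (@measurable_fun_fubini_tonelli_F _ _ _ _ _ mu3
  (fun p => F (row3p p.2) (q p.1))) => //.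
apply: mF => [c|i c].
  exact: (measurableT_comp (measurable_row3p c) measurable_snd).
exact: (measurableT_comp (mq i c) measurable_fst).
Qed.

(** Used in [intP_swap] to make the exchanged momentum the innermost variable. *)
Lemma int3_intP : int3 (fun a => intP (F a)) = intP (fun k => int3 (F ^~ k)).
Proof.
have [d [T [nu [h [mh nuE]]]]] := @intP_measure R n.
rewrite int3E//; [|exact: rmeasurable_intP|by move=> a; exact: intP_ge0].
rewrite nuE//; [|exact: cmeasurable_int3|by move=> a; exact: int3_ge0].
under eq_integral do rewrite nuE//.
under [RHS]eq_integral do rewrite int3E//.
apply: (@fubini_tonelli _ _ _ _ _ mu3 nu (fun p => F (row3p p.1) (h p.2))) => //.
apply: mF => [c|i c].
  exact: (measurableT_comp (measurable_row3p c) measurable_fst).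
exact: (measurableT_comp (mh i c) measurable_snd).
Qed.

End intP.

Lemma cmeasurable_prod n (g : 'I_n -> 'rV[R]_3 -> R) :
  (forall i, rmeasurable (EFin \o g i)) ->
  cmeasurable (fun k : cfg R n => (\prod_(i < n) g i (k i))%:E).
Proof.
move=> mg d T h mh; apply/measurable_EFinP; apply: measurable_fun_prodr => i.
by apply/measurable_EFinP; apply: (mg i).
Qed.

Lemma intP_prod n (g : 'I_n -> 'rV[R]_3 -> R) (b : 'I_n -> R) :
  (forall i, rmeasurable (EFin \o g i)) -> (forall i x, (0 <= g i x)%R) ->
  (forall i, int3 (EFin \o g i) = (b i)%:E) ->
  intP (fun k => (\prod_(i < n) g i (k i))%:E) = (\prod_(i < n) b i)%:E.
Proof.
elim: n g b => [|n IH] g b mg g0 gb /=; first by rewrite !big_ord0.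
have pE k : intP (fun ks => (\prod_(i < n.+1) g i (consP k ks i))%:E) =
    (\prod_(i < n) b (lift ord0 i))%:E * (g ord0 k)%:E.
  under [X in intP X]funext => ks.
    rewrite big_ord_recl /consP unlift_none.
    under eq_bigr do rewrite liftK.
    rewrite EFinM; over.
  rewrite intPZ//; last 2 first.
  - by apply: (@cmeasurable_prod n (fun i => g (lift ord0 i))) => i; exact: mg.
  - by move=> x; rewrite lee_fin prodr_ge0.
  by rewrite (IH (fun i => g (lift ord0 i)) (fun i => b (lift ord0 i)))// muleC.
under [X in int3 X]funext do rewrite pE.
rewrite int3Z//.
- by rewrite (gb ord0) muleC -EFinM big_ord_recl.
- exact: mg.
- by move=> x; rewrite lee_fin.
- apply: prodr_ge0 => i _; rewrite -lee_fin -gb.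
  by apply: int3_ge0 => x; rewrite lee_fin.
Qed.

End IteratedIntegralsTheory.

(** * Computation of derivatives and limits *)

Section Derivatives.
Context {R : realType}.
Implicit Types (f g : R -> R) (x a b : R).

(* Not a type class, so that instance resolution does not choose the derivative. *)
Definition has_derivative f x a : Prop := is_derive x 1 f a.

(** With [a] left as an existential variable, [derive] computes some expression for it; the
    remaining equation is then an algebraic identity. *)
Lemma is_derive_from f x a b : has_derivative f x a -> a = b -> is_derive x 1 f b.
Proof. by move=> fa <-. Qed.

Lemma is_derive_const (k : R) x : has_derivative (fun=> k) x 0.
Proof. exact: is_derive_cst. Qed.
Lemma is_derive_add f g x a b : has_derivative f x a -> has_derivative g x b ->
  has_derivative (fun y => f y + g y) x (a + b).
Proof. by move=> fa gb; exact: is_deriveD. Qed.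
Lemma is_derive_opp f x a : has_derivative f x a -> has_derivative (fun y => - f y) x (- a).
Proof. by move=> fa; exact: is_deriveN. Qed.
Lemma is_derive_mul f g x a b : has_derivative f x a -> has_derivative g x b ->
  has_derivative (fun y => f y * g y) x (f x * b + g x * a).
Proof. by move=> fa gb; exact: is_deriveM. Qed.
Lemma is_derive_exp f n x a : has_derivative f x a ->
  has_derivative (fun y => f y ^+ n) x (n%:R * f x ^+ n.-1 * a).
Proof.
move=> fa; have := @is_deriveX R R f n x 1 a fa.
by congr (is_derive _ _ _ _); apply/funext => y; rewrite fctE.
Qed.
Lemma is_derive_inv f x a : f x != 0 -> has_derivative f x a ->
  has_derivative (fun y => (f y)^-1) x (- (f x) ^- 2 * a).
Proof.
move=> fx0 [df <-]; apply: (@DeriveDef _ _ _ _ _ (fun y => (f y)^-1)).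
  exact: derivableV.
by rewrite deriveV.
Qed.
Lemma is_derive_sqrt f x a : 0 < f x -> has_derivative f x a ->
  has_derivative (fun y => Num.sqrt (f y)) x ((2 * Num.sqrt (f x))^-1 * a).
Proof. by move=> fx0 fa; exact: (is_derive1_comp (is_derive1_sqrt fx0) fa). Qed.
Lemma is_derive_atan f x a : has_derivative f x a ->
  has_derivative (fun y => atan (f y)) x ((1 + f x ^+ 2)^-1 * a).
Proof. by move=> fa; exact: (is_derive1_comp (is_derive1_atan (f x)) fa). Qed.

Lemma is_derive_continuous f x a : is_derive x 1 f a -> {for x, continuous f}.
Proof.
by move=> [df _]; apply: differentiable_continuous; exact/derivable1_diffP.
Qed.

Lemma cvg_sqrt (T : Type) (F : set_system T) (FF : Filter F) (f : T -> R) (a : R) :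
  f @ F --> a -> (fun t => Num.sqrt (f t)) @ F --> Num.sqrt a.
Proof. by move=> fa; apply: continuous_cvg => //; exact: sqrt_continuous. Qed.

Lemma cvg_exprn (T : Type) (F : set_system T) (FF : Filter F) (f : T -> R) (a : R) n :
  f @ F --> a -> (fun t => f t ^+ n) @ F --> a ^+ n.
Proof.
move=> fa; elim: n => [|n IH]; first exact: cvg_cst.
by under eq_cvg do rewrite exprS; rewrite exprS; exact: cvgM.
Qed.

End Derivatives.

Ltac derive_step :=
  lazymatch goal with
  | |- has_derivative (fun y => _ + _)%R _ _ => apply: is_derive_add
  | |- has_derivative (fun y => - _)%R _ _ => apply: is_derive_opp
  | |- has_derivative (fun y => _ * _)%R _ _ => apply: is_derive_mul
  | |- has_derivative (fun y => _ ^+ _)%R _ _ => apply: is_derive_exp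
  | |- has_derivative (fun y => _^-1)%R _ _ => apply: is_derive_inv
  | |- has_derivative (fun y => Num.sqrt _) _ _ => apply: is_derive_sqrt
  | |- has_derivative (fun y => atan _) _ _ => apply: is_derive_atan
  | |- has_derivative (fun y => y) _ _ => exact: is_derive_id
  | |- has_derivative (fun y => ?c) _ _ => exact: is_derive_const
  end.
Ltac derive := repeat first [simple apply is_derive_const | derive_step].

Ltac cvgs := repeat lazymatch goal with
  | |- cvg_to (nbhs (fmap (fun y => _ + _)%R _)) _ => apply: cvgD
  | |- cvg_to (nbhs (fmap (fun y => - _)%R _)) _ => apply: cvgN
  | |- cvg_to (nbhs (fmap (fun y => _ * _)%R _)) _ => apply: cvgM
  | |- cvg_to (nbhs (fmap (fun y => _ ^+ _)%R _)) _ => apply: cvg_exprn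
  | |- cvg_to (nbhs (fmap (fun y => _^-1)%R _)) _ => apply: cvgV
  | |- cvg_to (nbhs (fmap (fun y => Num.sqrt _) _)) _ => apply: cvg_sqrt
  | |- cvg_to (nbhs (fmap (fun y => y) _)) _ => exact: cvg_id
  | |- cvg_to (nbhs (fmap (fun y => ?c) _)) _ => exact: cvg_cst
  end.

(** * Integrals over the line of inverse powers of a shifted quadratic *)

Section LineIntegrals.
Context {R : realType}.
Local Notation mu := (@lebesgue_measure R).

Lemma integral_shift (f : R -> R) (h : R) : continuous f -> (forall x, 0 <= f x) ->
  (\int[mu]_x (f (x + h))%:E = \int[mu]_x (f x)%:E)%E.
Proof.
move=> cf f0; have dE : (fun x : R => x + h)^`() = cst 1.
  apply/funext => x; rewrite derive1E.
  have [_ ->] : has_derivative (fun x => x + h) x (1 + 0) by derive.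
  by rewrite addr0.
rewrite [RHS](@increasing_ge0_integration_by_substitutionT R (fun x => x + h) f)// ?dE//.
- by apply: eq_integral => x _; congr EFin; rewrite -[RHS]/(f (x + h) * 1) mulr1.
- by move=> x y; rewrite ltrD2r.
- by move=> x; exact: cvg_cst.
- exact: is_cvg_cst.
- exact: is_cvg_cst.
- exact: cvg_addrr_Ny.
- exact: cvg_addrr.
Qed.

(** Evenness doubles the half-line integral, which is the limit of the antiderivative vanishing at
    0. The shift [h] is carried along because completing the square in the Feynman denominators
    moves the centre. *)
Lemma integral_even (f F : R -> R) (l : R) :
  (forall x, 0 <= f x) -> continuous f -> (forall x, f (- x) = f x) ->
  (forall x : R, is_derive x 1 F (f x)) -> F 0 = 0 -> F x @[x --> +oo] --> l ->
  forall h, (\int[mu]_x (f (x + h))%:E = (2 * l)%:E)%E.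
Proof.
move=> f0 cf fN dF F0 Fl h; rewrite integral_shift//.
rewrite ge0_symfun_integralT//; last by move=> x; rewrite /= fN.
rewrite -set_itvcy (@ge0_continuous_FTC2y R f F 0 l)//.
- by rewrite F0 sube0 EFinM.
- by move=> x; exact: continuous_subspaceT.
- apply: cvg_at_right_filter; exact: (is_derive_continuous (dF 0)).
- by move=> x _; rewrite derive1E; have [_ ->] := dF x.
Qed.

Lemma cvgy_div_sqrt (c : R) : 0 < c -> x / Num.sqrt (x ^+ 2 + c) @[x --> +oo] --> (1 : R).
Proof.
move=> c0.
have i0 : (x : R)^-1 @[x --> +oo] --> 0.
  by apply/gtr0_cvgV0; [exact: nbhs_pinfty_gt|exact: cvg_id].
(* The lower barrier rests on [sqrt (x^2 + c) <= x + sqrt c] and [(1 - sqrt c / x) (x + sqrt c) = x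
   - c / x <= x]. *)
apply: (@squeeze_cvgr _ _ _ _ (fun x => 1 - Num.sqrt c * x^-1) (cst 1)); last 2 first.
- have : (fun x => 1 - Num.sqrt c * x^-1) @ +oo --> 1 - Num.sqrt c * 0 by cvgs.
  by rewrite mulr0 subr0.
- exact: cvg_cst.
near=> x; have x0 : 0 < x by near: x; exact: nbhs_pinfty_gt.
have sc : 0 < Num.sqrt c by rewrite sqrtr_gt0.
have r0 : 0 < Num.sqrt (x ^+ 2 + c) by rewrite sqrtr_gt0 addr_gt0 ?exprn_gt0.
have rx : x <= Num.sqrt (x ^+ 2 + c).
  by rewrite -[leLHS](ger0_norm (ltW x0)) -sqrtr_sqr ler_wsqrtr// lerDl ltW.
have rxc : Num.sqrt (x ^+ 2 + c) <= x + Num.sqrt c.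
  rewrite -[leRHS]ger0_norm; last by rewrite addr_ge0 ?ltW.
  rewrite -sqrtr_sqr ler_wsqrtr// -{1}(sqr_sqrtr (ltW c0)).
  by move: (Num.sqrt c) sc => t t0; nra.
rewrite ler_pdivrMr// mul1r rx andbT ler_pdivlMr//.
have [h|/ltW h] := leP (1 - Num.sqrt c / x) 0.
  by apply: le_trans (ltW x0); exact: mulr_le0_ge0 h (ltW r0).
apply: le_trans (ler_wpM2l h rxc) _.
have -> : (1 - Num.sqrt c / x) * (x + Num.sqrt c) = x - Num.sqrt c ^+ 2 / x.
  by field; rewrite gt_eqF.
by rewrite gerBl divr_ge0 ?sqr_ge0 ?ltW.
Unshelve. all: end_near. Qed.

Section powers.
Variables (c : R) (c0 : 0 < c).
Let r (x : R) : R := Num.sqrt (x ^+ 2 + c).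
Let q_gt0 x : 0 < x ^+ 2 + c. Proof. by rewrite ltr_wpDl ?sqr_ge0. Qed.
Let r_gt0 x : 0 < r x. Proof. by rewrite sqrtr_gt0. Qed.
Let r_neq0 x : r x != 0. Proof. by rewrite gt_eqF. Qed.
(** Eliminating [c] in this way turns the derivative checks below into rational identities in [x]
    and [r x], within reach of [field]. *)
Let cE x : c = r x ^+ 2 - x ^+ 2.
Proof. by rewrite /r sqr_sqrtr ?(ltW (q_gt0 x))// addrAC subrr add0r. Qed.
Let c_neq0 x : r x ^+ 2 - x ^+ 2 != 0. Proof. by rewrite -cE gt_eqF. Qed.

Let cr : continuous r.
Proof. by move=> x; apply: cvg_sqrt; cvgs. Qed.

Let dr (x : R) : is_derive x 1 r (x / r x).
Proof.
apply: is_derive_from; first by rewrite /r; derive.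
by rewrite -/(r x) /=; have := r_neq0 x; move: (r x) => t t0; field.
Qed.

Let rN x : r (- x) = r x. Proof. by rewrite /r sqrrN. Qed.

Lemma integral_inv_sqrt3 h :
  (\int[mu]_x (Num.sqrt ((x + h) ^+ 2 + c) ^- 3)%:E = (2 / c)%:E)%E.
Proof.
apply: (@integral_even (fun x => r x ^- 3) (fun x => c^-1 * (x / r x)) c^-1).
- by move=> x; rewrite invr_ge0 exprn_ge0 ?ltW.
- by move=> x; apply: cvgV; [rewrite expf_neq0|apply: cvg_exprn; exact: cr].
- by move=> x; rewrite rN.
- move=> x; apply: is_derive_from; first by derive; first [exact: r_neq0|exact: dr].
  have := r_neq0 x; have := c_neq0 x; rewrite /= (cE x); move: (r x) => t ht t0.
  by field; rewrite t0 ht.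
- by rewrite mul0r mulr0.
- have : (fun x => c^-1 * (x / r x)) @ +oo --> c^-1 * 1.
    by apply: cvgM; [exact: cvg_cst|exact: cvgy_div_sqrt].
  by rewrite mulr1.
Qed.

Lemma integral_inv_sqrt5 h :
  (\int[mu]_x (Num.sqrt ((x + h) ^+ 2 + c) ^- 5)%:E = (4 / (3 * c ^+ 2))%:E)%E.
Proof.
(* The value is put in the shape of the limit of the antiderivative, in which [x / r x] tends to
   1. *)
have -> : 4 / (3 * c ^+ 2) = 2 * (c ^- 2 * (1 - 3^-1 * 1 ^+ 3)).
  by field; rewrite gt_eqF.
apply: (@integral_even (fun x => r x ^- 5)
  (fun x => c ^- 2 * (x / r x - 3^-1 * (x / r x) ^+ 3))).
- by move=> x; rewrite invr_ge0 exprn_ge0 ?ltW.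
- by move=> x; apply: cvgV; [rewrite expf_neq0|apply: cvg_exprn; exact: cr].
- by move=> x; rewrite rN.
- move=> x; apply: is_derive_from; first by derive; first [exact: r_neq0|exact: dr].
  have := r_neq0 x; have := c_neq0 x; rewrite /= (cE x); move: (r x) => t ht t0.
  by field; rewrite t0 ht.
- by rewrite !mul0r expr0n/= mulr0 subrr mulr0.
- apply: cvgM; first exact: cvg_cst.
  apply: cvgB; first exact: cvgy_div_sqrt.
  by apply: cvgM; [exact: cvg_cst|apply: cvg_exprn; exact: cvgy_div_sqrt].
Qed.

Lemma cvgy_atan_div (a : R) : 0 < a -> atan (x / a) @[x --> +oo] --> (pi / 2 : R).
Proof.
move=> a0; apply: (@cvg_comp _ _ _ (fun x : R => x / a) (@atan R)).
  by apply: gt0_cvgMly; [rewrite invr_gt0|exact: cvg_id].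
exact: cvgy_atan.
Qed.

Lemma integral_inv_sqr h :
  (\int[mu]_x (((x + h) ^+ 2 + c)^-1)%:E = (pi / Num.sqrt c)%:E)%E.
Proof.
have s0 : 0 < Num.sqrt c by rewrite sqrtr_gt0.
have -> : pi / Num.sqrt c = 2 * ((Num.sqrt c)^-1 * (pi / 2)).
  by field; rewrite gt_eqF.
apply: (@integral_even (fun x => (x ^+ 2 + c)^-1)
  (fun x => (Num.sqrt c)^-1 * atan (x / Num.sqrt c))).
- by move=> x; rewrite invr_ge0 ltW.
- by move=> x; apply: cvgV; [rewrite gt_eqF|cvgs].
- by move=> x; rewrite sqrrN.
- move=> x; apply: is_derive_from; first by derive.
  have E : x ^+ 2 + c = x ^+ 2 + Num.sqrt c ^+ 2 by rewrite sqr_sqrtr ?ltW.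
  have := q_gt0 x; rewrite E.
  move: (Num.sqrt c) s0 => t t0 q0.
  by field; rewrite !gt_eqF// addrC.
- by rewrite mul0r atan0 mulr0.
- by apply: cvgM; [exact: cvg_cst|exact: cvgy_atan_div].
Qed.

Lemma integral_inv_sqr2 h :
  (\int[mu]_x (((x + h) ^+ 2 + c) ^- 2)%:E = (pi / (2 * Num.sqrt c ^+ 3))%:E)%E.
Proof.
have s0 : 0 < Num.sqrt c by rewrite sqrtr_gt0.
(* The factors [1] and [0] are the limits of [x / r x] and of the remaining [1 / r x] in the second
   term of the antiderivative. *)
have -> : pi / (2 * Num.sqrt c ^+ 3) =
    2 * ((2 * Num.sqrt c ^+ 3)^-1 * (pi / 2 + Num.sqrt c * (1 * 0))).
  by field; rewrite gt_eqF.
apply: (@integral_even (fun x => (x ^+ 2 + c) ^- 2) (fun x => (2 * Num.sqrt c ^+ 3)^-1 *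
  (atan (x / Num.sqrt c) + Num.sqrt c * (x / r x / r x)))).
- by move=> x; rewrite invr_ge0 exprn_ge0 ?ltW.
- by move=> x; apply: cvgV; [rewrite expf_neq0// gt_eqF|cvgs].
- by move=> x; rewrite sqrrN.
- move=> x; apply: is_derive_from; first by derive; first [exact: r_neq0|exact: dr].
  rewrite /=; have qE : x ^+ 2 = r x ^+ 2 - Num.sqrt c ^+ 2.
    by rewrite sqr_sqrtr ?(ltW c0)// (cE x) opprB addrC subrK.
  have -> : x ^+ 2 + c = r x ^+ 2 by rewrite (cE x) addrC subrK.
  rewrite -/(r x); move: (Num.sqrt c) s0 qE (r_gt0 x) => t t0 qE q0.
  have -> : (1 + (x / t) ^+ 2) = r x ^+ 2 / t ^+ 2.
    by rewrite expr_div_n qE; field; rewrite gt_eqF.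
  move: (r x) q0 qE => u u0 qE.
  transitivity ((u ^+ 2 - x ^+ 2) / (t ^+ 2 * u ^+ 4)); last first.
    by rewrite qE; field; rewrite !gt_eqF.
  by field; rewrite !gt_eqF.
- by rewrite !mul0r mulr0 addr0 atan0 mulr0.
- apply: cvgM; first exact: cvg_cst.
  apply: cvgD; first exact: cvgy_atan_div.
  apply: cvgM; first exact: cvg_cst.
  apply: cvgM; first exact: cvgy_div_sqrt.
  apply: (@squeeze_cvgr _ _ _ _ (cst 0) (fun x => x^-1)); last 2 first.
  + exact: cvg_cst.
  + by apply/gtr0_cvgV0; [exact: nbhs_pinfty_gt|exact: cvg_id].
  near=> x; have x0 : 0 < x by near: x; exact: nbhs_pinfty_gt.
  rewrite invr_ge0 ltW//= lef_pV2 ?posrE//.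
  by rewrite -[leLHS](ger0_norm (ltW x0)) -sqrtr_sqr ler_wsqrtr// lerDl ltW.
Unshelve. all: end_near. Qed.

End powers.

End LineIntegrals.

(** * Half-line integrals and the Feynman parametrization *)

Section Feynman.
Context {R : realType}.
Local Notation mu := (@lebesgue_measure R).

Lemma integral_indicator (A : pred R) (f : R -> R) : measurable [set x | A x] ->
  (\int[mu]_x ((A x)%:R * f x)%:E = \int[mu]_(x in [set x | A x]) (f x)%:E)%E.
Proof.
move=> mA; rewrite [RHS]integral_mkcond; apply: eq_integral => x _.
by rewrite patchE mem_setE -topredE/=; case: (A x); rewrite ?mul1r ?mul0r.
Qed.

Lemma swap_integral (g : R -> R -> R) : (forall x u, 0 <= g x u) ->
  measurable_fun setT (fun p : R * R => g p.1 p.2) ->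
  (\int[mu]_x \int[mu]_u (g x u)%:E = \int[mu]_u \int[mu]_x (g x u)%:E)%E.
Proof.
move=> g0 mg; apply: (@fubini_tonelli _ _ _ _ _ mu mu (fun p => (g p.1 p.2)%:E)).
  exact/measurable_EFinP.
by move=> x; rewrite lee_fin.
Qed.

(** With [r] the square root, [-(1/r + (p/c) (x + p)/r)] is an antiderivative; it equals [-r(0)/c]
    at 0 and tends to [-p/c]. *)
Lemma integral_half_line (c p : R) : 0 < c ->
  (\int[mu]_(x in `[0%R, +oo[) (x * Num.sqrt ((x + p) ^+ 2 + c) ^- 3)%:E =
   ((Num.sqrt (p ^+ 2 + c) - p) / c)%:E)%E.
Proof.
move=> c0; pose r x : R := Num.sqrt ((x + p) ^+ 2 + c).
have q0 x : 0 < (x + p) ^+ 2 + c by rewrite ltr_wpDl ?sqr_ge0.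
have r0 x : 0 < r x by rewrite sqrtr_gt0.
have rn0 x : r x != 0 by rewrite gt_eqF.
have dr (x : R) : is_derive x 1 r ((x + p) / r x).
  apply: is_derive_from; first by rewrite /r; derive.
  rewrite -/(r x) /=; move: (r x) (rn0 x) => t t0; by field.
pose F (x : R) : R := - ((r x)^-1 + p / c * ((x + p) / r x)).
have dF (x : R) : is_derive x 1 F (x * r x ^- 3).
  apply: is_derive_from; first by rewrite /F; derive; first [exact: rn0|exact: dr].
  rewrite /=.
  have cE : c = r x ^+ 2 - (x + p) ^+ 2.
    by rewrite /r sqr_sqrtr ?(ltW (q0 x))// addrAC subrr add0r.
  have : r x ^+ 2 - (x + p) ^+ 2 != 0 by rewrite -cE gt_eqF.
  rewrite [in X in _ -> X = _]cE; move: (r x) (rn0 x) => t t0 ht.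
  by field; rewrite t0.
have cvr : (x + p) / r x @[x --> +oo] --> (1 : R).
  apply: (@cvg_comp _ _ _ (fun x : R => x + p) (fun x => x / Num.sqrt (x ^+ 2 + c))).
    exact: cvg_addrr.
  exact: cvgy_div_sqrt.
rewrite (@ge0_continuous_FTC2y R (fun x => x * r x ^- 3) F 0 (- (0 + p / c * 1))).
- rewrite -EFinB; congr EFin; rewrite /F mulr1 !add0r opprK.
  have -> : Num.sqrt (p ^+ 2 + c) = r 0 by rewrite /r add0r.
  have cE : r 0 ^+ 2 = p ^+ 2 + c by rewrite /r add0r sqr_sqrtr// ltW// -[p]add0r.
  move: (r 0) (rn0 0) cE => t t0 cE; apply: (mulfI t0).
  rewrite [RHS]mulrA mulrBr -expr2 cE.
  by field; rewrite t0 gt_eqF.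
- by move=> x x0; rewrite mulr_ge0// invr_ge0 exprn_ge0 ?ltW.
- move=> x; apply: continuous_subspaceT => {}x; apply: cvgM; first exact: cvg_id.
  apply: cvgV; first by rewrite expf_neq0.
  by apply: cvg_exprn; exact: is_derive_continuous (dr x).
- apply: cvgN; apply: cvgD; last by apply: cvgM; [exact: cvg_cst|].
  apply: (@squeeze_cvgr _ _ _ _ (cst 0) (fun x => (x + p)^-1)); last 2 first.
  + exact: cvg_cst.
  + apply/gtr0_cvgV0; last exact: cvg_addrr.
    by near=> x; rewrite -ltrBlDr sub0r; near: x; apply: nbhs_pinfty_gt; exact: num_real.
  near=> x; have x0 : 0 < x + p.
    by rewrite -ltrBlDr sub0r; near: x; apply: nbhs_pinfty_gt; exact: num_real.
  rewrite invr_ge0 ltW//= lef_pV2 ?posrE//.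
  by rewrite -[leLHS](ger0_norm (ltW x0)) -sqrtr_sqr ler_wsqrtr// lerDl ltW.
- by move=> x _; have [] := dF x.
- by apply: cvg_at_right_filter; exact: (is_derive_continuous (dF 0)).
- by move=> x _; rewrite derive1E; have [_ ->] := dF x.
Unshelve. all: end_near. Qed.

(** The two signs select the positive and the negative part of [x]. The square root in the value is
    common to both, so it drops out of their difference. *)
Lemma integral_max_half (c p eps : R) : 0 < c -> eps = 1 \/ eps = -1 ->
  (\int[mu]_x (Num.max (eps * x) 0 * Num.sqrt ((x + p) ^+ 2 + c) ^- 3)%:E =
   ((Num.sqrt (p ^+ 2 + c) - eps * p) / c)%:E)%E.
Proof.
move=> c0 heps.
have cg q : continuous (fun x : R => Num.sqrt ((x + q) ^+ 2 + c) ^- 3).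
  move=> x; apply: cvgV; last by cvgs.
  by rewrite expf_neq0// gt_eqF// sqrtr_gt0 ltr_wpDl ?sqr_ge0.
case: heps => ->; last first.
  have -> : -1 * p = - p by rewrite mulN1r.
  rewrite -[p ^+ 2]sqrrN -integral_half_line//.
  transitivity (\int[mu]_(x in `]-oo, (- 0)%R]) ((- x) * Num.sqrt ((x + p) ^+ 2 + c) ^- 3)%:E)%E.
    rewrite oppr0 integral_mkcond [RHS]integral_mkcond; apply: eq_integral => x _.
    rewrite !patchE in_setT mem_setE/= in_itv/= mulN1r.
    by case: (leP x 0) => x0; [rewrite max_l// oppr_ge0|rewrite max_r ?mul0r// oppr_le0 ltW].
  rewrite ge0_integration_by_substitutionNy.
  - by apply: eq_integral => x _; rewrite /= opprK -sqrrN opprD opprK.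
  - apply: continuous_subspaceT => x; apply: cvgM; last exact: cg.
    exact: opp_continuous.
  - move=> x; rewrite in_itv/= oppr0 => x0; rewrite mulr_ge0//; first by rewrite oppr_ge0 ltW.
rewrite mul1r -integral_half_line// integral_mkcond [RHS]integral_mkcond.
apply: eq_integral => x _.
rewrite !patchE in_setT mem_setE/= in_itv/= andbT mul1r.
by case: (leP 0 x) => x0; rewrite ?mul0r.
Qed.

Lemma set_itv01 : [set u : R | 0 < u < 1] = `]0%R, 1%R[%classic.
Proof. by []. Qed.

(** The Feynman formula for [a^(-3/2) b^(-1)], with [u^2] in place of the usual parameter so that
    the weight is polynomial. With [r] the square root of the interpolated value, [b^-1 (u / r)^3]
    is an antiderivative. *)
Lemma feynman (a b : R) : 0 < a -> 0 < b ->
  (\int[mu]_u ((0 < u < 1)%R%:R *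
     (3 * u ^+ 2 * Num.sqrt (u ^+ 2 * a + (1 - u ^+ 2) * b) ^- 5))%:E =
   (Num.sqrt a ^- 3 * b^-1)%:E)%E.
Proof.
move=> a0 b0; rewrite integral_indicator; last first.
  by rewrite set_itv01; exact: measurable_itv.
pose q (u : R) := u ^+ 2 * a + (1 - u ^+ 2) * b.
pose r u : R := Num.sqrt (q u).
have q0 (u : R) : 0 <= u <= 1 -> 0 < q u.
  move=> /andP[u0 u1]; rewrite /q.
  have u2 : u ^+ 2 <= 1 by rewrite exprn_ile1.
  have [|h] := leP (u ^+ 2) (1/2) => [h|]; last by nra.
  by have := sqr_ge0 u; nra.
have r0 (u : R) : 0 <= u <= 1 -> r u != 0 by move=> /q0 qu; rewrite gt_eqF// sqrtr_gt0.
have dr (u : R) : 0 <= u <= 1 -> is_derive u 1 r (u * (a - b) / r u).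
  move=> u01; have ru := r0 _ u01; have qu := q0 _ u01.
  apply: is_derive_from; first by rewrite /r/q; derive.
  by rewrite -/(q u) -/(r u) /=; move: (r u) ru => t t0; field.
have cr (u : R) : 0 <= u <= 1 -> {for u, continuous r}.
  by move=> /dr; exact: is_derive_continuous.
pose F (u : R) : R := b^-1 * (u / r u) ^+ 3.
have dF (u : R) : 0 <= u <= 1 -> is_derive u 1 F (3 * u ^+ 2 * r u ^- 5).
  move=> u01; have ru := r0 _ u01; have := dr _ u01 => dru.
  apply: is_derive_from; first by rewrite /F; derive; first [exact: ru|exact: dru].
  rewrite /=.
  have : r u ^+ 2 = q u by rewrite sqr_sqrtr// ltW// q0.
  move: (r u) ru => t t0; rewrite /q => tE.
  transitivity (3 * u ^+ 2 * (t ^+ 2 - u ^+ 2 * (a - b)) / (b * t ^+ 5)).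
    by field; rewrite t0 gt_eqF.
  by rewrite tE; field; rewrite t0 gt_eqF.
have h01 : 0 <= (0 : R) <= 1 by rewrite lexx ler01.
have h11 : 0 <= (1 : R) <= 1 by rewrite lexx ler01.
transitivity (\int[mu]_(x in `[0%R, 1%R]) (3 * x ^+ 2 * r x ^- 5)%:E)%E.
  have mf : measurable_fun setT (fun x : R => 3 * x ^+ 2 * r x ^- 5).
    by rewrite /r /q; mfun.
  rewrite set_itv01 -(integral_itv_bndoo true false)//.
  by apply/measurable_EFinP; exact: measurable_funTS.
rewrite (@continuous_FTC2 _ _ F)//.
- rewrite -EFinB; congr EFin; rewrite /F mul0r expr0n/= mulr0 subr0.
  have -> : r 1 = Num.sqrt a by rewrite /r /q expr1n subrr mul0r mul1r addr0.
  by rewrite mul1r exprVn mulrC.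
- apply: continuous_in_subspaceT => u; rewrite inE/= in_itv/= => u01.
  apply: cvgM; first by cvgs.
  apply: cvgV; first by rewrite expf_neq0// r0.
  by apply: cvg_exprn; exact: cr.
- split.
  + by move=> u; rewrite in_itv/= => /andP[/ltW u0 /ltW u1]; have [|] := dF u; rewrite ?u0.
  + by apply: cvg_at_right_filter; exact: is_derive_continuous (dF 0 h01).
  + by apply: cvg_at_left_filter; exact: is_derive_continuous (dF 1 h11).
- move=> u; rewrite in_itv/= => /andP[/ltW u0 /ltW u1].
  by rewrite derive1E; have [|_ ->] := dF u; rewrite ?u0.
Qed.

End Feynman.

(** * The p-wave integrated against the inverse of a quadratic polynomial *)

Section PWaveKernel.
Context {R : realType}.
Local Notation mu := (@lebesgue_measure R).

Lemma dot3E (a b : 'rV[R]_3) :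
  dot3 a b = a 0 0 * b 0 0 + a 0 1 * b 0 1 + a 0 2%:R * b 0 2%:R.
Proof.
rewrite /dot3 !big_ord_recl big_ord0 addr0 addrA.
by congr (_ * _ + _ * _ + _ * _); congr (_ _ _); apply/val_inj.
Qed.

Lemma row3_0 (x y z : R) : row3 x y z 0 0 = x.
Proof. by rewrite mxE. Qed.
Lemma row3_1 (x y z : R) : row3 x y z 0 1 = y.
Proof. by rewrite mxE. Qed.
Lemma row3_2 (x y z : R) : row3 x y z 0 2%:R = z.
Proof. by rewrite mxE. Qed.

Lemma integralZ (k : R) (f : R -> R) : measurable_fun setT f -> (forall x, 0 <= f x) ->
  0 <= k -> (\int[mu]_x (k * f x)%:E = k%:E * \int[mu]_x (f x)%:E)%E.
Proof.
move=> mf f0 k0; under eq_integral do rewrite EFinM.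
rewrite ge0_integralZl_EFin//; first by move=> x _; rewrite lee_fin.
exact/measurable_EFinP.
Qed.

Section kernel.
Variables (v1 v2 v3 e : R).
Hypothesis ve : v1 ^+ 2 + v2 ^+ 2 + v3 ^+ 2 < e.
(** Completing the square: [u^2 |x|^2 + w (|x|^2 + 2 v.x + e) = |x + w v|^2 + w (e - w |v|^2)]. The
    constants [cu], [c2], [c3] are what stands beside the square in [x1], [x2], [x3]
    respectively. *)
Let w (u : R) := 1 - u ^+ 2.
Let cu (u : R) := w u * (e - w u * (v1 ^+ 2 + v2 ^+ 2 + v3 ^+ 2)).
Let c2 (x1 u : R) := (x1 + w u * v1) ^+ 2 + cu u.
Let c3 (x1 x2 u : R) := (x2 + w u * v2) ^+ 2 + c2 x1 u.

Let w01 u : 0 < u < 1 -> 0 < w u < 1.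
Proof. by move=> /andP[u0 u1]; rewrite /w; apply/andP; split; nra. Qed.

Let cu_gt0 u : 0 < u < 1 -> 0 < cu u.
Proof.
move=> /w01/andP[w0 w1]; rewrite /cu mulr_gt0// subr_gt0.
by apply: le_lt_trans ve; rewrite ler_piMl ?(ltW w1)// !addr_ge0 ?sqr_ge0.
Qed.

Let c2_gt0 x1 u : 0 < u < 1 -> 0 < c2 x1 u.
Proof. by move=> /cu_gt0 c0; rewrite /c2 ltr_wpDl ?sqr_ge0. Qed.

Let c3_gt0 x1 x2 u : 0 < u < 1 -> 0 < c3 x1 x2 u.
Proof. by move=> h; rewrite /c3 ltr_wpDl ?sqr_ge0// c2_gt0. Qed.

Let b x1 x2 x3 := x1 * x1 + x2 * x2 + x3 * x3 + 2 * (v1 * x1 + v2 * x2 + v3 * x3) + e.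

Let b_gt0 x1 x2 x3 : 0 < b x1 x2 x3.
Proof.
have -> : b x1 x2 x3 = (x1 + v1) ^+ 2 + (x2 + v2) ^+ 2 + (x3 + v3) ^+ 2 +
    (e - (v1 ^+ 2 + v2 ^+ 2 + v3 ^+ 2)) by rewrite /b; ring.
by rewrite ltr_wpDl ?subr_gt0// !addr_ge0 ?sqr_ge0.
Qed.

(** This and the next two lemmas integrate one coordinate each: Tonelli moves it inside the
    [u]-integral, and the exponent of the quadratic goes from -5/2 to -2 to -3/2. On the plane
    excluded by [x1 != 0] the p-wave factor of [kernel_integral1] vanishes. *)
Lemma kernel_integral3 x1 x2 : x1 != 0 ->
  (\int[mu]_x3 (Num.sqrt (x1 * x1 + x2 * x2 + x3 * x3) ^- 3 * (b x1 x2 x3)^-1)%:E =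
   \int[mu]_u ((0 < u < 1)%R%:R * (4 * u ^+ 2 * c3 x1 x2 u ^- 2))%:E)%E.
Proof.
move=> x10.
have a0 x3 : 0 < x1 * x1 + x2 * x2 + x3 * x3.
  by rewrite -!expr2 ltr_wpDr ?sqr_ge0// ltr_wpDr ?sqr_ge0// exprn_even_gt0.
under eq_integral do rewrite -feynman//.
rewrite swap_integral; last 2 first.
- by move=> x u; nneg.
- by rewrite /b; mfun.
apply: eq_integral => u _; case: (boolP (0 < u < 1)) => u01; last first.
  by under eq_integral do rewrite mul0r; rewrite mul0r integral0.
rewrite mul1r.
transitivity (\int[mu]_x (3 * u ^+ 2 * Num.sqrt ((x + w u * v3) ^+ 2 + c3 x1 x2 u) ^- 5)%:E)%E.
  apply: eq_integral => x _; rewrite mul1r; congr (_ * (Num.sqrt _ ^- 5))%:E.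
  by rewrite /c3 /c2 /cu /w /b; ring.
rewrite integralZ; [|by mfun|by move=> x; nneg|by nneg].
rewrite integral_inv_sqrt5 ?c3_gt0//.
by rewrite -EFinM; congr EFin; field; rewrite gt_eqF ?c3_gt0.
Qed.

Lemma kernel_integral2 x1 : x1 != 0 ->
  (\int[mu]_x2 \int[mu]_x3
     (Num.sqrt (x1 * x1 + x2 * x2 + x3 * x3) ^- 3 * (b x1 x2 x3)^-1)%:E =
   \int[mu]_u ((0 < u < 1)%R%:R * (2 * pi * u ^+ 2 * Num.sqrt (c2 x1 u) ^- 3))%:E)%E.
Proof.
move=> x10; under eq_integral do rewrite kernel_integral3//.
rewrite swap_integral; last 2 first.
- by move=> x u; nneg.
- by rewrite /c3 /c2 /cu /w; mfun.
apply: eq_integral => u _; case: (boolP (0 < u < 1)) => u01; last first.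
  by under eq_integral do rewrite mul0r; rewrite mul0r integral0.
rewrite mul1r; under eq_integral do rewrite mul1r.
rewrite integralZ; [|by rewrite /c3; mfun|by move=> x; nneg|by nneg].
rewrite integral_inv_sqr2 ?c2_gt0//.
rewrite -EFinM; congr EFin.
by field; rewrite gt_eqF// sqrtr_gt0 c2_gt0.
Qed.

Lemma kernel_integral1 eps : eps = 1 \/ eps = -1 ->
  (\int[mu]_x1 \int[mu]_x2 \int[mu]_x3 (Num.max (eps * x1) 0 *
     (Num.sqrt (x1 * x1 + x2 * x2 + x3 * x3) ^- 3 * (b x1 x2 x3)^-1))%:E =
   \int[mu]_u ((0 < u < 1)%R%:R * (2 * pi * u ^+ 2 *
     ((Num.sqrt ((w u * v1) ^+ 2 + cu u) - eps * (w u * v1)) / cu u)))%:E)%E.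
Proof.
move=> heps.
have bi0 x1 x2 x3 :
    0 <= Num.sqrt (x1 * x1 + x2 * x2 + x3 * x3) ^- 3 * (b x1 x2 x3)^-1.
  by nneg; rewrite ltW.
have max0 x : 0 <= Num.max (eps * x) 0 by rewrite le_max lexx orbT.
transitivity (\int[mu]_x1 \int[mu]_u ((0 < u < 1)%R%:R * (2 * pi * u ^+ 2 *
    (Num.max (eps * x1) 0 * Num.sqrt (c2 x1 u) ^- 3)))%:E)%E.
  apply: eq_integral => x1 _; have [->|x10] := eqVneq x1 0.
    rewrite mulr0 maxxx; under eq_integral.
      move=> x2 _; under eq_integral do rewrite mul0r.
      rewrite integral0; over.
    by rewrite integral0; under eq_integral do rewrite mul0r !mulr0; rewrite integral0.
  under eq_integral.
    move=> x2 _; rewrite integralZ//; last by rewrite /b; mfun.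
    over.
  rewrite ge0_integralZl_EFin//; last 2 first.
  - by move=> x _; apply: integral_ge0 => y _; rewrite lee_fin.
  - have := @measurable_fun_fubini_tonelli_F _ _ _ _ _ mu (fun p : R * R =>
      (Num.sqrt (x1 * x1 + p.1 * p.1 + p.2 * p.2) ^- 3 * (b x1 p.1 p.2)^-1)%:E).
    by apply; [rewrite /b; mfun|move=> x; rewrite lee_fin].
  rewrite kernel_integral2// -integralZ//.
  - by apply: eq_integral => u _; congr EFin; ring.
  - by rewrite /c2 /cu /w; mfun.
  - by move=> u; nneg.
rewrite swap_integral; last 2 first.
- by move=> x u; nneg.
- by rewrite /c2 /cu /w; mfun.
apply: eq_integral => u _; case: (boolP (0 < u < 1)) => u01; last first.
  by under eq_integral do rewrite mul0r; rewrite mul0r integral0.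
rewrite mul1r; under eq_integral do rewrite mul1r.
rewrite integralZ; [|by rewrite /c2; mfun|by move=> x; nneg|by nneg].
by rewrite integral_max_half ?cu_gt0.
Qed.

End kernel.

Lemma int3_kernel (v : 'rV[R]_3) (e eps : R) : dot3 v v < e -> eps = 1 \/ eps = -1 ->
  let q u := (1 - u ^+ 2) * (e - (1 - u ^+ 2) * dot3 v v) in
  int3 (fun t => (Num.max (eps * t 0 0) 0 *
    (Num.sqrt (dot3 t t) ^- 3 * (dot3 t t + 2 * dot3 v t + e)^-1))%:E) =
  (\int[mu]_u ((0 < u < 1)%R%:R * (2 * pi * u ^+ 2 *
     ((Num.sqrt (((1 - u ^+ 2) * v 0%R 0%R) ^+ 2 + q u)
       - eps * ((1 - u ^+ 2) * v 0%R 0%R)) / q u)))%:E)%E.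
Proof.
move=> ve heps q.
have vE : dot3 v v = v 0 0 ^+ 2 + v 0 1 ^+ 2 + v 0 2%:R ^+ 2 by rewrite dot3E !expr2.
rewrite vE in ve; rewrite /q vE -(kernel_integral1 ve heps) /int3.
do 3![apply: eq_integral => ? _].
by rewrite -/(row3 _ _ _) !dot3E !row3_0 !row3_1 !row3_2.
Qed.

End PWaveKernel.

(** * The angular integral and the critical mass *)

Section CriticalMass.
Context {R : realType}.
Local Notation mu := (@lebesgue_measure R).

(** The function [A] of the overview. The kernel estimate produces it as the integral in
    [integral_angular], whereas [LambdaMN] contains this closed form. *)
Definition angular (k : R) : R :=
  k ^- 2 * (1 - Num.sqrt (1 - k ^+ 2) / k * atan (k / Num.sqrt (1 - k ^+ 2))).

Lemma integral_angular (k : R) : 0 < k < 1 ->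
  (\int[mu]_u ((0 < u < 1)%R%:R * (u ^+ 2 / (1 - k ^+ 2 * (1 - u ^+ 2))))%:E =
   (angular k)%:E)%E.
Proof.
move=> /andP[k0 k1]; rewrite integral_indicator; last first.
  by rewrite set_itv01; exact: measurable_itv.
pose c := Num.sqrt (1 - k ^+ 2).
have k21 : 0 < 1 - k ^+ 2 by rewrite subr_gt0 expr_lt1 ?ltW.
have c0 : 0 < c by rewrite sqrtr_gt0.
have cE : c ^+ 2 = 1 - k ^+ 2 by rewrite sqr_sqrtr// ltW.
have q0 u : 0 < c ^+ 2 + k ^+ 2 * u ^+ 2 by rewrite ltr_wpDr ?exprn_gt0// -exprMn sqr_ge0.
pose F (u : R) : R := k ^- 2 * (u - c / k * atan (u * k / c)).
pose f (u : R) : R := u ^+ 2 / (c ^+ 2 + k ^+ 2 * u ^+ 2).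
have dF (u : R) : is_derive u 1 F (f u).
  apply: is_derive_from; first by rewrite /F; derive.
  rewrite /f /=; have := q0 u; move: c c0 {cE q0 F f} => c c0 q0.
  by field; rewrite exprMn !gt_eqF.
have cF u : {for u, continuous F} by exact: is_derive_continuous (dF u).
have cf : continuous f.
  move=> u; apply: cvgM; first by cvgs.
  by apply: cvgV; [rewrite gt_eqF|cvgs].
transitivity (\int[mu]_(x in `[0%R, 1%R]) (f x)%:E)%E.
  rewrite set_itv01 -(integral_itv_bndoo true false)//.
    apply: eq_integral => u _; congr (_ / _)%:E.
    by rewrite cE; ring.
  apply/measurable_EFinP/measurable_funTS.
  by mfun.
rewrite (@continuous_FTC2 _ _ F)//.
- rewrite -EFinB; congr EFin.
  by rewrite /F !mul0r atan0 mulr0 subr0 mulr0 subr0 mul1r.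
- exact: continuous_subspaceT.
- split=> [u _||]; first by have [] := dF u.
    by apply: cvg_at_right_filter; exact: cF.
  by apply: cvg_at_left_filter; exact: cF.
- by move=> u _; rewrite derive1E; have [_ ->] := dF u.
Qed.

(** Read off the integral representation, whose integrand increases with [k] pointwise; the closed
    form hides this. *)
Lemma angular_le (k l : R) : 0 < k -> k <= l -> l < 1 -> angular k <= angular l.
Proof.
move=> k0 kl l1; have l0 : 0 < l by exact: lt_le_trans kl.
have d0 u r : 0 < u < 1 -> 0 < r < 1 -> 0 < 1 - r ^+ 2 * (1 - u ^+ 2) :> R.
  move=> _ /andP[r0 r1].
  have -> : 1 - r ^+ 2 * (1 - u ^+ 2) = (1 - r ^+ 2) + (r * u) ^+ 2 by ring.
  by rewrite ltr_wpDr ?sqr_ge0// subr_gt0 expr_lt1 ?ltW.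
rewrite -lee_fin -!integral_angular ?k0 ?l0//; last by rewrite (le_lt_trans kl).
apply: ge0_le_integral => //.
- move=> u _; rewrite lee_fin; case: (boolP (0 < u < 1)) => u01; rewrite ?mul0r//.
  by rewrite mul1r divr_ge0 ?sqr_ge0// ltW// d0// k0 (le_lt_trans kl).
- by mfun.
- by mfun.
- move=> u _; rewrite lee_fin; case: (boolP (0 < u < 1)) => u01; rewrite ?mul0r// !mul1r.
  rewrite ler_wpM2l ?sqr_ge0// lef_pV2 ?posrE ?d0 ?l0 ?k0 ?(le_lt_trans kl)//.
  rewrite lerD2l lerN2 ler_wpM2r//; first by case/andP: u01 => u0 u1; nra.
  by rewrite ler_pXn2r ?nnegrE // ltW.
Qed.

Lemma asin_atan (k : R) : 0 < k < 1 -> asin k = atan (k / Num.sqrt (1 - k ^+ 2)).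
Proof.
move=> /andP[k0 k1]; have kk : -1 <= k <= 1 by lra.
have -> : k / Num.sqrt (1 - k ^+ 2) = tan (asin k) by rewrite /tan asinK// cos_asin.
by rewrite tanK// in_itv/= asin_gtNpi2 ?asin_ltpi2//; lra.
Qed.

Lemma LambdaMN2E (m : R) : 0 < m ->
  let k := (m + 1)^-1 in
  LambdaMN m 2 = 2 / pi * (k / Num.sqrt (1 - k ^+ 2)) * angular k.
Proof.
move=> m0 k; have m10 : 0 < m + 1 by lra.
have k0 : 0 < k by rewrite invr_gt0.
have k1 : k < 1 by rewrite invf_lt1//; lra.
have k2 : 0 < 1 - k ^+ 2 by rewrite subr_gt0 expr_lt1 ?ltW.
have c0 : 0 < Num.sqrt (1 - k ^+ 2) by rewrite sqrtr_gt0.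
have sE : Num.sqrt (m * (m + 2)) = Num.sqrt (1 - k ^+ 2) / k.
  have -> : m * (m + 2) = (1 - k ^+ 2) * (k^-1) ^+ 2.
    by rewrite /k; field; rewrite gt_eqF.
  by rewrite sqrtrM ?ltW// sqrtr_sqr ger0_norm// invr_ge0 ltW.
rewrite /LambdaMN sE -/k asin_atan ?k0// /angular -[m + 1]invrK -/k.
move: (Num.sqrt _) (atan _) c0 => c t c0.
have := @pi_gt0 R; move: (@pi R) => p p0.
by field; rewrite !gt_eqF.
Qed.

(** Both [k / sqrt (1 - k^2)] and [angular k] increase with [k], that is, as the mass decreases. The
    conclusion says [LambdaMN m 2 > 1] with denominators cleared, which is the comparison of the
    cross and diagonal coefficients. *)
Lemma LambdaMN2_gt1 (m mstar : R) : 0 < m -> m < mstar -> LambdaMN mstar 2 = 1 ->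
  let k := (m + 1)^-1 in
  pi * Num.sqrt (1 - k ^+ 2) < 2 * k * angular k.
Proof.
move=> m0 mm; rewrite LambdaMN2E; last by lra.
set l := (mstar + 1)^-1 => L1; set k := (m + 1)^-1; cbv zeta.
have k0 : 0 < k by rewrite invr_gt0; lra.
have l0 : 0 < l by rewrite invr_gt0; lra.
have lk : l < k by rewrite ltf_pV2 ?posrE; lra.
have k1 : k < 1 by rewrite invf_lt1; lra.
have lt1 : l < 1 by lra.
have ck : 0 < Num.sqrt (1 - k ^+ 2) by rewrite sqrtr_gt0 subr_gt0 expr_lt1 ?ltW.
have cl : 0 < Num.sqrt (1 - l ^+ 2) by rewrite sqrtr_gt0 subr_gt0 expr_lt1 ?ltW.
have cc : Num.sqrt (1 - k ^+ 2) <= Num.sqrt (1 - l ^+ 2).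
  by rewrite ler_wsqrtr// lerD2l lerN2 ler_pXn2r ?nnegrE ?ltW.
have alk := angular_le l0 (ltW lk) k1.
have pi0 := @pi_gt0 R.
have al : pi * Num.sqrt (1 - l ^+ 2) = 2 * l * angular l.
  have := congr1 (fun x => x * (pi * Num.sqrt (1 - l ^+ 2))) L1; rewrite mul1r => <-.
  by move: (@pi R) pi0 => p p0; field; rewrite !gt_eqF.
(* Needed for strictness: [angular] is only known to be monotone, so the strict inequality comes
   from [l < k]. *)
have al0 : 0 < angular l.
  have : 0 < 2 * l * angular l by rewrite -al mulr_gt0.
  by rewrite pmulr_rgt0 // mulr_gt0.
apply: (@le_lt_trans _ _ (2 * l * angular l)).
  by rewrite -al ler_wpM2l// ltW.
by rewrite -!mulrA ltr_pM2l// (@lt_le_trans _ _ (k * angular l))// ?ltr_pM2r// ler_wpM2l// ltW.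
Qed.

End CriticalMass.

(** * Slater determinants of orbitals with disjoint supports *)

Section Slater.
Context {R : realType}.

(** Rows are particles, columns are orbitals. There is no factor [1 / sqrt N!], so factorials appear
    in all norms. *)
Definition slater N (f : 'I_N -> 'rV[R]_3 -> R) (k : cfg R N) : R :=
  \det (\matrix_(i, j) f j (k i)).

(** Stronger than orthogonality in L^2: mixed terms vanish before any integration, which makes
    weights and kernels harmless. *)
Definition orthofam N (f : 'I_N -> 'rV[R]_3 -> R) :=
  forall j l x, j != l -> f j x * f l x = 0.

Lemma slaterE N (f : 'I_N -> 'rV[R]_3 -> R) k :
  slater f k = \sum_(s : 'S_N) (-1) ^+ s * \prod_i f (s i) (k i).
Proof.
by apply: eq_bigr => s _; congr (_ * _); apply: eq_bigr => i _; rewrite mxE.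
Qed.

Lemma sqr_sum_orthogonal (I : finType) (a : I -> R) :
  (forall i j, i != j -> a i * a j = 0) -> (\sum_i a i) ^+ 2 = \sum_i a i ^+ 2.
Proof.
move=> a0; rewrite expr2 mulr_suml; apply: eq_bigr => i _.
rewrite mulr_sumr (bigD1 i)//= -expr2 big1 ?addr0// => j ji.
by rewrite a0// eq_sym.
Qed.

Lemma prod_orthogonal N M (f : 'I_M -> 'rV[R]_3 -> R) (a b : 'I_N -> 'I_M) (k : cfg R N) :
  orthofam f -> (exists i, a i != b i) ->
  (\prod_i f (a i) (k i)) * (\prod_i f (b i) (k i)) = 0.
Proof.
move=> fo [i abi]; rewrite -big_split/= (bigD1 i)//= fo// mul0r//.
Qed.

Lemma slater_sqr N (f : 'I_N -> 'rV[R]_3 -> R) k : orthofam f ->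
  slater f k ^+ 2 = \sum_(s : 'S_N) \prod_i f (s i) (k i) ^+ 2.
Proof.
move=> fo; rewrite slaterE sqr_sum_orthogonal.
  by apply: eq_bigr => s _; rewrite exprMn sqrr_sign mul1r prodrXl.
move=> s t st; rewrite mulrACA prod_orthogonal ?mulr0//.
apply/existsP; rewrite -negb_forall; apply: contra st => /forallP h.
by apply/eqP/permP => i; exact/eqP.
Qed.

Lemma slater_antisym N (f : 'I_N -> 'rV[R]_3 -> R) : antisym (slater f).
Proof.
move=> s k; rewrite /slater.
have -> : (\matrix_(i, j) f j (k (s i))) = row_perm s (\matrix_(i, j) f j (k i)).
  by apply/matrixP => i j; rewrite !mxE.
by rewrite row_permE det_mulmx det_perm.
Qed.

Lemma consP0 n (x : 'rV[R]_3) (ks : cfg R n) : consP x ks ord0 = x.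
Proof. by rewrite /consP unlift_none. Qed.

Lemma consPS n (x : 'rV[R]_3) (ks : cfg R n) i : consP x ks (lift ord0 i) = ks i.
Proof. by rewrite /consP liftK. Qed.

Lemma slater_cons n (f : 'I_n.+1 -> 'rV[R]_3 -> R) x (ks : cfg R n) :
  slater f (consP x ks) =
  \sum_j f j x * ((-1) ^+ j * slater (fun l => f (lift j l)) ks).
Proof.
rewrite /slater (expand_det_row _ ord0); apply: eq_bigr => j _.
rewrite mxE consP0 /cofactor add0n; congr (_ * (_ * _)); congr (\det _).
by apply/matrixP => i l; rewrite !mxE consPS.
Qed.

(** The minor without column [j] contains column [l], which the other minor lacks. In the row where
    the first one uses [l], the two orbitals differ and their product is zero. *)
Lemma slater_lift_orth n (f : 'I_n.+1 -> 'rV[R]_3 -> R) j l (ks : cfg R n) :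
  orthofam f -> j != l ->
  slater (fun i => f (lift j i)) ks * slater (fun i => f (lift l i)) ks = 0.
Proof.
move=> fo jl; rewrite !slaterE mulr_suml big1// => s _.
rewrite mulr_sumr big1// => t _; rewrite mulrACA.
rewrite (@prod_orthogonal _ _ f (fun i => lift j (s i)) (fun i => lift l (t i))) ?mulr0//.
have [i li] : exists i, l = lift j i.
  by case: (unliftP j l) => [i ->|lj]; [exists i|rewrite lj eqxx in jl].
exists ((s^-1)%g i); rewrite permKV -li; exact: neq_lift.
Qed.

(** Two determinants with common spectators, as in the integrand of the cross term. Being diagonal
    in the orbital [j], the product separates the p-wave exchange from that of the cells. *)
Lemma slater_cons_mul n (f : 'I_n.+1 -> 'rV[R]_3 -> R) x y (ks : cfg R n) :
  orthofam f -> slater f (consP x ks) * slater f (consP y ks) =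
  \sum_j f j x * f j y * slater (fun i => f (lift j i)) ks ^+ 2.
Proof.
move=> fo; rewrite !slater_cons mulr_suml; apply: eq_bigr => j _.
rewrite mulr_sumr (bigD1 j)//= big1 ?addr0 => [|l lj].
  by rewrite mulrACA -expr2 exprMn sqrr_sign mul1r.
rewrite mulrACA [X in _ * X]mulrACA slater_lift_orth ?mulr0// eq_sym//.
Qed.

Lemma rem0_cons n (x : 'rV[R]_3) (q : cfg R n) : rem ord0 (consP x q) = q.
Proof. by apply/funext => i; rewrite /rem consPS. Qed.

Lemma rem1_cons n (x y : 'rV[R]_3) (ks : cfg R n) :
  rem (ord_1 n) (consP x (consP y ks)) = consP x ks.
Proof.
apply/funext => i; rewrite /rem; case: (unliftP ord0 i) => [j ->|->].
  have -> : lift (ord_1 n) (lift ord0 j) = lift ord0 (lift ord0 j) by apply/val_inj.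
  by rewrite !consPS.
have -> : lift (ord_1 n) ord0 = ord0 by apply/val_inj.
by rewrite !consP0.
Qed.

End Slater.

(** * One-particle integrals: reduction to the first coordinate *)

Section OneParticle.
Context {R : realType}.
Local Notation mu := (@lebesgue_measure R).

Definition nrm (t : 'rV[R]_3) : R := Num.sqrt (dot3 t t).

Lemma dot3_ge0 (t : 'rV[R]_3) : 0 <= dot3 t t.
Proof. by rewrite dot3E -!expr2; nneg. Qed.

Lemma nrm_sqr (t : 'rV[R]_3) : nrm t ^+ 2 = dot3 t t.
Proof. by rewrite sqr_sqrtr// dot3_ge0. Qed.

Lemma nrm_ge0 (t : 'rV[R]_3) : 0 <= nrm t.
Proof. exact: sqrtr_ge0. Qed.

Lemma coord0_le_nrm (t : 'rV[R]_3) : `|t 0 0| <= nrm t.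
Proof.
rewrite -sqrtr_sqr ler_wsqrtr// dot3E -!expr2 -addrA lerDl.
by nneg.
Qed.

Section measurability.
Context d (T : measurableType d) (h : T -> 'rV[R]_3).
Hypothesis mh : forall c, measurable_fun setT (fun t => h t 0 c).

Lemma measurable_dot3 (g : T -> 'rV[R]_3) :
  (forall c, measurable_fun setT (fun t => g t 0 c)) ->
  measurable_fun setT (fun t => dot3 (h t) (g t)).
Proof. by move=> mg; rewrite /dot3; mfun. Qed.

Lemma measurable_nrm : measurable_fun setT (fun t => nrm (h t)).
Proof. by rewrite /nrm; apply: measurable_fun_sqrtr; exact: measurable_dot3. Qed.

End measurability.

Lemma integral2_nrm3 (x : R) : x != 0 ->
  (\int[mu]_y \int[mu]_z (Num.sqrt (x * x + y * y + z * z) ^- 3)%:E =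
   (2 * pi / `|x|)%:E)%E.
Proof.
move=> x0; have x2 : 0 < x * x by rewrite -expr2 exprn_even_gt0.
transitivity (\int[mu]_y (2 * ((y + 0) ^+ 2 + x * x)^-1)%:E)%E.
  apply: eq_integral => y _.
  rewrite -(@integral_inv_sqrt3 _ _ _ 0); last by rewrite ltr_wpDl ?sqr_ge0.
  by apply: eq_integral => z _; rewrite !addr0 -!expr2 addrC [x ^+ 2 + _]addrC.
rewrite integralZ//; [|by mfun|by move=> y; rewrite invr_ge0 addr_ge0 ?sqr_ge0// ltW].
by rewrite integral_inv_sqr// -expr2 sqrtr_sqr -EFinM mulrA.
Qed.

Lemma integral2_nrm5 (x : R) : x != 0 ->
  (\int[mu]_y \int[mu]_z (Num.sqrt (x * x + y * y + z * z) ^- 5)%:E =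
   (2 * pi / (3 * `|x| ^+ 3))%:E)%E.
Proof.
move=> x0; have x2 : 0 < x * x by rewrite -expr2 exprn_even_gt0.
transitivity (\int[mu]_y (4 / 3 * ((y + 0) ^+ 2 + x * x) ^- 2)%:E)%E.
  apply: eq_integral => y _.
  have y0 : 0 < (y + 0) ^+ 2 + x * x by rewrite ltr_wpDl ?sqr_ge0.
  have -> : 4 / 3 * ((y + 0) ^+ 2 + x * x) ^- 2 = 4 / (3 * ((y + 0) ^+ 2 + x * x) ^+ 2).
    by rewrite [in RHS]invfM [in RHS]mulrA.
  rewrite -(@integral_inv_sqrt5 _ _ y0 0).
  by apply: eq_integral => z _; rewrite !addr0 -!expr2 addrC [x ^+ 2 + _]addrC.
rewrite integralZ; [|by mfun|by move=> y; nneg|by nneg].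
rewrite integral_inv_sqr2// -expr2 sqrtr_sqr -EFinM; congr EFin.
by move: (@pi R) => p; field; rewrite normr_eq0.
Qed.

(** At fixed [x] the two inner integrals of [|x| / |t|^3] give [2 pi], except at [x = 0], where the
    left side vanishes; hence an inequality suffices pointwise. All cut-off errors are reduced by it
    to line integrals of a profile [p]. *)
Lemma int3_slab (p : R -> R) : measurable_fun setT p -> (forall x, 0 <= p x) ->
  (int3 (fun t => (p (t ord0 ord0) * (`|t ord0 ord0| * nrm t ^- 3))%:E) <=
   \int[mu]_x (2 * pi * p x)%:E)%E.
Proof.
move=> mp p0; rewrite /int3; apply: ge0_le_integral => //.
- by move=> x _; do 2![apply: integral_ge0 => ? _]; rewrite lee_fin; nneg.
- pose F (q : R * R) : \bar R := (\int[mu]_z (p q.1 * (`|q.1| *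
    Num.sqrt (q.1 * q.1 + q.2 * q.2 + z * z) ^- 3))%:E)%E.
  have mF : measurable_fun setT F.
    apply: (@measurable_fun_fubini_tonelli_F _ _ _ _ _ mu (fun q : (R * R) * R =>
      (p q.1.1 * (`|q.1.1| *
        Num.sqrt (q.1.1 * q.1.1 + q.1.2 * q.1.2 + q.2 * q.2) ^- 3))%:E)) => /=.
      apply/measurable_EFinP; apply: measurable_fun_mulr; last by mfun.
      by apply: (measurableT_comp mp); mfun.
    by move=> q; rewrite lee_fin; nneg.
  rewrite (_ : (fun x => _) = (fun x => \int[mu]_y F (x, y))%E).
    apply: (@measurable_fun_fubini_tonelli_F _ _ _ _ _ mu F) => //.
    by move=> q; apply: integral_ge0 => z _; rewrite lee_fin; nneg.
  apply/funext => x; do 2![apply: eq_integral => ? _].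
  by rewrite -/(row3 _ _ _) /nrm dot3E !row3_0 !row3_1 !row3_2.
- by mfun.
- move=> x _; have [->|x0] := eqVneq x 0.
    under eq_integral => y _.
      under eq_integral => z _.
        rewrite -/(row3 _ _ _) row3_0 normr0 mul0r mulr0; over.
      rewrite integral0; over.
    by rewrite integral0 lee_fin; nneg.
  rewrite (_ : (\int[mu]_y _)%E = (\int[mu]_y ((p x * `|x|)%:E * \int[mu]_z
      (Num.sqrt (x * x + y * y + z * z) ^- 3)%:E))%E); last first.
    apply: eq_integral => y _; rewrite -integralZ; [|by mfun|by move=> z; nneg|by nneg].
    apply: eq_integral => z _.
    by rewrite -/(row3 _ _ _) /nrm dot3E !row3_0 !row3_1 !row3_2 mulrA.
  rewrite ge0_integralZl_EFin//; last 3 first.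
  + by move=> y _; apply: integral_ge0 => z _; rewrite lee_fin; nneg.
  + apply: (@measurable_fun_fubini_tonelli_F _ _ _ _ _ mu (fun q : R * R =>
      (Num.sqrt (x * x + q.1 * q.1 + q.2 * q.2) ^- 3)%:E)).
      by mfun.
    by move=> q; rewrite lee_fin; nneg.
  + by nneg.
  rewrite integral2_nrm3// -EFinM lee_fin.
  have -> // : p x * `|x| * (2 * pi / `|x|) = 2 * pi * p x.
  by move: (@pi R) => q; field; rewrite normr_eq0.
Qed.

End OneParticle.

(** * Exact masses of the p-wave, the cells and the resolvent *)

Section OneParticleExact.
Context {R : realType}.
Local Notation mu := (@lebesgue_measure R).

Lemma integral_inv_norm (d K : R) : 0 < d -> d < K ->
  (\int[mu]_x ((d <= `|x| <= K)%R%:R * `|x|^-1)%:E = (2 * ln (K / d))%:E)%E.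
Proof.
move=> d0 dK; have K0 : 0 < K by exact: lt_trans dK.
have setE : [set x : R | d <= `|x| <= K] = `[- K, - d]%classic `|` `[d, K]%classic.
  apply/seteqP; split=> x /=; rewrite !in_itv/=.
    have [x0|x0] := leP 0 x; [rewrite ger0_norm//; by right|].
    by rewrite ltr0_norm// => h; left; lra.
  case=> /andP[h1 h2]; first by rewrite ler0_norm; lra.
  by rewrite ger0_norm; lra.
rewrite integral_indicator; last by rewrite setE; exact: measurableU.
have mf D : measurable_fun D (fun x : R => (`|x|^-1)%:E).
  by apply: measurable_funTS; mfun.
have dis : [disjoint `[- K, - d]%classic & `[d, K]%classic].
  apply/disj_setPS => x /= []; rewrite !in_itv/= => /andP[_ h1] /andP[h2 _].
  by have : False by lra.
rewrite setE ge0_integral_setU//; last exact: mf.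
have cN (x : R) : x != 0 -> {for x, continuous (fun y : R => `|y|^-1)}.
  move=> x0; apply: cvgV; first by rewrite normr_eq0.
  exact: norm_continuous.
have -> : (\int[mu]_(x in `[(- K)%R, (- d)%R]) (`|x|^-1)%:E =
    \int[mu]_(x in `[d, K]) (`|x|^-1)%:E)%E.
  rewrite integration_by_substitution_oppr ?ltW//.
    by apply: eq_integral => x _; rewrite /= normrN.
  apply: continuous_in_subspaceT => x; rewrite inE/= in_itv/= => /andP[h1 h2].
  by apply: cN; rewrite lt_eqF//; lra.
have -> : (\int[mu]_(x in `[d, K]) (`|x|^-1)%:E = (ln (K / d))%:E)%E.
  rewrite (@continuous_FTC2 _ _ (@ln R))//.
  - by rewrite -EFinB ln_div// posrE.
  - apply: continuous_in_subspaceT => x; rewrite inE/= in_itv/= => /andP[h1 h2].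
    by apply: cN; rewrite gt_eqF//; lra.
  - split=> [x||].
    + by rewrite in_itv/= => /andP[h1 h2]; have [|dx _] := @is_derive1_ln R x; [lra|exact: dx].
    + by apply: cvg_at_right_filter; apply: continuous_ln.
    + by apply: cvg_at_left_filter; apply: continuous_ln.
  - move=> x; rewrite in_itv/= => /andP[h1 h2]; rewrite derive1E.
    have [|_ ->] := @is_derive1_ln R x; first by lra.
    by rewrite ger0_norm//; lra.
by rewrite -EFinD mulr2n mulrDl mul1r.
Qed.

(** At fixed [x] the two inner integrals give [2 pi / (3 |x|)]; this scale invariance is the source
    of the logarithm. *)
Lemma int3_pwave (d K : R) : 0 < d -> d < K ->
  int3 (fun t => ((d <= `|t ord0 ord0| <= K)%R%:R *
    (t ord0 ord0 ^+ 2 * nrm t ^- 5))%:E) = (4 * pi / 3 * ln (K / d))%:E.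
Proof.
move=> d0 dK; rewrite /int3.
transitivity (\int[mu]_x (2 * pi / 3 * ((d <= `|x| <= K)%R%:R * `|x|^-1))%:E)%E; last first.
  rewrite integralZ; [|by mfun|by move=> x; nneg|by nneg].
  by rewrite integral_inv_norm// -EFinM; congr EFin; ring.
apply: eq_integral => x _; case: (boolP (d <= `|x| <= K)) => dxK; last first.
  rewrite mul0r mulr0.
  under eq_integral => y _.
    under eq_integral => z _.
      rewrite -/(row3 _ _ _) row3_0 (negbTE dxK) mul0r; over.
    rewrite integral0; over.
  by rewrite integral0.
have x0 : x != 0 by rewrite -normr_gt0; lra.
rewrite (_ : (\int[mu]_y _)%E = (\int[mu]_y ((x ^+ 2)%:E * \int[mu]_z
    (Num.sqrt (x * x + y * y + z * z) ^- 5)%:E))%E); last first.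
  apply: eq_integral => y _; rewrite -integralZ; [|by mfun|by move=> z; nneg|by nneg].
  apply: eq_integral => z _.
  by rewrite -/(row3 _ _ _) /nrm dot3E !row3_0 !row3_1 !row3_2 dxK mul1r.
rewrite ge0_integralZl_EFin//; last 3 first.
- by move=> y _; apply: integral_ge0 => z _; rewrite lee_fin; nneg.
- apply: (@measurable_fun_fubini_tonelli_F _ _ _ _ _ mu (fun q : R * R =>
    (Num.sqrt (x * x + q.1 * q.1 + q.2 * q.2) ^- 5)%:E)).
    by mfun.
  by move=> q; rewrite lee_fin; nneg.
- by nneg.
rewrite integral2_nrm5// -EFinM; congr EFin.
rewrite -[x ^+ 2]real_normK ?num_real// mul1r.
by move: (@pi R) => q; field; rewrite normr_eq0.
Qed.

Lemma integral_box (a b : R) : a <= b ->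
  (\int[mu]_x ((a <= x < b)%R%:R)%:E = (b - a)%:E)%E.
Proof.
move=> ab; transitivity (\int[mu]_x ((a <= x < b)%R%:R * 1)%:E)%E.
  by apply: eq_integral => x _; rewrite mulr1.
rewrite (@integral_indicator _ _ (fun=> 1)); last first.
  rewrite (_ : [set _ | _] = `[a, b[%classic)//; exact: measurable_itv.
rewrite (_ : [set _ | _] = `[a, b[%classic)// integral_cst//= mul1e.
rewrite lebesgue_measure_itv/= lte_fin; case: ltgtP ab => // -> _.
  by rewrite subrr.
Qed.

(** Indicator of a unit cube: it is its own square, has integral 1, and for distinct integers [j]
    the supports are disjoint. *)
Definition cell (j : R) (t : 'rV[R]_3) : R :=
  (j <= t 0 0 < j + 1)%R%:R * ((0 <= t 0 1 < 1)%R%:R * (0 <= t 0 2%:R < 1)%R%:R).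

Lemma int3_cell (j : R) : int3 (fun t => (cell j t)%:E) = 1%:E.
Proof.
rewrite /int3 /cell.
transitivity (\int[mu]_x ((j <= x < j + 1)%R%:R)%:E)%E; last first.
  by rewrite integral_box ?lerDl// addrAC subrr add0r.
apply: eq_integral => x _.
transitivity (\int[mu]_y ((j <= x < j + 1)%R%:R * (0 <= y < 1)%R%:R)%:E)%E; last first.
  rewrite integralZ; [|by mfun|by move=> z; nneg|by nneg].
  by rewrite integral_box// subr0 mule1.
apply: eq_integral => y _.
transitivity (\int[mu]_z ((j <= x < j + 1)%R%:R * (0 <= y < 1)%R%:R * (0 <= z < 1)%R%:R)%:E)%E; last first.
  rewrite integralZ; [|by mfun|by move=> z; nneg|by nneg].
  by rewrite integral_box// subr0 mule1.
apply: eq_integral => z _.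
by rewrite -/(row3 _ _ _) !row3_0 !row3_1 !row3_2 mulrA.
Qed.

(** Only the finiteness of the value matters, since it enters the energy estimate divided by [d]. *)
Lemma int3_inv_sqr2 (a l : R) : 0 < a -> 0 < l -> exists2 g0 : R, 0 <= g0 &
  int3 (fun t => ((a * dot3 t t + l) ^- 2)%:E) = g0%:E.
Proof.
move=> a0 l0; exists (a ^- 2 * (pi ^+ 2 / Num.sqrt (l / a))); first by nneg.
have c0 : 0 < l / a by rewrite divr_gt0.
have cx x : 0 < x ^+ 2 + l / a by rewrite ltr_wpDl ?sqr_ge0.
have cxy x y : 0 < y ^+ 2 + (x ^+ 2 + l / a) by rewrite ltr_wpDl ?sqr_ge0.
rewrite /int3.
transitivity (\int[mu]_x (a ^- 2 * pi * ((x + 0) ^+ 2 + l / a)^-1)%:E)%E; last first.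
  rewrite integralZ; [|by mfun|by move=> z; rewrite addr0 invr_ge0 ltW|by nneg].
  rewrite integral_inv_sqr// -EFinM; congr EFin.
  by move: (@pi R) (Num.sqrt _) => p q; ring.
apply: eq_integral => x _; rewrite addr0.
transitivity (\int[mu]_y (a ^- 2 * (pi / 2) * Num.sqrt ((y + 0) ^+ 2 + (x ^+ 2 + l / a)) ^- 3)%:E)%E; last first.
  rewrite integralZ; [|by mfun|by move=> z; nneg|by nneg].
  rewrite integral_inv_sqrt3// -EFinM; congr EFin.
  by have := cx x; move: (@pi R) (x ^+ 2 + l / a) => p q q0; field; rewrite !gt_eqF.
apply: eq_integral => y _; rewrite addr0.
transitivity (\int[mu]_z (a ^- 2 * ((z + 0) ^+ 2 + (y ^+ 2 + (x ^+ 2 + l / a))) ^- 2)%:E)%E; last first.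
  rewrite integralZ; [|by mfun|by move=> z; nneg|by nneg].
  rewrite integral_inv_sqr2// -EFinM; congr EFin.
  have q0 : 0 < Num.sqrt (y ^+ 2 + (x ^+ 2 + l / a)) by rewrite sqrtr_gt0.
  by move: (@pi R) (Num.sqrt _) q0 => p q q0; field; rewrite !gt_eqF.
apply: eq_integral => z _; congr EFin.
rewrite -/(row3 _ _ _) dot3E !row3_0 !row3_1 !row3_2 -invfM -exprMn; congr (_ ^- 2).
by field; rewrite gt_eqF.
Qed.

End OneParticleExact.

(** * The kinetic form, its inverse and the weight [Ll] in terms of the total momentum *)

Section Kinetic.
Context {R : realType}.
Implicit Types a b c : 'rV[R]_3.

Lemma dot3C a b : dot3 a b = dot3 b a.
Proof. by rewrite !dot3E; ring. Qed.

Lemma dot3Dl a b c : dot3 (a + b) c = dot3 a c + dot3 b c.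
Proof. by rewrite !dot3E !mxE; ring. Qed.

Lemma dot3Dr a b c : dot3 a (b + c) = dot3 a b + dot3 a c.
Proof. by rewrite !dot3E !mxE; ring. Qed.

Lemma dot3_suml (I : Type) (s : seq I) (F : I -> 'rV[R]_3) b :
  dot3 (\sum_(i <- s) F i) b = \sum_(i <- s) dot3 (F i) b.
Proof.
elim: s => [|i s IH]; last by rewrite !big_cons dot3Dl IH.
by rewrite !big_nil dot3E !mxE; ring.
Qed.

Lemma dot3_sumr (I : Type) (s : seq I) (F : I -> 'rV[R]_3) b :
  dot3 b (\sum_(i <- s) F i) = \sum_(i <- s) dot3 b (F i).
Proof. by rewrite dot3C dot3_suml; apply: eq_bigr => i _; rewrite dot3C. Qed.

Lemma cauchy_schwarz3 a b : `|dot3 a b| <= nrm a * nrm b.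
Proof.
rewrite -sqrtr_sqr /nrm -sqrtrM ?dot3_ge0// ler_wsqrtr// -subr_ge0.
rewrite (_ : _ - _ = (a 0 0 * b 0 1 - a 0 1 * b 0 0) ^+ 2 +
  (a 0 0 * b 0 2%:R - a 0 2%:R * b 0 0) ^+ 2 +
  (a 0 1 * b 0 2%:R - a 0 2%:R * b 0 1) ^+ 2); last by rewrite !dot3E; ring.
by nneg.
Qed.

Lemma ler_nrmD a b : nrm (a + b) <= nrm a + nrm b.
Proof.
rewrite -[leRHS]ger0_norm ?addr_ge0 ?nrm_ge0// -sqrtr_sqr ler_wsqrtr//.
rewrite dot3Dl !dot3Dr -!nrm_sqr [dot3 b a]dot3C.
by have := cauchy_schwarz3 a b; rewrite ler_norml => /andP[_]; lra.
Qed.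

Definition vsum n (k : cfg R n) : 'rV[R]_3 := \sum_i k i.

Lemma nrm_vsum n (k : cfg R n) (M : R) : (forall i, nrm (k i) <= M) ->
  nrm (vsum k) <= n%:R * M.
Proof.
move=> kM; apply: (@le_trans _ _ (\sum_i nrm (k i))).
  rewrite /vsum; elim/big_ind2 : _ => //.
    by rewrite /nrm dot3E !mxE !mul0r !addr0 sqrtr0.
  by move=> a x b y ax b_y; apply: le_trans (ler_nrmD _ _) _; exact: lerD.
rewrite -[n in leRHS]card_ord mulr_natl -sumr_const.
by apply: ler_sum => i _; exact: kM.
Qed.

Lemma sumsq_le n (k : cfg R n) (M : R) : (forall i, nrm (k i) <= M) ->
  sumsq k <= n%:R * M ^+ 2.
Proof.
move=> kM; rewrite -[n in leRHS]card_ord mulr_natl -sumr_const.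
apply: ler_sum => i _; rewrite -nrm_sqr.
by rewrite ler_pXn2r ?nnegrE ?nrm_ge0 ?(le_trans (nrm_ge0 _) (kM i)).
Qed.

Lemma sumsq_ge0 n (k : cfg R n) : 0 <= sumsq k.
Proof. by apply: sumr_ge0 => i _; exact: dot3_ge0. Qed.

Lemma dot3_le_sumsq n (k : cfg R n) i : dot3 (k i) (k i) <= sumsq k.
Proof.
by rewrite /sumsq (bigD1 i)//= lerDl; apply: sumr_ge0 => j _; exact: dot3_ge0.
Qed.

Lemma dot3_vsum n (k : cfg R n) : dot3 (vsum k) (vsum k) = sumsq k + 2 * sumdot k.
Proof.
rewrite /vsum dot3_suml; under eq_bigr do rewrite dot3_sumr.
have E i : \sum_j dot3 (k i) (k j) = dot3 (k i) (k i) +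
    (\sum_(j < n | (i < j)%N) dot3 (k i) (k j) + \sum_(j < n | (j < i)%N) dot3 (k i) (k j)).
  rewrite (bigD1 i)//=; congr (_ + _); rewrite (bigID (fun j : 'I_n => (i < j)%N))/=.
  congr (_ + _); apply: eq_bigl => j; rewrite neq_ltn.
    by case: ltngtP.
  by rewrite -leqNgt; case: ltngtP.
under eq_bigr do rewrite E; rewrite big_split/= big_split/= -/(sumsq k) -/(sumdot k).
congr (_ + _); rewrite mulr_natl mulr2n; congr (_ + _).
rewrite (exchange_big_dep xpredT)//=; apply: eq_bigr => i _.
by apply: eq_bigr => j _; rewrite dot3C.
Qed.

Section mass.
Variables (m lam : R).
Hypotheses (m0 : 0 < m) (lam0 : 0 < lam).
Let kap := (m + 1)^-1.

Lemma kap_itv : 0 < kap < 1.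
Proof. by rewrite invr_gt0 addr_gt0 //= invf_lt1 ?addr_gt0 // ltrDr. Qed.

(** With the total momentum as a variable, positivity and the lower bound [(1 - kap) * sumsq k] are
    visible. *)
Lemma kinE n (k : cfg R n) :
  kin m k = (1 - kap) * sumsq k + kap * dot3 (vsum k) (vsum k).
Proof. by rewrite dot3_vsum /kin -/kap; ring. Qed.

Lemma kin_ge n (k : cfg R n) : (1 - kap) * sumsq k <= kin m k.
Proof. by rewrite kinE lerDl mulr_ge0 ?dot3_ge0//; have := kap_itv; lra. Qed.

Lemma kin_ge0 n (k : cfg R n) : 0 <= kin m k.
Proof.
apply: le_trans (kin_ge k); rewrite mulr_ge0 ?sumsq_ge0//.
by have := kap_itv; lra.
Qed.

Lemma kin_le n (k : cfg R n) (M : R) : 0 <= M -> (forall i, nrm (k i) <= M) ->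
  kin m k <= n%:R * M ^+ 2 + (n%:R * M) ^+ 2.
Proof.
move=> M0 kM; rewrite kinE -nrm_sqr; have := kap_itv => kk.
have h1 := sumsq_le kM; have h2 := nrm_vsum kM; have h3 := sumsq_ge0 k.
have h4 : nrm (vsum k) ^+ 2 <= (n%:R * M) ^+ 2.
  by rewrite ler_pXn2r ?nnegrE ?nrm_ge0 ?mulr_ge0.
have h5 := sqr_ge0 (nrm (vsum k)).
apply: lerD; [apply: le_trans h1|apply: le_trans h4].
  by rewrite ler_piMl//; lra.
by rewrite ler_piMl//; lra.
Qed.

Lemma Gl_gt0 n (k : cfg R n) : 0 < Gl m lam k.
Proof. by rewrite invr_gt0 ltr_wpDl ?kin_ge0. Qed.

Lemma Gl_le n (k : cfg R n) : Gl m lam k <= lam^-1.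
Proof. by rewrite lef_pV2 ?posrE ?ltr_wpDl ?kin_ge0// lerDr kin_ge0. Qed.

(** Uses [m (m + 2) / (m + 1)^2 = 1 - kap^2] and [m / (m + 1)^2 = kap (1 - kap)]. *)
Lemma LlE n (k : cfg R n) : Ll m lam k =
  2 * pi ^+ 2 * Num.sqrt ((1 - kap) * (sumsq k + kap * dot3 (vsum k) (vsum k)) + lam).
Proof.
rewrite /Ll dot3_vsum; congr (_ * Num.sqrt (_ + _)).
have -> : m = kap^-1 - 1 by rewrite invrK addrK.
have : kap != 0 by rewrite gt_eqF//; have := kap_itv; lra.
by move: kap => q q0; field; rewrite q0 mulN1r subrK oner_neq0.
Qed.

Lemma sumsq_cons n a (k : cfg R n) : sumsq (consP a k) = dot3 a a + sumsq k.
Proof.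
rewrite /sumsq big_ord_recl consP0; congr (_ + _).
by apply: eq_bigr => i _; rewrite consPS.
Qed.

Lemma vsum_cons n a (k : cfg R n) : vsum (consP a k) = a + vsum k.
Proof.
rewrite /vsum big_ord_recl consP0; congr (_ + _).
by apply: eq_bigr => i _; rewrite consPS.
Qed.

(** The denominator of [Gl] as a quadratic polynomial in the exchanged momentum [t], in the shape
    required by [int3_kernel]. *)
Lemma kin_cons2 n s t (k : cfg R n) :
  let v := kap *: (s + vsum k) in
  let e := dot3 s s + 2 * kap * dot3 s (vsum k) + kin m k + lam in
  kin m (consP s (consP t k)) + lam = dot3 t t + 2 * dot3 v t + e.
Proof.
move=> v e; rewrite /v /e !kinE !sumsq_cons !vsum_cons.
by rewrite !dot3E !mxE; ring.
Qed.

(** At its minimizer [t = -v] the polynomial of [kin_cons2] equals [e - |v|^2], and [kin_ge] bounds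
    it from below. *)
Lemma kin_cons2_gap n s (k : cfg R n) v e :
  v = kap *: (s + vsum k) ->
  e = dot3 s s + 2 * kap * dot3 s (vsum k) + kin m k + lam ->
  (1 - kap) * dot3 s s + dot3 v v + lam <= e.
Proof.
move=> vE eE; have := kin_cons2 s (- v) k; rewrite /= -vE -eE.
have -> : dot3 (- v) (- v) + 2 * dot3 v (- v) + e = e - dot3 v v.
  by rewrite !dot3E !mxE; ring.
have := kin_ge (consP s (consP (- v) k)); rewrite sumsq_cons.
have : (1 - kap) * dot3 s s <= (1 - kap) * (dot3 s s + sumsq (consP (- v) k)).
  rewrite ler_wpM2l ?lerDl ?sumsq_ge0//; have := kap_itv; lra.
by lra.
Qed.

End mass.

End Kinetic.

(** * The kernel estimate for one fixed momentum and fixed spectators *)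

Section KernelEstimate.
Context {R : realType}.
Local Notation mu := (@lebesgue_measure R).

Definition slab (d K : R) (t : 'rV[R]_3) : bool := (d <= `|t 0 0| <= K)%R.

Variables (m lam : R).
Hypotheses (m0 : 0 < m) (lam0 : 0 < lam).
Let kap := (m + 1)^-1.
Variables (n : nat) (M d K : R).
Hypotheses (M0 : 0 <= M) (d1 : 1 <= d) (dK : d < K).

(** The numerator bounds the spectator terms in [D]: first the term in [dot3 s V], then [kin m ks]
    in two summands, then [lam]. The denominator is the minimum of [1 - kap^2 w] for
    [0 <= w <= 1]. *)
Definition kernel_const : R :=
  (2 * (n%:R * M) + n%:R * M ^+ 2 + (n%:R * M) ^+ 2 + lam) / (1 - kap ^+ 2).

Variables (s : 'rV[R]_3) (ks : cfg R n).
Hypotheses (sD : slab d K s) (ksM : forall i, nrm (ks i) <= M).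

Let G (t : 'rV[R]_3) := Gl m lam (consP s (consP t ks)).
Let V := vsum ks.
Let v := kap *: (s + V).
Let e := dot3 s s + 2 * kap * dot3 s V + kin m ks + lam.
(** For [w = 1 - u^2], the product [w * D w] is the constant left by completing the square in the
    Feynman denominator. *)
Let D (w : R) := e - w * dot3 v v.
Let kapi : 0 < kap < 1. Proof. exact: kap_itv. Qed.
Let kap2 : 0 < 1 - kap ^+ 2.
Proof. by rewrite subr_gt0 expr_lt1//; case/andP: kapi => *; rewrite ?ltW. Qed.

Let x_gt0 : 0 < `|s 0 0|.
Proof. by move: sD => /andP[h _]; move: d1; lra. Qed.

Let s_ge : d <= nrm s.
Proof. by move: sD => /andP[h _]; exact: le_trans (coord0_le_nrm s). Qed.

Let ss_gt0 : 0 < dot3 s s.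
Proof. by rewrite -nrm_sqr exprn_gt0//; move: s_ge d1; lra. Qed.

Let VM : nrm V <= n%:R * M.
Proof. exact: nrm_vsum. Qed.

Let D_ge w : 0 <= w <= 1 -> (1 - kap) * dot3 s s <= D w.
Proof.
move=> /andP[w0 w1]; have := @kin_cons2_gap R m lam m0 n s ks v e erefl erefl.
have : w * dot3 v v <= dot3 v v by rewrite ler_piMl ?dot3_ge0.
by rewrite /D -/kap; move: lam0; lra.
Qed.

Let D_gt0 w : 0 <= w <= 1 -> 0 < D w.
Proof.
move=> /D_ge; apply: lt_le_trans; rewrite mulr_gt0//.
by case/andP: kapi; lra.
Qed.

Let D_le w : 0 <= w <= 1 ->
  D w <= (1 - kap ^+ 2 * w) * (dot3 s s * (1 + kernel_const / d)).
Proof.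
move=> /andP[w0 w1]; have /andP[k0 k1] := kapi.
have nM : 0 <= n%:R * M by rewrite mulr_ge0.
have d0 : 0 < d by move: d1; lra.
have sV : dot3 s V <= nrm s * (n%:R * M).
  apply: le_trans (ler_norm _) _; apply: le_trans (cauchy_schwarz3 s V) _.
  by rewrite ler_wpM2l ?nrm_ge0.
have DE : D w = (1 - kap ^+ 2 * w) * dot3 s s + 2 * kap * (1 - kap * w) * dot3 s V
    + (kin m ks + lam - w * (kap ^+ 2 * dot3 V V)).
  by rewrite /D /e /v !dot3E !mxE; ring.
pose c3 := 2 * (n%:R * M) + n%:R * M ^+ 2 + (n%:R * M) ^+ 2 + lam.
have h1 : D w <= (1 - kap ^+ 2 * w) * dot3 s s + c3 * nrm s.
  rewrite DE -addrA lerD2l.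
  have s1 : 1 <= nrm s by move: s_ge d1; lra.
  have kl := kin_le m0 M0 ksM.
  have h2 : 0 <= w * (kap ^+ 2 * dot3 V V) by nneg; exact: dot3_ge0.
  have h3 : kin m ks + lam - w * (kap ^+ 2 * dot3 V V) <=
      (n%:R * M ^+ 2 + (n%:R * M) ^+ 2 + lam) * nrm s.
    apply: (@le_trans _ _ (n%:R * M ^+ 2 + (n%:R * M) ^+ 2 + lam)); first by lra.
    by rewrite ler_peMr//; nneg; rewrite ltW.
  have h4 : 2 * kap * (1 - kap * w) * dot3 s V <= 2 * (n%:R * M) * nrm s.
    have kw : 0 <= kap * w <= 1.
      by rewrite (mulr_ge0 (ltW k0) w0) (mulr_ile1 (ltW k0) w0 (ltW k1) w1).
    apply: (@le_trans _ _ (2 * kap * (1 - kap * w) * (nrm s * (n%:R * M)))).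
      by rewrite ler_wpM2l//; nneg; [exact: ltW|by case/andP: kw].
    have -> : 2 * (n%:R * M) * nrm s = 2 * (nrm s * (n%:R * M)) by ring.
    rewrite ler_wpM2r ?mulr_ge0 ?nrm_ge0// -mulrA ler_piMr//.
    case/andP: kw => kw0 kw1.
    by rewrite (mulr_ile1 (ltW k0) _ (ltW k1)) ?subr_ge0 ?gerBl.
  by rewrite /c3; move: h3 h4; lra.
apply: le_trans h1 _.
have -> : (1 - kap ^+ 2 * w) * (dot3 s s * (1 + kernel_const / d)) =
  (1 - kap ^+ 2 * w) * dot3 s s + (1 - kap ^+ 2 * w) * dot3 s s * (kernel_const / d) by ring.
rewrite lerD2l.
have c30 : 0 <= c3 by rewrite /c3; nneg; rewrite ltW.
have kcE : kernel_const = c3 / (1 - kap ^+ 2) by [].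
(* Since [nrm s >= d], the error [c3 * nrm s] is at most [c3 * nrm s ^ 2 / d], a fraction of the
   leading term. *)
apply: (@le_trans _ _ ((1 - kap ^+ 2) * dot3 s s * (kernel_const / d))).
  have -> : (1 - kap ^+ 2) * dot3 s s * (kernel_const / d) = c3 * (nrm s * (nrm s / d)).
    by rewrite kcE -nrm_sqr; field; rewrite !gt_eqF.
  rewrite ler_wpM2l// ler_peMr ?nrm_ge0// ler_pdivlMr// mul1r.
  exact: s_ge.
have kc0 : 0 <= kernel_const by rewrite kcE divr_ge0// ltW.
apply: ler_wpM2r; first by rewrite divr_ge0 ?(ltW d0).
apply: ler_wpM2r; first exact: ltW.
rewrite lerD2l lerN2.
by rewrite ler_piMr ?sqr_ge0.
Qed.

Let wu u : 0 < u < 1 -> 0 <= (1 - u ^+ 2 : R) <= 1.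
Proof. by move=> /andP[u0 u1]; apply/andP; split; nra. Qed.

(** Lower bound for the Feynman integral of the shift [kap * s]: [D_le] factors out [dot3 s s] and
    leaves [angular kap]. *)
Definition pwave_gain : R :=
  4 * pi * kap * `|s 0 0| * angular kap / (dot3 s s * (1 + kernel_const / d)).

(** Upper bound for the same integral with the shift [kap * V], from [D_ge], [u^2 <= 1] and
    [nrm V <= n M]. *)
Definition shift_loss : R := 4 * pi * kap * (n%:R * M) / ((1 - kap) * dot3 s s).

Let int3_G eps : eps = 1 \/ eps = -1 ->
  int3 (fun t => (Num.max (eps * t 0 0) 0 * (nrm t ^- 3 * G t))%:E) =
  (\int[mu]_u ((0 < u < 1)%R%:R * (2 * pi * u ^+ 2 *
     ((Num.sqrt (((1 - u ^+ 2) * v 0%R 0%R) ^+ 2 + (1 - u ^+ 2) * D (1 - u ^+ 2))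
       - eps * ((1 - u ^+ 2) * v 0%R 0%R)) / ((1 - u ^+ 2) * D (1 - u ^+ 2)))))%:E)%E.
Proof.
move=> heps; have ve : dot3 v v < e.
  by have /D_gt0 : 0 <= (1 : R) <= 1; rewrite ?lexx ?ler01// /D mul1r subr_gt0.
rewrite -(int3_kernel ve heps); congr int3; apply/funext => t.
by rewrite /G /Gl (@kin_cons2 R m lam n s t ks).
Qed.

Let gain_le : (pwave_gain%:E <= \int[mu]_u ((0 < u < 1)%R%:R *
  (4 * pi * kap * `|s 0 0|%R * (u ^+ 2 / D (1 - u ^+ 2))))%:E)%E.
Proof.
have /andP[k0 k1] := kapi.
pose c := 4 * pi * kap * `|s 0 0| / (dot3 s s * (1 + kernel_const / d)).
have kc0 : 0 <= kernel_const.
  by rewrite divr_ge0 ?(ltW kap2)//; nneg; rewrite ltW.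
have d0 : 0 < d by move: d1; lra.
have den0 : 0 < dot3 s s * (1 + kernel_const / d).
  by rewrite mulr_gt0// ltr_pwDl// divr_ge0// ltW.
have c0 : 0 <= c by rewrite divr_ge0 ?(ltW den0)//; nneg; rewrite ltW.
have -> : pwave_gain = c * angular kap by rewrite /pwave_gain /c; ring.
rewrite EFinM -integral_angular// -integralZ//; last 2 first.
- by mfun.
- move=> u; case: (boolP (0 < u < 1)) => u01; rewrite ?mul0r// mul1r.
  rewrite divr_ge0 ?sqr_ge0//.
  have := D_le (wu u01); have := D_gt0 (wu u01) => h1 h2.
  by have := lt_le_trans h1 h2; rewrite pmulr_lgt0// => /ltW.
apply: ge0_le_integral => //.
- move=> u _; rewrite lee_fin mulr_ge0//; case: (boolP (0 < u < 1)) => u01; rewrite ?mul0r// mul1r.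
  rewrite divr_ge0 ?sqr_ge0//.
  have := D_le (wu u01); have := D_gt0 (wu u01) => h1 h2.
  by have := lt_le_trans h1 h2; rewrite pmulr_lgt0// => /ltW.
- by mfun.
- by rewrite /D; mfun.
- move=> u _; rewrite lee_fin; case: (boolP (0 < u < 1)) => u01; rewrite ?mul0r ?mulr0// !mul1r.
  have h2 := D_le (wu u01); have h1 := D_gt0 (wu u01).
  have h3 : 0 < 1 - kap ^+ 2 * (1 - u ^+ 2).
    by have := lt_le_trans h1 h2; rewrite pmulr_lgt0.
  have -> : c * (u ^+ 2 / (1 - kap ^+ 2 * (1 - u ^+ 2))) = 4 * pi * kap * `|s 0 0| *
      (u ^+ 2 / ((1 - kap ^+ 2 * (1 - u ^+ 2)) * (dot3 s s * (1 + kernel_const / d)))).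
    by rewrite /c !invfM; ring.
  apply: ler_wpM2l; first by nneg; rewrite ltW.
  by rewrite ler_wpM2l ?sqr_ge0// lef_pV2 ?posrE// mulr_gt0.
Qed.

Let loss_le : (\int[mu]_u ((0 < u < 1)%R%:R *
  (4 * pi * kap * `|V 0%R 0%R| * (u ^+ 2 / D (1 - u ^+ 2))))%:E <= shift_loss%:E)%E.
Proof.
have /andP[k0 k1] := kapi.
have l0 : 0 < (1 - kap) * dot3 s s by rewrite mulr_gt0 ?subr_gt0.
have nM : 0 <= n%:R * M by rewrite mulr_ge0.
have sl0 : 0 <= shift_loss by rewrite divr_ge0 ?(ltW l0)//; nneg; rewrite ltW.
apply: (@le_trans _ _ (\int[mu]_u (shift_loss * (0 <= u < 1)%R%:R)%:E)%E); last first.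
  rewrite integralZ//; [|by mfun].
  by rewrite integral_box// subr0 mule1.
apply: ge0_le_integral => //.
- move=> u _; rewrite lee_fin; case: (boolP (0 < u < 1)) => u01; rewrite ?mul0r// mul1r.
  have h1 := D_gt0 (wu u01).
  by rewrite mulr_ge0 ?divr_ge0 ?sqr_ge0 ?(ltW h1)//; nneg; rewrite ltW.
- by rewrite /D; mfun.
- by mfun.
- move=> u _; rewrite lee_fin; case: (boolP (0 < u < 1)) => u01; last first.
    by rewrite mul0r mulr_ge0.
  have h1 := D_gt0 (wu u01); have h2 := D_ge (wu u01).
  have /andP[u0 u1] := u01; rewrite (ltW u0) u1 mulr1 mul1r /shift_loss.
  have V0 : `|V 0 0| <= n%:R * M by apply: le_trans (coord0_le_nrm V) VM.
  rewrite -mulrA -[leRHS]mulrA ler_wpM2l//; first by nneg; rewrite ltW.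
  apply: ler_pM => //; first by rewrite divr_ge0 ?sqr_ge0 ?(ltW h1).
  apply: (@le_trans _ _ (D (1 - u ^+ 2))^-1).
    by rewrite ler_piMl ?invr_ge0 ?(ltW h1)// expr_le1 ?ltW.
  by rewrite lef_pV2.
Qed.

(** Here [eps] is the sign of [s 0 0]. The kernel favours momenta in the half-space opposite to [s]:
    in the difference of the two closed forms the square roots cancel and
    [4 pi (u^2 / D) * eps * v 0 0] remains. As [v = kap (s + V)], this is at least the term with
    [|s 0 0|] minus the one with [|V 0 0|]. *)
Lemma kernel_sign (eps : R) : eps * s 0 0 = `|s 0 0| -> eps = 1 \/ eps = -1 ->
  (int3 (fun t => (Num.max (eps * t ord0 ord0) 0 * (nrm t ^- 3 * G t))%:E) + pwave_gain%:E <=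
   int3 (fun t => (Num.max ((- eps) * t ord0 ord0) 0 * (nrm t ^- 3 * G t))%:E) + shift_loss%:E)%E.
Proof.
move=> es heps; have heps' : - eps = 1 \/ - eps = -1.
  by case: heps => ->; [right|left; rewrite opprK].
rewrite !int3_G//.
have /andP[k0 k1] := kapi.
pose A (h u : R) := (0 < u < 1)%R%:R * (2 * pi * u ^+ 2 *
     ((Num.sqrt (((1 - u ^+ 2) * v 0%R 0%R) ^+ 2 + (1 - u ^+ 2) * D (1 - u ^+ 2))
       - h * ((1 - u ^+ 2) * v 0%R 0%R)) / ((1 - u ^+ 2) * D (1 - u ^+ 2)))).
pose B (h u : R) := (0 < u < 1)%R%:R * (4 * pi * kap * h * (u ^+ 2 / D (1 - u ^+ 2))).
have w0 u : 0 < u < 1 -> 0 < (1 - u ^+ 2 : R).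
  by move=> /andP[u0 u1]; rewrite subr_gt0 expr_lt1 ?ltW.
have mA h : measurable_fun setT (fun u => (A h u)%:E) by rewrite /A /D; mfun.
have mB h : measurable_fun setT (fun u => (B h u)%:E) by rewrite /B /D; mfun.
have A0 h u : h = 1 \/ h = -1 -> (0 <= (A h u)%:E)%E.
  move=> hh; rewrite lee_fin /A; case: (boolP (0 < u < 1)) => u01; rewrite ?mul0r// mul1r.
  have q0 : 0 < (1 - u ^+ 2) * D (1 - u ^+ 2) by rewrite mulr_gt0 ?w0 ?D_gt0 ?wu.
  rewrite mulr_ge0 ?divr_ge0 ?(ltW q0)//; first by nneg.
  rewrite subr_ge0; apply: (@le_trans _ _ `|(1 - u ^+ 2) * v 0 0|).
    by case: hh => ->; rewrite ?mul1r ?mulN1r ?ler_norm// -normrN ler_norm.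
  by rewrite -sqrtr_sqr ler_wsqrtr// lerDl ltW.
have B0 h u : 0 <= h -> (0 <= (B h u)%:E)%E.
  move=> hh; rewrite lee_fin /B; case: (boolP (0 < u < 1)) => u01; rewrite ?mul0r// mul1r.
  by rewrite mulr_ge0 ?divr_ge0 ?sqr_ge0 ?(ltW (D_gt0 (wu u01)))//; nneg; rewrite ltW.
apply: (@le_trans _ _ (\int[mu]_u (A eps u)%:E + \int[mu]_u (B `|s 0%R 0%R| u)%:E)%E).
  by apply: leeD => //; exact: gain_le.
apply: (@le_trans _ _ (\int[mu]_u (A (- eps) u)%:E + \int[mu]_u (B `|V 0%R 0%R| u)%:E)%E); last first.
  by apply: leeD => //; exact: loss_le.
rewrite -ge0_integralD;
  [|by []|by move=> u _; exact: A0|exact: mA|by move=> u _; exact: B0|exact: mB].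
rewrite -ge0_integralD;
  [|by []|by move=> u _; exact: A0|exact: mA|by move=> u _; exact: B0|exact: mB].
apply: ge0_le_integral => //.
- by move=> u _; apply: adde_ge0; [exact: A0|exact: B0].
- by apply: emeasurable_funD; [exact: mA|exact: mB].
- by apply: emeasurable_funD; [exact: mA|exact: mB].
move=> u _; rewrite -!EFinD lee_fin /A /B.
case: (boolP (0 < u < 1)) => u01; rewrite ?mul0r// !mul1r.
have := w0 _ u01; have := D_gt0 (wu u01).
set w := 1 - u ^+ 2; move: (D w) (Num.sqrt _) => q r q0 w0'.
rewrite -subr_ge0.
rewrite (_ : _ - _ = 4 * pi * (u ^+ 2 / q) *
    (eps * v 0 0 - kap * `|s 0 0| + kap * `|V 0 0|)); last first.
  by move: (@pi R) => p; field; rewrite !gt_eqF.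
rewrite mulr_ge0//; first by nneg; rewrite ltW.
rewrite (_ : _ + _ = kap * (eps * V 0 0 + `|V 0 0|)); last first.
  by rewrite /v !mxE -es; ring.
rewrite mulr_ge0 ?(ltW k0)//.
by case: heps => ->; rewrite ?mul1r ?mulN1r; have := ler_norm (V 0 0); have := ler_norm (- V 0 0); rewrite normrN; lra.
Qed.

End KernelEstimate.

(** * The kernel estimate with the cut-off to the slab *)

Section SlabEstimate.
Context {R : realType}.
Local Notation mu := (@lebesgue_measure R).

Lemma lee_addr_tail (a b : \bar R) (x y : R) :
  (a <= b + y%:E -> a + x%:E <= b + (x + y)%:E)%E.
Proof. by move=> ab; rewrite EFinD [(x%:E + _)%E]addeC addeA leeD2r. Qed.

Lemma measurable_sumsq n d (T : measurableType d) (h : T -> cfg R n) :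
  (forall i c, measurable_fun setT (fun t => h t i 0 c)) ->
  measurable_fun setT (fun t => sumsq (h t)).
Proof. by move=> mh; rewrite /sumsq /dot3; mfun. Qed.

Lemma measurable_sumdot n d (T : measurableType d) (h : T -> cfg R n) :
  (forall i c, measurable_fun setT (fun t => h t i 0 c)) ->
  measurable_fun setT (fun t => sumdot (h t)).
Proof. by move=> mh; rewrite /sumdot /dot3; mfun. Qed.

Lemma measurable_Gl m lam n d (T : measurableType d) (h : T -> cfg R n) :
  (forall i c, measurable_fun setT (fun t => h t i 0 c)) ->
  measurable_fun setT (fun t => Gl m lam (h t)).
Proof.
move=> mh; have h1 := measurable_sumsq mh; have h2 := measurable_sumdot mh.
by rewrite /Gl /kin; mfun.
Qed.

Lemma measurable_slab a b d (T : measurableType d) (h : T -> 'rV[R]_3) :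
  (forall c, measurable_fun setT (fun t => h t 0 c)) ->
  measurable_fun setT (fun t => slab a b (h t)).
Proof. by move=> mh; rewrite /slab; mfun. Qed.

Variables (m lam : R).
Hypotheses (m0 : 0 < m) (lam0 : 0 < lam).
Let kap := (m + 1)^-1.
Variables (n : nat) (M d K : R).
Hypotheses (M0 : 0 <= M) (d1 : 1 <= d) (dK : d < K).

(** The first summand pays for the missing region [|t_1| < d], the second for [|t_1| > K]. *)
Definition tail_loss (x : R) : R := 4 * pi ^+ 2 / (1 - kap) * (d / x ^+ 2 + K^-1).

(** On the left the cut-off only decreases the integral. On the right the discarded region is
    estimated with [Gl] at most the inverse of [(1 - kap) (s_1^2 + t_1^2)]. *)
Lemma kernel_slab (s : 'rV[R]_3) (ks : cfg R n) (eps : R) :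
  slab d K s -> (forall i, nrm (ks i) <= M) ->
  eps * s 0 0 = `|s 0 0| -> eps = 1 \/ eps = -1 ->
  (int3 (fun t => ((slab d K t)%:R *
     (Num.max (eps * t ord0 ord0) 0 * (nrm t ^- 3 * Gl m lam (consP s (consP t ks)))))%:E)
     + (pwave_gain m lam n M d s)%:E <=
   int3 (fun t => ((slab d K t)%:R *
     (Num.max ((- eps) * t ord0 ord0) 0 * (nrm t ^- 3 * Gl m lam (consP s (consP t ks)))))%:E)
     + (shift_loss m n M s + tail_loss (s ord0 ord0))%:E)%E.
Proof.
move=> sD ksM es heps; pose G t := Gl m lam (consP s (consP t ks)).
have /andP[k0 k1] : 0 < kap < 1 by exact: kap_itv.
have mG e (T : measurableType e) (h : T -> 'rV[R]_3) :
    (forall c, measurable_fun setT (fun t => h t 0 c)) ->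
    measurable_fun setT (fun t => G (h t)).
  move=> mh; apply: measurable_Gl; apply: measurable_consP => [c|].
    exact: measurable_cst.
  by apply: measurable_consP => // i c; exact: measurable_cst.
have G0 t : 0 <= G t by rewrite ltW// Gl_gt0.
have mH h : rmeasurable (fun t => (Num.max (h * t ord0 ord0) 0 * (nrm t ^- 3 * G t))%:E).
  move=> e T q mq; have := mG _ _ _ mq; have := measurable_nrm mq => h1 h2.
  by mfun.
have mS h : rmeasurable (fun t => ((slab d K t)%:R *
    (Num.max (h * t ord0 ord0) 0 * (nrm t ^- 3 * G t)))%:E).
  move=> e T q mq; have := mG _ _ _ mq; have := measurable_nrm mq => h1 h2.
  by have h3 := @measurable_slab d K _ _ _ mq; mfun.
have H0 h (t : 'rV[R]_3) : 0 <= Num.max (h * t ord0 ord0) 0 * (nrm t ^- 3 * G t).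
  by nneg; exact: nrm_ge0.
apply: (@le_trans _ _ (int3 (fun t =>
    (Num.max (eps * t ord0 ord0) 0 * (nrm t ^- 3 * G t))%:E)
    + (pwave_gain m lam n M d s)%:E)%E).
  apply: leeD; last exact: lexx.
  apply: int3_le; [exact: mS|exact: mH| |] => t; rewrite lee_fin.
    by rewrite mulr_ge0.
  by case: (slab _ _ _); rewrite ?mul1r// mul0r.
apply: le_trans (kernel_sign m0 lam0 M0 d1 sD ksM es heps) _.
apply: lee_addr_tail.
have x0 : 0 < `|s 0 0| by move: sD => /andP[h _]; move: d1; lra.
have x2 : 0 < s 0 0 ^+ 2 by rewrite -real_normK ?num_real// exprn_gt0.
have d0 : 0 < d by move: d1; lra.
have K0 : 0 < K by move: dK; lra.
(* Lorentzian majorants of [1 / (s_1^2 + t_1^2)] off the slab: if [|t_1| < d], then [1 / s_1^2 <= 2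
   (d^2 / s_1^2) / (t_1^2 + d^2)]; if [|t_1| > K], then [1 / t_1^2 <= 2 / (t_1^2 + K^2)]. Their
   integrals are explicit. *)
pose p (y : R) := 2 / (1 - kap) *
  (d ^+ 2 / s 0 0 ^+ 2 * ((y + 0) ^+ 2 + d ^+ 2)^-1 + ((y + 0) ^+ 2 + K ^+ 2)^-1).
have p0 y : 0 <= p y.
  by rewrite /p; nneg; exact: ltW.
have mp : measurable_fun setT p by rewrite /p; mfun.
have tailE : (\int[mu]_y (2 * pi * p y)%:E = (tail_loss (s ord0 ord0))%:E)%E.
  rewrite integralZ//; last by nneg.
  rewrite integralZ//; [|by mfun|by move=> y; nneg|by nneg; exact: ltW].
  under eq_integral do rewrite EFinD.
  rewrite ge0_integralD//.
  - rewrite integralZ; [|by mfun|by move=> y; nneg|by nneg].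
    rewrite !integral_inv_sqr ?exprn_gt0// !sqrtr_sqr !gtr0_norm//.
    rewrite -[LHS]/((2 * pi * (2 / (1 - kap) *
      (d ^+ 2 / s 0 0 ^+ 2 * (pi / d) + pi / K)))%:E).
    congr EFin; rewrite /tail_loss.
    have : s 0 0 != 0 by rewrite -normr_gt0.
    have : 1 - kap != 0 by rewrite subr_eq0 gt_eqF.
    move: (s 0 0) (@pi R) (1 - kap) => x q a x0' a0'.
    by field; rewrite ?x0' ?a0' ?gt_eqF.
  - by move=> y _; rewrite lee_fin; nneg.
  - by mfun.
  - by move=> y _; rewrite lee_fin; nneg.
  - by mfun.
rewrite -tailE; apply: (@le_trans _ _ (int3 (fun t => ((slab d K t)%:R *
     (Num.max ((- eps) * t ord0 ord0) 0 * (nrm t ^- 3 * G t)))%:E) +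
   int3 (fun t => (p (t ord0 ord0) * (`|t ord0 ord0| * nrm t ^- 3))%:E))%E); last first.
  by apply: leeD; [exact: lexx|exact: int3_slab].
have mP : rmeasurable (fun t => (p (t ord0 ord0) * (`|t ord0 ord0| * nrm t ^- 3))%:E).
  by move=> e T q mq; have := measurable_nrm mq => h1; rewrite /p; mfun.
rewrite -int3D; [|exact: mS|exact: mP| |]; last 2 first.
- by move=> t; rewrite lee_fin mulr_ge0.
- by move=> t; rewrite lee_fin mulr_ge0//; nneg; exact: nrm_ge0.
apply: int3_le; first exact: mH.
- by move=> e T q mq; apply: emeasurable_funD; [exact: mS|exact: mP].
- by move=> t; rewrite lee_fin.
move=> t; rewrite -EFinD lee_fin; case: (boolP (slab d K t)) => tD.
  by rewrite mul1r lerDl mulr_ge0//; nneg; exact: nrm_ge0.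
rewrite mul0r add0r.
have [t00|t00] := eqVneq (t 0 0) 0.
  by rewrite t00 mulr0 maxxx mul0r normr0 mul0r mulr0.
have le_max : Num.max ((- eps) * t 0 0) 0 <= `|t 0 0|.
  rewrite ge_max normr_ge0 andbT.
  by case: heps => ->; rewrite ?opprK ?mul1r ?mulN1r ?ler_norm// -normrN ler_norm.
have -> : p (t 0 0) * (`|t 0 0| * nrm t ^- 3) = `|t 0 0| * (nrm t ^- 3 * p (t 0 0)).
  by ring.
have n3 : 0 <= nrm t ^- 3 by nneg; exact: nrm_ge0.
apply: ler_pM; [by nneg|exact: mulr_ge0 n3 (G0 t)|exact: le_max|apply: ler_wpM2l => //].
have y2 : 0 < t 0 0 ^+ 2 by rewrite exprn_even_gt0.
have a0 : 0 < 1 - kap by rewrite subr_gt0.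
apply: (@le_trans _ _ (((1 - kap) * (s 0 0 ^+ 2 + t 0 0 ^+ 2))^-1)).
  have g0 : 0 < kin m (consP s (consP t ks)) + lam by rewrite ltr_wpDl ?kin_ge0.
  have b0 : 0 < (1 - kap) * (s 0 0 ^+ 2 + t 0 0 ^+ 2) by rewrite mulr_gt0 ?(addr_gt0 x2 y2).
  rewrite lef_pV2 ?posrE//.
  apply: le_trans (_ : kin m (consP s (consP t ks)) <= _); last by rewrite lerDl ltW.
  apply: le_trans (kin_ge m0 _); rewrite -/kap ler_wpM2l ?(ltW a0)// !sumsq_cons !dot3E.
  have := sumsq_ge0 ks; have := sqr_ge0 (s 0 1); have := sqr_ge0 (s 0 2%:R).
  have := sqr_ge0 (t 0 1); have := sqr_ge0 (t 0 2%:R); rewrite !expr2; lra.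
rewrite invfM /p !addr0 [2 / _]mulrC -[leRHS]mulrA; apply: ler_wpM2l.
  by rewrite invr_ge0 ltW.
move: tD; rewrite /slab negb_and -!ltNge => /orP[td|tK].
  apply: (@le_trans _ _ (2 * (d ^+ 2 / s 0 0 ^+ 2 * (t 0 0 ^+ 2 + d ^+ 2)^-1))); last first.
    by rewrite ler_wpM2l// lerDl invr_ge0 addr_ge0 ?sqr_ge0.
  have td2 : t 0 0 ^+ 2 <= d ^+ 2.
    by rewrite -[t 0 0 ^+ 2]real_normK ?num_real// ler_pXn2r ?nnegrE ?normr_ge0 ?(ltW d0) ?(ltW K0)// ltW.
  apply: (@le_trans _ _ (s 0 0 ^+ 2)^-1); first by rewrite lef_pV2 ?posrE ?addr_gt0// lerDl ltW.
  rewrite -subr_ge0.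
  rewrite (_ : _ - _ = (s 0 0 ^+ 2)^-1 * ((d ^+ 2 - t 0 0 ^+ 2) / (t 0 0 ^+ 2 + d ^+ 2))).
    by rewrite mulr_ge0 ?divr_ge0 ?invr_ge0 ?subr_ge0 ?addr_ge0 ?sqr_ge0.
  have sn0 : s 0 0 != 0 by rewrite -normr_gt0.
  by field; rewrite sn0 andbT gt_eqF// (addr_gt0 y2 (exprn_gt0 2 d0)).
apply: (@le_trans _ _ (2 * (t 0 0 ^+ 2 + K ^+ 2)^-1)); last first.
  by rewrite ler_wpM2l// lerDr; nneg.
have tK2 : K ^+ 2 <= t 0 0 ^+ 2.
  by rewrite -[t 0 0 ^+ 2]real_normK ?num_real// ler_pXn2r ?nnegrE ?normr_ge0 ?(ltW d0) ?(ltW K0)// ltW.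
apply: (@le_trans _ _ (t 0 0 ^+ 2)^-1); first by rewrite lef_pV2 ?posrE ?addr_gt0// lerDr ltW.
rewrite -subr_ge0.
rewrite (_ : _ - _ = (t 0 0 ^+ 2)^-1 * ((t 0 0 ^+ 2 - K ^+ 2) / (t 0 0 ^+ 2 + K ^+ 2))).
  by rewrite mulr_ge0 ?divr_ge0 ?invr_ge0 ?subr_ge0 ?addr_ge0 ?sqr_ge0.
by field; rewrite t00 andbT gt_eqF// (addr_gt0 y2 (exprn_gt0 2 K0)).
Qed.

End SlabEstimate.

(** * The p-wave part of the cross term, integrated over all momenta *)

Section CrossTerm.
Context {R : realType}.
Local Notation mu := (@lebesgue_measure R).

Lemma int3_0 : int3 (fun=> 0%E) = 0%E :> \bar R.
Proof.
rewrite /int3; under eq_integral => x _.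
  under eq_integral => y _ do rewrite integral0.
  rewrite integral0; over.
exact: integral0.
Qed.

Lemma intP_0 n : @intP R n (fun=> 0%E) = 0%E.
Proof. by elim: n => //= n IH; rewrite -[RHS]int3_0; congr int3; apply/funext. Qed.

Lemma lee_scale_add (c a b : R) (x y : \bar R) : 0 <= c ->
  (x + a%:E <= y + b%:E -> c%:E * x + (c * a)%:E <= c%:E * y + (c * b)%:E)%E.
Proof.
move=> c0 h; rewrite !EFinM -!muleDr ?fin_num_adde_defl//.
by apply: lee_wpmul2l.
Qed.

(** The recursive integral runs over [s], [t], [ks] in this order. With [t] innermost, the inner
    integral at fixed [(s, ks)] is the one treated in [kernel_slab]. *)
Lemma intP_swap n (f : cfg R n.+2 -> \bar R) : cmeasurable f -> (forall q, 0 <= f q)%E ->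
  intP f = intP (fun k : cfg R n.+1 =>
    int3 (fun t => f (consP (k ord0) (consP t (rem ord0 k))))).
Proof.
move=> mf f0 /=; apply: (congr1 (@int3 R)); apply/funext => s.
rewrite int3_intP; last 2 first.
- move=> e T a h ma mh; apply: mf; apply: measurable_consP => [c|].
    exact: measurable_cst.
  exact: measurable_consP.
- by move=> a k; exact: f0.
apply: (congr1 (@intP R n)); apply/funext => ks; apply: (congr1 (@int3 R)); apply/funext => t.
by rewrite consP0 (rem0_cons s ks).
Qed.

Lemma intP_cons_mul n (A : 'rV[R]_3 -> R) (P : cfg R n -> R) (p0 : R) :
  rmeasurable (EFin \o A) -> cmeasurable (EFin \o P) ->
  (forall s, 0 <= A s) -> (forall k, 0 <= P k) -> intP (EFin \o P) = p0%:E ->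
  intP (fun k : cfg R n.+1 => (A (k ord0) * P (rem ord0 k))%:E) =
  (p0%:E * int3 (EFin \o A))%E.
Proof.
move=> mA mP A0 P0 Pp /=.
have p00 : 0 <= p0 by rewrite -lee_fin -Pp; apply: intP_ge0 => k; rewrite lee_fin.
rewrite -int3Z; [|exact: mA|by move=> s; rewrite lee_fin|exact: p00].
apply: (congr1 (@int3 R)); apply/funext => s.
rewrite -Pp muleC -intPZ; [|exact: mP|by move=> k; rewrite lee_fin|exact: A0].
by apply: (congr1 (@intP R n)); apply/funext => ks; rewrite consP0 (rem0_cons s ks) EFinM.
Qed.

Variables (m lam : R).
Hypotheses (m0 : 0 < m) (lam0 : 0 < lam).
Let kap := (m + 1)^-1.
Variables (n : nat) (M d K : R).
Hypotheses (M0 : 0 <= M) (d1 : 1 <= d) (dK : d < K).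

Definition pwave (t : 'rV[R]_3) : R := (slab d K t)%:R * (t 0 0 * nrm t ^- 3).
(** Equal to [nrm t * pwave t ^ 2], since the leading part of [Ll] is proportional to the momentum
    of the particle in the p-wave. *)
Definition pwave_density (t : 'rV[R]_3) : R :=
  (slab d K t)%:R * (t 0 0 ^+ 2 * nrm t ^- 5).

Variables (P : cfg R n -> R) (p0 : R).
Hypotheses (mP : cmeasurable (EFin \o P)) (P0 : forall k, 0 <= P k).
Hypotheses (Pp : intP (EFin \o P) = p0%:E).
Hypothesis PM : forall k, P k != 0 -> forall i, nrm (k i) <= M.

(** For [h = 1] and [h = -1], the positive and the negative part of the p-wave contribution to the
    cross term. *)
Definition cross_part (h : R) (q : cfg R n.+2) : R :=
  Num.max (h * (pwave (q ord0) * pwave (q (ord_1 n)))) 0 * P (rem ord0 (rem ord0 q))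
  * Gl m lam q.

Let d0 : 0 < d. Proof. by move: d1; lra. Qed.
Let K0 : 0 < K. Proof. by move: d0 dK; lra. Qed.
Let k01 : 0 < kap < 1. Proof. exact: kap_itv. Qed.

Lemma measurable_pwave e (T : measurableType e) (h : T -> 'rV[R]_3) :
  (forall c, measurable_fun setT (fun t => h t 0 c)) ->
  measurable_fun setT (fun t => pwave (h t)).
Proof.
move=> mh; have h1 := measurable_nrm mh; have h2 := @measurable_slab R d K _ _ _ mh.
by rewrite /pwave; mfun.
Qed.

Lemma measurable_pwave_density e (T : measurableType e) (h : T -> 'rV[R]_3) :
  (forall c, measurable_fun setT (fun t => h t 0 c)) ->
  measurable_fun setT (fun t => pwave_density (h t)).
Proof.
move=> mh; have h1 := measurable_nrm mh; have h2 := @measurable_slab R d K _ _ _ mh.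
by rewrite /pwave_density; mfun.
Qed.

Lemma pwave_density_ge0 t : 0 <= pwave_density t.
Proof. by rewrite /pwave_density; nneg; exact: nrm_ge0. Qed.

Lemma measurable_P e (T : measurableType e) (h : T -> cfg R n) :
  (forall i c, measurable_fun setT (fun t => h t i 0 c)) ->
  measurable_fun setT (fun t => P (h t)).
Proof. by move=> mh; apply/measurable_EFinP; exact: mP. Qed.

Lemma cmeasurable_cross_part h : cmeasurable (EFin \o cross_part h).
Proof.
move=> e T q mq; have h1 := measurable_Gl m lam mq.
have h2 : measurable_fun setT (fun t => P (rem ord0 (rem ord0 (q t)))).
  by apply: measurable_P => i c; exact: mq.
have h3 i : measurable_fun setT (fun t => pwave (q t i)).
  by apply: measurable_pwave => c; exact: mq.
by rewrite /cross_part /=; mfun.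
Qed.

Lemma cross_part_ge0 h q : 0 <= cross_part h q.
Proof. by rewrite /cross_part; nneg; first [exact: P0|rewrite ltW// Gl_gt0]. Qed.

(** Gain per unit of p-wave mass; it tends to the coefficient [4 pi kap A(kap)] as [d] grows. *)
Definition gain_coef : R := 4 * pi * kap * angular kap / (1 + kernel_const m lam n M / d).
Definition loss_coef : R := 4 * pi * kap * (n%:R * M) / (1 - kap).
(** The product of [2 pi], of [4 pi^2 / (1 - kap)] and of [4 pi], the last being the sum of the two
    Lorentzian integrals in [E1]. *)
Definition loss_const : R := 32 * pi ^+ 4 / (1 - kap).

Let loss (s : 'rV[R]_3) : R := shift_loss m n M s + tail_loss m d K (s 0 0).

Let kc0 : 0 <= kernel_const m lam n M.
Proof.
have /andP[k0 k1] := k01.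
by rewrite divr_ge0//; nneg; [exact: ltW|rewrite -/kap expr_le1 ?ltW].
Qed.

Let ang0 : 0 <= angular kap.
Proof.
have /andP[k0 k1] := k01.
rewrite -lee_fin -integral_angular//; apply: integral_ge0 => u _; rewrite lee_fin.
case: (boolP (0 < u < 1)) => u01; rewrite ?mul0r// mul1r divr_ge0 ?sqr_ge0// subr_ge0.
have /andP[u0 u1] := u01.
apply: mulr_ile1; [exact: sqr_ge0| | |by rewrite gerBl sqr_ge0].
  by rewrite subr_ge0 expr_le1 ?(ltW u1) ?(ltW u0).
by rewrite expr_le1 ?(ltW k1) ?(ltW k0).
Qed.

Let pwave_gainE s : `|pwave s| * pwave_gain m lam n M d s = gain_coef * pwave_density s.
Proof.
rewrite /pwave /pwave_density; case: (boolP (slab d K s)) => sD; last by rewrite !mul0r normr0 mul0r mulr0.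
have s0 : 0 < nrm s.
  apply: lt_le_trans d0 _; move: sD => /andP[h _]; exact: le_trans (coord0_le_nrm s).
rewrite !mul1r normrM normfV normrX (ger0_norm (nrm_ge0 s)).
rewrite /pwave_gain /gain_coef -/kap -nrm_sqr -[s 0 0 ^+ 2]real_normK ?num_real//.
have : 1 + kernel_const m lam n M / d != 0 by rewrite gt_eqF// ltr_pwDl// divr_ge0// ltW.
move: (1 + kernel_const m lam n M / d) (@pi R) (`|s 0 0|) (angular kap) => D p x a D0.
by field; rewrite D0 gt_eqF.
Qed.

(** On the slab [d / x^2 <= 2 d / (x^2 + d^2)] and [1 / K <= 2 K / (x^2 + K^2)], and each majorant
    has integral [2 pi] whatever its scale. This uniformity in [d] and [K] is what lets the
    logarithm win. *)
Let E1 : (int3 (fun s => (`|pwave s| * tail_loss m d K (s ord0 ord0))%:E) <= loss_const%:E)%E.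
Proof.
have /andP[k0 k1] := k01; have a0 : 0 < 1 - kap by rewrite subr_gt0.
pose p (x : R) := 4 * pi ^+ 2 / (1 - kap) *
  (2 * d * ((x + 0) ^+ 2 + d ^+ 2)^-1 + 2 * K * ((x + 0) ^+ 2 + K ^+ 2)^-1).
have p00 x : 0 <= p x by rewrite /p; nneg; exact: ltW.
have mp : measurable_fun setT p by rewrite /p; mfun.
have d2 : 0 < d ^+ 2 by rewrite exprn_gt0.
have K2 : 0 < K ^+ 2 by rewrite exprn_gt0.
apply: (@le_trans _ _ (\int[mu]_x (2 * pi * p x)%:E)%E); last first.
  rewrite integralZ//; last by nneg.
  rewrite integralZ//; [|by mfun|by move=> y; nneg; exact: ltW|by nneg; exact: ltW].
  under eq_integral do rewrite EFinD.
  rewrite ge0_integralD//; last 4 first.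
  - by move=> y _; rewrite lee_fin; nneg; exact: ltW.
  - by mfun.
  - by move=> y _; rewrite lee_fin; nneg; exact: ltW.
  - by mfun.
  rewrite integralZ; [|by mfun|by move=> y; nneg|by nneg; exact: ltW].
  rewrite integralZ; [|by mfun|by move=> y; nneg|by nneg; exact: ltW].
  rewrite !integral_inv_sqr// !sqrtr_sqr !gtr0_norm//.
  rewrite -[X in (X <= _)%E]/((2 * pi * (4 * pi ^+ 2 / (1 - kap) *
    (2 * d * (pi / d) + 2 * K * (pi / K))))%:E).
  rewrite lee_fin /loss_const -/kap le_eqVlt; apply/orP; left; apply/eqP.
  by move: (@pi R) (1 - kap) a0 => q a a0; field; rewrite !gt_eqF.
apply: le_trans (int3_slab mp p00); apply: int3_le.
- move=> e T q mq; have h1 := measurable_pwave mq.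
  by rewrite /tail_loss; mfun.
- by move=> e T q mq; have := measurable_nrm mq => h1; rewrite /p; mfun.
- by move=> s; rewrite lee_fin /tail_loss; nneg; exact: ltW.
move=> s; rewrite lee_fin /pwave; case: (boolP (slab d K s)) => sD; last first.
  by rewrite mul0r normr0 mul0r; nneg; first [exact: p00|exact: nrm_ge0].
rewrite mul1r normrM normfV normrX (ger0_norm (nrm_ge0 s)) mulrC ler_wpM2r//.
  by nneg; exact: nrm_ge0.
rewrite /tail_loss /p -/kap ler_wpM2l//; first by nneg; exact: ltW.
have /andP[h1 h2] := sD.
have x0 : 0 < `|s 0 0| by apply: lt_le_trans h1.
rewrite -[s 0 0 ^+ 2]real_normK ?num_real// addr0 -[s 0 0 ^+ 2]real_normK ?num_real//.
move: (`|s 0 0|) x0 h1 h2 => x x0 dx xK.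
have x2 : 0 < x ^+ 2 by rewrite exprn_gt0.
apply: lerD.
  rewrite -subr_ge0 (_ : _ - _ = d * (x ^+ 2 - d ^+ 2) / (x ^+ 2 * (x ^+ 2 + d ^+ 2))).
    rewrite divr_ge0//; last by rewrite mulr_ge0 ?addr_ge0// ltW.
    by rewrite mulr_ge0 ?subr_ge0 ?(ltW d0)// ler_pXn2r ?nnegrE ?(ltW d0) ?(ltW x0).
  by field; rewrite !gt_eqF// addr_gt0.
rewrite -subr_ge0 (_ : _ - _ = (K ^+ 2 - x ^+ 2) / (K * (x ^+ 2 + K ^+ 2))).
  rewrite divr_ge0//; last by rewrite mulr_ge0 ?addr_ge0// ltW.
  by rewrite subr_ge0 ler_pXn2r ?nnegrE ?(ltW K0) ?(ltW x0).
by field; rewrite !gt_eqF// addr_gt0.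
Qed.

(** The missing power of [s_1] is supplied by [d <= |s_1|] on the slab, at the price of the factor
    [1 / d]. *)
Let shift_lossE s : `|pwave s| * shift_loss m n M s <= loss_coef / d * pwave_density s.
Proof.
have /andP[k0 k1] := k01; have a0 : 0 < 1 - kap by rewrite subr_gt0.
rewrite /pwave /pwave_density; case: (boolP (slab d K s)) => sD; last by rewrite !mul0r normr0 mul0r mulr0.
have /andP[h1 h2] := sD.
have s0 : 0 < nrm s by apply: lt_le_trans d0 _; exact: le_trans (coord0_le_nrm s).
rewrite !mul1r normrM normfV normrX (ger0_norm (nrm_ge0 s)).
rewrite /shift_loss /loss_coef -/kap -nrm_sqr -[s 0 0 ^+ 2]real_normK ?num_real//.
have nM : 0 <= n%:R * M by rewrite mulr_ge0.
have c0 : 0 <= 4 * pi * kap * (n%:R * M) / (1 - kap) * nrm s ^- 5.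
  by nneg; first [exact: ltW|exact: nrm_ge0].
rewrite -subr_ge0 (_ : _ - _ = (4 * pi * kap * (n%:R * M) / (1 - kap) * nrm s ^- 5) *
    (`|s 0 0| * ((`|s 0 0| - d) / d))); last first.
  move: (@pi R) (1 - kap) a0 (nrm s) s0 (`|s 0 0|) => p a a0 r r0 x.
  by field; rewrite !gt_eqF.
by rewrite mulr_ge0// mulr_ge0// divr_ge0 ?subr_ge0// ltW.
Qed.

(** The sign of [s_1] moves into the direction tested on [t], which brings the integrand into the
    form of [kernel_slab]. *)
Let max_pwave h s t : (h = 1 \/ h = -1) -> slab d K s ->
  Num.max (h * (pwave s * pwave t)) 0 = `|pwave s| *
    ((slab d K t)%:R * (Num.max (h * Num.sg (s 0 0) * t 0 0) 0 * nrm t ^- 3)).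
Proof.
move=> hh sD; have n3 : 0 <= nrm t ^- 3 by nneg; exact: nrm_ge0.
have s3 : 0 <= nrm s ^- 3 by nneg; exact: nrm_ge0.
have -> : h * (pwave s * pwave t) =
   (`|pwave s| * ((slab d K t)%:R * nrm t ^- 3)) * (h * Num.sg (s 0 0) * t 0 0).
  rewrite /pwave sD !mul1r normrM (ger0_norm s3) [in LHS](numEsg (s 0 0)).
  by ring.
have c0 : 0 <= `|pwave s| * ((slab d K t)%:R * nrm t ^- 3) by nneg.
rewrite -[in X in Num.max _ X](mulr0 (`|pwave s| * ((slab d K t)%:R * nrm t ^- 3))).
by rewrite -maxr_pMr//; ring.
Qed.

(** If [P ks] or [pwave s] vanishes, both sides are zero; otherwise this is [kernel_slab] multiplied
    by [|pwave s| * P ks], with [eps] the sign of [s_1]. *)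
Let inner_le (k : cfg R n.+1) :
  (int3 (fun t => (cross_part 1 (consP (k ord0) (consP t (rem ord0 k))))%:E)
   + (`|pwave (k ord0)| * pwave_gain m lam n M d (k ord0) * P (rem ord0 k))%:E <=
   int3 (fun t => (cross_part (-1) (consP (k ord0) (consP t (rem ord0 k))))%:E)
   + (`|pwave (k ord0)| * loss (k ord0) * P (rem ord0 k))%:E)%E.
Proof.
set s := k ord0; set ks := rem ord0 k.
have qE h t : cross_part h (consP s (consP t ks)) =
    Num.max (h * (pwave s * pwave t)) 0 * P ks * Gl m lam (consP s (consP t ks)).
  rewrite /cross_part consP0 !rem0_cons.
  by have -> : consP s (consP t ks) (ord_1 n) = t by rewrite consPS consP0.
have Z h : (forall t, cross_part h (consP s (consP t ks)) = 0) ->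
    int3 (fun t => (cross_part h (consP s (consP t ks)))%:E) = 0%E.
  move=> c0; rewrite -[RHS]int3_0; apply: (congr1 (@int3 R)).
  by apply/funext => t; rewrite c0.
have [Pk|Pk] := eqVneq (P ks) 0.
  rewrite (Z 1) 1?(Z (-1)); [by rewrite Pk 2!mulr0| |];
  by move=> t; rewrite qE Pk mulr0 mul0r.
have [sD|sD] := boolP (slab d K s); last first.
  have ps : pwave s = 0 by rewrite /pwave (negbTE sD) mul0r.
  rewrite (Z 1) 1?(Z (-1)); [by rewrite ps normr0 4!mul0r| |];
  by move=> t; rewrite qE ps mul0r mulr0 maxxx !mul0r.
have x0 : 0 < `|s 0 0| by move: sD => /andP[h _]; exact: lt_le_trans h.
pose c := `|pwave s| * P ks.
have c0 : 0 <= c by rewrite /c; nneg; exact: P0.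
have heps : Num.sg (s 0 0) = 1 \/ Num.sg (s 0 0) = -1.
  by case: (ltgtP (s 0 0) 0) x0 => [/ltr0_sg|/gtr0_sg|->]; rewrite ?normr0 ?ltxx; [right|left|].
pose A h t := (slab d K t)%:R * (Num.max (h * t ord0 ord0) 0 *
   (nrm t ^- 3 * Gl m lam (consP s (consP t ks)))).
have A0 h t : (0 <= (A h t)%:E)%E.
  by rewrite lee_fin /A; nneg; first [exact: nrm_ge0|rewrite ltW// Gl_gt0].
have mA h : rmeasurable (fun t => (A h t)%:E).
  move=> e T q mq; have h1 := measurable_nrm mq; have h2 := @measurable_slab R d K _ _ _ mq.
  have h3 : measurable_fun setT (fun t => Gl m lam (consP s (consP (q t) ks))).
    apply: measurable_Gl; apply: measurable_consP => [c'|]; first exact: measurable_cst.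
    by apply: measurable_consP => // i c'; exact: measurable_cst.
  by rewrite /A; mfun.
have intE h : h = 1 \/ h = -1 ->
   int3 (fun t => (cross_part h (consP s (consP t ks)))%:E) =
   (c%:E * int3 (fun t => (A (h * Num.sg (s 0%R 0%R)) t)%:E))%E.
  move=> hh; rewrite -int3Z; [|exact: mA|exact: A0|exact: c0].
  apply: (congr1 (@int3 R)); apply/funext => t.
  rewrite qE max_pwave// -EFinM /A /c; congr EFin; ring.
rewrite !intE; [|by right|by left].
have -> : `|pwave s| * pwave_gain m lam n M d s * P ks = c * pwave_gain m lam n M d s.
  by rewrite /c; ring.
have -> : `|pwave s| * loss s * P ks = c * loss s by rewrite /c; ring.
apply: lee_scale_add => //.
rewrite mul1r mulN1r; apply: kernel_slab => //; first exact: PM.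
by rewrite -normrEsg.
Qed.

(** Integration of [inner_le] over [(s, ks)], where gains and losses factor into a one-particle
    integral and the spectator mass [p0]. The additive form is meaningful before the two integrals
    of [cross_part] are known to be finite. *)
Lemma cross_main (J : R) : int3 (EFin \o pwave_density) = J%:E ->
  (intP (EFin \o cross_part 1) + (p0 * (gain_coef * J))%:E <=
   intP (EFin \o cross_part (-1)) + (p0 * (loss_coef / d * J + loss_const))%:E)%E.
Proof.
move=> dJ; have /andP[k0 k1] := k01.
have gc0 : 0 <= gain_coef.
  by rewrite /gain_coef; nneg; first [exact: ltW|exact: kc0].
have p00 : 0 <= p0 by rewrite -lee_fin -Pp; apply: intP_ge0 => k; rewrite lee_fin.
have md : rmeasurable (EFin \o pwave_density).
  by move=> e T h mh; apply/measurable_EFinP; exact: measurable_pwave_density.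
have d_ge0 s : (0 <= (EFin \o pwave_density) s)%E by rewrite lee_fin pwave_density_ge0.
have mgain : rmeasurable (fun s => (`|pwave s| * pwave_gain m lam n M d s)%:E).
  move=> e T h mh; have h1 := measurable_pwave_density mh.
  rewrite (_ : (fun t => _) = (fun t => (gain_coef * pwave_density (h t))%:E)).
    by mfun.
  by apply/funext => t; rewrite pwave_gainE.
have gE : intP (fun k : cfg R n.+1 =>
    (`|pwave (k ord0)| * pwave_gain m lam n M d (k ord0) * P (rem ord0 k))%:E) =
    (p0 * (gain_coef * J))%:E.
  rewrite (@intP_cons_mul n (fun s => `|pwave s| * pwave_gain m lam n M d s) P p0).
  - rewrite (_ : EFin \o _ = (fun s => gain_coef%:E * (EFin \o pwave_density) s)%E).
      by rewrite int3Z ?dJ.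
    by apply/funext => s /=; rewrite pwave_gainE.
  - exact: mgain.
  - exact: mP.
  - by move=> s; rewrite pwave_gainE mulr_ge0 ?pwave_density_ge0.
  - exact: P0.
  - exact: Pp.
have loss0 s : 0 <= loss s.
  rewrite /loss /shift_loss /tail_loss -/kap.
  by nneg; first [exact: ltW|exact: dot3_ge0].
have mloss : rmeasurable (fun s => (`|pwave s| * loss s)%:E).
  move=> e T h mh; have h1 := measurable_pwave mh; have h2 := measurable_dot3 mh mh.
  by rewrite /loss /shift_loss /tail_loss; mfun.
have lE : (intP (fun k : cfg R n.+1 =>
    (`|pwave (k ord0)| * loss (k ord0) * P (rem ord0 k))%:E) <=
    (p0 * (loss_coef / d * J + loss_const))%:E)%E.
  rewrite (@intP_cons_mul n (fun s => `|pwave s| * loss s) P p0).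
  - rewrite EFinM; apply: lee_wpmul2l; first by rewrite lee_fin.
    apply: (@le_trans _ _ (int3 (fun s => (loss_coef / d)%:E * (EFin \o pwave_density) s
        + (`|pwave s| * tail_loss m d K (s ord0 ord0))%:E)%E)).
      apply: int3_le.
      + exact: mloss.
      + move=> e T h mh; apply: emeasurable_funD.
          by apply: measurable_funeM; exact: md.
        by have h1 := measurable_pwave mh; rewrite /tail_loss; mfun.
      + by move=> s; rewrite lee_fin mulr_ge0.
      + move=> s; rewrite /= -EFinM -EFinD lee_fin /loss mulrDr lerD2r.
        exact: shift_lossE.
    rewrite int3D; last 4 first.
    + by move=> e T h mh; apply: measurable_funeM; exact: md.
    + by move=> e T h mh; have h1 := measurable_pwave mh; rewrite /tail_loss; mfun.
    + move=> s; apply: mule_ge0; last exact: d_ge0.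
      by rewrite lee_fin /loss_coef; nneg; exact: ltW.
    + by move=> s; rewrite lee_fin /tail_loss -/kap; nneg; exact: ltW.
    rewrite int3Z; [|exact: md|exact: d_ge0|]; last first.
      by rewrite /loss_coef; nneg; exact: ltW.
    by rewrite dJ -EFinM EFinD; apply: leeD; [exact: lexx|exact: E1].
  - exact: mloss.
  - exact: mP.
  - by move=> s; rewrite mulr_ge0.
  - exact: P0.
  - exact: Pp.
have mI h : cmeasurable (fun k : cfg R n.+1 =>
    int3 (fun t => (cross_part h (consP (k ord0) (consP t (rem ord0 k))))%:E)).
  apply: (@cmeasurable_int3 R n.+1 (fun t k =>
    (cross_part h (consP (k ord0) (consP t (rem ord0 k))))%:E)).
    move=> e T a q ma mq; apply: cmeasurable_cross_part.
    apply: measurable_consP; first by move=> c; exact: mq.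
    by apply: measurable_consP => // i c; exact: mq.
  by move=> a k; rewrite lee_fin cross_part_ge0.
have I0 h (k : cfg R n.+1) :
    (0 <= int3 (fun t => (cross_part h (consP (k ord0) (consP t (rem ord0 k))))%:E))%E.
  by apply: int3_ge0 => t; rewrite lee_fin cross_part_ge0.
have mX A : rmeasurable (fun s => (`|pwave s| * A s)%:E) ->
    cmeasurable (fun k : cfg R n.+1 => (`|pwave (k ord0)| * A (k ord0) * P (rem ord0 k))%:E).
  move=> mA e T q mq; apply/measurable_EFinP; apply: measurable_fun_mulr.
    by apply/measurable_EFinP; apply: (mA _ _ (fun t => q t ord0)) => c; exact: mq.
  by apply: measurable_P => i c; exact: mq.
apply: le_trans (leeD (lexx _) lE).
rewrite -gE !intP_swap; [|exact: cmeasurable_cross_part|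
  by move=> q; rewrite lee_fin cross_part_ge0|exact: cmeasurable_cross_part|
  by move=> q; rewrite lee_fin cross_part_ge0].
have g_ge0 (k : cfg R n.+1) : (0 <= (`|pwave (k ord0)| *
    pwave_gain m lam n M d (k ord0) * P (rem ord0 k))%:E)%E.
  by rewrite lee_fin mulr_ge0// pwave_gainE mulr_ge0// pwave_density_ge0.
have l_ge0 (k : cfg R n.+1) : (0 <= (`|pwave (k ord0)| *
    loss (k ord0) * P (rem ord0 k))%:E)%E.
  by rewrite lee_fin mulr_ge0// mulr_ge0.
have D1 := intPD (mI 1) (mX _ mgain) (I0 1) g_ge0.
have D2 := intPD (mI (-1)) (mX _ mloss) (I0 (-1)) l_ge0.
have eqW (x y : \bar R) : x = y -> (x <= y)%E by move=> ->.
apply: le_trans (eqW _ _ (esym D1)) _; apply: le_trans _ (eqW _ _ D2).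
apply: intP_le.
- by move=> e T q mq; apply: emeasurable_funD; [exact: mI|exact: (mX _ mgain)].
- by move=> e T q mq; apply: emeasurable_funD; [exact: mI|exact: (mX _ mloss)].
- by move=> k; apply: adde_ge0.
- exact: inner_le.
Qed.

End CrossTerm.

(** * The orbitals, the charge [xi] and its weighted norms *)

Section TrialFamily.
Context {R : realType}.
Variables (n : nat) (d K : R).
Hypotheses (dn : n.+1%:R <= d) (dK : d < K).

(** Orbital 0 is the p-wave and the cells have indices 1 to [n]. They lie in [x_1 < n + 1 <= d],
    hence off the slab. *)
Definition fam (j : 'I_n.+1) : 'rV[R]_3 -> R :=
  if j == ord0 then pwave d K else cell j%:R.

(** The square of the orbital, multiplied by [|t|] in the case of the p-wave, so that its mass is
    known exactly. *)
Definition dens (j : 'I_n.+1) : 'rV[R]_3 -> R :=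
  if j == ord0 then pwave_density d K else cell j%:R.

Definition pwave_mass : R := 4 * pi / 3 * ln (K / d).

Let mass (j : 'I_n.+1) : R := if j == ord0 then pwave_mass else 1.

Let d1 : 1 <= d. Proof. by apply: le_trans dn; rewrite ler1n. Qed.
Let d0 : 0 < d. Proof. by apply: lt_le_trans d1. Qed.

Lemma cell_ge0 j (t : 'rV[R]_3) : 0 <= cell j t.
Proof. by rewrite /cell; nneg. Qed.

Lemma cell_sqr j (t : 'rV[R]_3) : cell j t ^+ 2 = cell j t.
Proof.
rewrite /cell; case: (_ && _); case: (_ && _); case: (_ && _);
by rewrite ?mul1r ?mul0r ?expr1n ?expr0n.
Qed.

Lemma cell_neq0 j (t : 'rV[R]_3) : cell j t != 0 ->
  [/\ j <= t 0 0 < j + 1, 0 <= t 0 1 < 1 & 0 <= t 0 2%:R < 1].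
Proof.
rewrite /cell !mulf_eq0 !pnatr_eq0 !eqb0 !negb_or !negbK => /andP[h1 /andP[h2 h3]].
by split.
Qed.

Lemma measurable_cell j e (T : measurableType e) (h : T -> 'rV[R]_3) :
  (forall c, measurable_fun setT (fun t => h t 0 c)) ->
  measurable_fun setT (fun t => cell j (h t)).
Proof. by move=> mh; rewrite /cell; mfun. Qed.

Lemma nrm_le_sum (t : 'rV[R]_3) : nrm t <= `|t 0 0| + `|t 0 1| + `|t 0 2%:R|.
Proof.
rewrite -[leRHS]ger0_norm; last by nneg.
rewrite -sqrtr_sqr ler_wsqrtr// dot3E -!expr2 -(real_normK (num_real (t 0 0))).
rewrite -(real_normK (num_real (t 0 1))) -(real_normK (num_real (t 0 2%:R))).
have := normr_ge0 (t 0 0); have := normr_ge0 (t 0 1); have := normr_ge0 (t 0 2%:R).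
by move: `|t 0 0| `|t 0 1| `|t 0 2%:R| => x y z z0 y0 x0; nra.
Qed.

(** The bound is [(n + 1) + 1 + 1], one summand per coordinate; it serves as [M] in all later
    estimates. *)
Lemma cell_nrm (j : 'I_n.+1) (t : 'rV[R]_3) : cell j%:R t != 0 -> nrm t <= n.+3%:R.
Proof.
move=> /cell_neq0[/andP[a1 a2] /andP[b1 b2] /andP[c1 c2]].
apply: le_trans (nrm_le_sum t) _.
have j0 : 0 <= j%:R :> R by [].
have jn : j%:R <= n%:R :> R by rewrite ler_nat -ltnS.
have -> : n.+3%:R = n%:R + 3 :> R by rewrite -[n.+3]addn3 natrD.
by rewrite !ger0_norm//; lra.
Qed.

Lemma pwave_neq0 (t : 'rV[R]_3) : pwave d K t != 0 -> slab d K t.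
Proof. by rewrite /pwave; case: (slab _ _ _) => //; rewrite mul0r eqxx. Qed.

Lemma slab_nrm (t : 'rV[R]_3) : slab d K t -> d <= nrm t.
Proof. by move=> /andP[h _]; exact: le_trans (coord0_le_nrm t). Qed.

Lemma pwave_sqr (t : 'rV[R]_3) : nrm t * pwave d K t ^+ 2 = pwave_density d K t.
Proof.
rewrite /pwave /pwave_density; case: (boolP (slab d K t)) => tD; last first.
  by rewrite !mul0r expr0n mulr0.
have t0 : nrm t != 0 by rewrite gt_eqF// (lt_le_trans d0)// slab_nrm.
by rewrite !mul1r; field.
Qed.

Lemma fam_ortho : orthofam fam.
Proof.
have aux (j : 'I_n.+1) (x : 'rV[R]_3) : pwave d K x * cell j%:R x = 0.
  have [->|/pwave_neq0/andP[h1 _]] := eqVneq (pwave d K x) 0; first by rewrite mul0r.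
  have [->|/cell_neq0[/andP[h2 h3] _ _]] := eqVneq (cell j%:R x) 0; first by rewrite mulr0.
  have j0 : 0 <= j%:R :> R by [].
  have jn : j%:R + 1 <= n.+1%:R :> R by rewrite natr1 ler_nat ltn_ord.
  by move: h1; rewrite ger0_norm ?(le_trans j0)//; move: dn; lra.
move=> j l x jl; rewrite /fam; case: eqP => [j0|_]; case: eqP => [l0|_].
- by rewrite j0 l0 eqxx in jl.
- exact: aux.
- by rewrite mulrC aux.
have [->|/cell_neq0[/andP[h1 h2] _ _]] := eqVneq (cell j%:R x) 0; first by rewrite mul0r.
have [->|/cell_neq0[/andP[h3 h4] _ _]] := eqVneq (cell l%:R x) 0; first by rewrite mulr0.
move: jl; rewrite neq_ltn => /orP[jl|jl].
  have : j%:R + 1 <= l%:R :> R by rewrite natr1 ler_nat.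
  by lra.
have : l%:R + 1 <= j%:R :> R by rewrite natr1 ler_nat.
by lra.
Qed.

Lemma measurable_fam j e (T : measurableType e) (h : T -> 'rV[R]_3) :
  (forall c, measurable_fun setT (fun t => h t 0 c)) ->
  measurable_fun setT (fun t => fam j (h t)).
Proof.
by move=> mh; rewrite /fam; case: (_ == _); [exact: measurable_pwave|exact: measurable_cell].
Qed.

Lemma measurable_dens j e (T : measurableType e) (h : T -> 'rV[R]_3) :
  (forall c, measurable_fun setT (fun t => h t 0 c)) ->
  measurable_fun setT (fun t => dens j (h t)).
Proof.
by move=> mh; rewrite /dens; case: (_ == _);
  [exact: measurable_pwave_density|exact: measurable_cell].
Qed.

Lemma dens_ge0 j t : 0 <= dens j t.
Proof. by rewrite /dens; case: (_ == _); [exact: pwave_density_ge0|exact: cell_ge0]. Qed.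

Lemma int3_dens j : int3 (EFin \o dens j) = (mass j)%:E.
Proof.
by rewrite /dens /mass; case: (_ == _); [exact: int3_pwave|exact: int3_cell].
Qed.

Lemma pwave_mass_ge0 : 0 <= pwave_mass.
Proof.
have := int3_dens ord0; rewrite /mass eqxx => h; rewrite -lee_fin -h.
by apply: int3_ge0 => t; rewrite lee_fin dens_ge0.
Qed.

(** On the slab [|t| >= d], so an unweighted p-wave costs a factor [1 / d]. This is the smallness of
    [psi] and of the spectator exchange. *)
Lemma fam_sqr_le j t : fam j t ^+ 2 <= (if j == ord0 then d^-1 else 1) * dens j t.
Proof.
rewrite /fam /dens; case: (_ == _); last by rewrite cell_sqr mul1r.
have [->|pt] := eqVneq (pwave d K t) 0.
  by rewrite expr0n mulr_ge0 ?invr_ge0 ?pwave_density_ge0 ?(ltW d0).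
rewrite -pwave_sqr mulrA ler_peMl ?sqr_ge0// mulrC ler_pdivlMr// mul1r.
by rewrite slab_nrm// pwave_neq0.
Qed.

Lemma measurable_slater N (f : 'I_N -> 'rV[R]_3 -> R) e (T : measurableType e) (h : T -> cfg R N) :
  (forall j, rmeasurable (EFin \o f j)) ->
  (forall i c, measurable_fun setT (fun t => h t i 0 c)) ->
  measurable_fun setT (fun t => slater f (h t)).
Proof.
move=> mf mh; rewrite (_ : (fun t => _) =
  (fun t => \sum_(s : 'S_N) (-1) ^+ s * \prod_i f (s i) (h t i))); last first.
  by apply/funext => t; exact: slaterE.
have h1 j i : measurable_fun setT (fun t => f j (h t i)).
  by apply/measurable_EFinP; apply: mf => c; exact: mh.
by mfun.
Qed.

Section spike.
(** Masses and factors [1 / d] are functions of the orbital that differ from 1 at the p-wave only,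
    so a product over any permutation reduces to a single value. *)
Variable b : 'I_n.+1 -> R.
Hypothesis b1 : forall j, j != ord0 -> b j = 1.

Let prod_spike : \prod_j b j = b ord0.
Proof. by rewrite big_ord_recl big1 ?mulr1// => i _; rewrite b1. Qed.

Lemma prod_spike_perm (s : 'S_n.+1) : \prod_i b (s i) = b ord0.
Proof. by rewrite -prod_spike [RHS](reindex_perm s). Qed.

Lemma prod_spike_lift (s : 'S_n) j : j != ord0 -> \prod_i b (lift j (s i)) = b ord0.
Proof.
move=> j0; have E : \prod_i b (lift j (s i)) = \prod_i b (lift j i).
  by rewrite [RHS](reindex_perm s).
by rewrite E -prod_spike [RHS](bigD1_ord j)//= (b1 j0) mul1r.
Qed.

Lemma prod_spike_lift0 (s : 'S_n) : \prod_i b (lift ord0 (s i)) = 1.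
Proof. by rewrite big1// => i _; rewrite b1. Qed.

End spike.

Let mass1 j : j != ord0 -> mass j = 1.
Proof. by rewrite /mass => /negbTE ->. Qed.

Let mass0 : mass ord0 = pwave_mass.
Proof. by rewrite /mass eqxx. Qed.

Lemma intP_dens N (idx : 'I_N -> 'I_n.+1) :
  intP (fun k => (\prod_i dens (idx i) (k i))%:E) = (\prod_i mass (idx i))%:E.
Proof.
apply: (@intP_prod R N (fun i => dens (idx i))).
- by move=> i e T h mh; apply/measurable_EFinP; exact: measurable_dens.
- by move=> i t; exact: dens_ge0.
- by move=> i; exact: int3_dens.
Qed.

Lemma cmeasurable_dens N (idx : 'I_N -> 'I_n.+1) :
  cmeasurable (fun k => (\prod_i dens (idx i) (k i))%:E).
Proof.
apply: (@cmeasurable_prod R N (fun i => dens (idx i))).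
by move=> i e T h mh; apply/measurable_EFinP; exact: measurable_dens.
Qed.

Lemma rmeasurable_fam j : rmeasurable (EFin \o fam j).
Proof. by move=> e T h mh; apply/measurable_EFinP; exact: measurable_fam. Qed.

Definition xi := slater fam.

(** Satisfied wherever a permutation term of [xi ^ 2] is nonzero, with [i0] the particle in the
    p-wave. *)
Definition spectator_bound (k : cfg R n.+1) i0 :=
  slab d K (k i0) /\ forall j, nrm (rem i0 k j) <= n.+3%:R.

(** By [slater_sqr] there is one term per permutation, with exactly one particle [i0] in the p-wave;
    the factor [nrm (k i0)] turns its [pwave ^ 2] into the density. Applied to the Sobolev weight,
    to [Ll] and to the constant 1. *)
Lemma intP_weight (W : cfg R n.+1 -> R) (c : R) : 0 <= c ->
  (forall k, 0 <= W k) -> cmeasurable (EFin \o W) ->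
  (forall k i0, spectator_bound k i0 -> W k <= c * nrm (k i0)) ->
  (intP (fun k => (W k * xi k ^+ 2)%:E) <= (c * (n.+1`!%:R * pwave_mass))%:E)%E.
Proof.
move=> c0 W0 mW Wc.
apply: (@le_trans _ _ (intP (fun k => \sum_(s : 'S_n.+1) (c%:E *
    (\prod_i dens (s i) (k i))%:E))%E)); last first.
  rewrite intP_sum.
  - rewrite (eq_bigr (fun=> (c * pwave_mass)%:E)); last first.
      move=> s _; rewrite intPZ; [|exact: cmeasurable_dens| |exact: c0].
        by rewrite intP_dens (prod_spike_perm mass1) mass0 -EFinM.
      by move=> k; rewrite lee_fin prodr_ge0// => i _; exact: dens_ge0.
    rewrite sumEFin lee_fin sumr_const (_ : #|_| = n.+1`!); last exact: card_Sn.
    by rewrite -[X in X <= _]mulr_natl [X in X <= _]mulrCA.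
  - move=> s e T h mh; apply: measurable_funeM; exact: cmeasurable_dens.
  - move=> s k; apply: mule_ge0; first by rewrite lee_fin.
    by rewrite lee_fin prodr_ge0// => i _; exact: dens_ge0.
apply: intP_le.
- move=> e T h mh; apply/measurable_EFinP; apply: measurable_fun_mulr.
    by apply/measurable_EFinP; exact: mW.
  by apply: measurable_fun_exprn; apply: measurable_slater => // j; exact: rmeasurable_fam.
- move=> e T h mh; apply: emeasurable_sum => s; apply: measurable_funeM.
  exact: cmeasurable_dens.
- by move=> k; rewrite lee_fin mulr_ge0 ?sqr_ge0.
move=> k; rewrite sumEFin lee_fin slater_sqr; last exact: fam_ortho.
rewrite mulr_sumr; apply: ler_sum => s _.
have [p0|/prodf_neq0 p0] := eqVneq (\prod_i fam (s i) (k i) ^+ 2) 0.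
  by rewrite p0 mulr0 mulr_ge0// prodr_ge0// => i _; exact: dens_ge0.
pose i0 := (s^-1)%g ord0.
have si0 : s i0 = ord0 by rewrite /i0 permKV.
have si i : i != i0 -> s i != ord0.
  by apply: contra => /eqP h; rewrite /i0 -h permK.
have f0 i : fam (s i) (k i) != 0 by have := p0 i isT; rewrite expf_eq0.
have sb : spectator_bound k i0.
  split; first by apply: pwave_neq0; have := f0 i0; rewrite /fam si0 eqxx.
  move=> j; rewrite /rem; have := f0 (lift i0 j); rewrite /fam (negbTE (si _ _)); last first.
    by rewrite eq_sym neq_lift.
  exact: cell_nrm.
rewrite (bigD1 i0)//= [in leRHS](bigD1 i0)//= {1}/fam {1}/dens si0 eqxx -pwave_sqr.
rewrite (eq_bigr (fun i => dens (s i) (k i))); last first.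
  by move=> i /si h; rewrite /fam /dens (negbTE h) cell_sqr.
set p2 := pwave d K (k i0) ^+ 2; set Q := \prod_(i < n.+1 | i != i0) _.
have -> : c * (nrm (k i0) * p2 * Q) = c * nrm (k i0) * (p2 * Q) by ring.
apply: ler_wpM2r; last exact: Wc.
by rewrite mulr_ge0 ?sqr_ge0// prodr_ge0// => i _; exact: dens_ge0.
Qed.

Lemma prod_fam_le N (idx : 'I_N -> 'I_n.+1) (k : cfg R N) :
  \prod_i fam (idx i) (k i) ^+ 2 <=
  \prod_i (if idx i == ord0 then d^-1 else 1) * \prod_i dens (idx i) (k i).
Proof.
rewrite -big_split/=; apply: ler_prod => i _.
by rewrite sqr_ge0 fam_sqr_le.
Qed.

Let spd (j : 'I_n.+1) : R := if j == ord0 then d^-1 else 1.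
Let spd1 j : j != ord0 -> spd j = 1.
Proof. by rewrite /spd => /negbTE ->. Qed.

Lemma xi_sqr_le (k : cfg R n.+1) :
  xi k ^+ 2 <= \sum_(s : 'S_n.+1) d^-1 * \prod_i dens (s i) (k i).
Proof.
rewrite slater_sqr; last exact: fam_ortho.
apply: ler_sum => s _; apply: le_trans (prod_fam_le _ _) _.
by rewrite (prod_spike_perm spd1) /spd eqxx.
Qed.

Definition minor j := slater (fun i => fam (lift j i)).

Lemma minor_ortho j : orthofam (fun i => fam (lift j i)).
Proof. by move=> i l x il; apply: fam_ortho; rewrite (inj_eq lift_inj). Qed.

Lemma minor_sqr_le j (k : cfg R n) : j != ord0 ->
  minor j k ^+ 2 <= \sum_(s : 'S_n) d^-1 * \prod_i dens (lift j (s i)) (k i).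
Proof.
move=> j0; rewrite slater_sqr; last exact: minor_ortho.
apply: ler_sum => s _.
apply: le_trans (prod_fam_le (fun i => lift j (s i)) k) _.
by rewrite (prod_spike_lift spd1)// /spd eqxx.
Qed.

Lemma minor0_sqr (k : cfg R n) :
  minor ord0 k ^+ 2 = \sum_(s : 'S_n) \prod_i dens (lift ord0 (s i)) (k i).
Proof.
rewrite slater_sqr; last exact: minor_ortho.
by apply: eq_bigr => s _; apply: eq_bigr => i _; rewrite /fam /dens/= cell_sqr.
Qed.

Lemma minor0_nrm (k : cfg R n) : minor ord0 k ^+ 2 != 0 -> forall i, nrm (k i) <= n.+3%:R.
Proof.
rewrite minor0_sqr => h i.
have [s hs] : exists s : 'S_n, \prod_i dens (lift ord0 (s i)) (k i) != 0.
  apply/existsP; apply: contraNT h; rewrite negb_exists => /forallP h.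
  by apply/eqP; rewrite big1// => s _; apply/eqP; have := h s; rewrite negbK.
have /prodf_neq0 /(_ i isT) := hs; have nz : lift ord0 (s i) != ord0 by [].
by rewrite /dens (negbTE nz); exact: cell_nrm.
Qed.

Lemma measurable_minor j e (T : measurableType e) (h : T -> cfg R n) :
  (forall i c, measurable_fun setT (fun t => h t i 0 c)) ->
  measurable_fun setT (fun t => minor j (h t)).
Proof. by move=> mh; apply: measurable_slater => // i; exact: rmeasurable_fam. Qed.

Lemma measurable_xi e (T : measurableType e) (h : T -> cfg R n.+1) :
  (forall i c, measurable_fun setT (fun t => h t i 0 c)) ->
  measurable_fun setT (fun t => xi (h t)).
Proof. by move=> mh; apply: measurable_slater => // i; exact: rmeasurable_fam. Qed.

Lemma intP_minor0 : intP (fun k => (minor ord0 k ^+ 2)%:E) = (n`!%:R)%:E.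
Proof.
rewrite (_ : (fun k => _) = (fun k => \sum_(s : 'S_n)
    (\prod_i dens (lift ord0 (s i)) (k i))%:E)%E); last first.
  by apply/funext => k; rewrite minor0_sqr sumEFin.
rewrite intP_sum.
- rewrite (eq_bigr (fun=> 1%:E)); last first.
    by move=> s _; rewrite intP_dens (prod_spike_lift0 mass1).
  by rewrite sumEFin sumr_const (_ : #|_| = n`!)//; exact: card_Sn.
- by move=> s; exact: cmeasurable_dens.
- by move=> s k; rewrite lee_fin prodr_ge0// => i _; exact: dens_ge0.
Qed.

Lemma intP_minor_dens j (s : 'S_n) : j != ord0 ->
  intP (fun k => (\prod_i dens (lift j (s i)) (k i))%:E) = pwave_mass%:E.
Proof. by move=> j0; rewrite intP_dens (prod_spike_lift mass1)// mass0. Qed.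

End TrialFamily.

(** * Bounds on the diagonal weight, the Sobolev weight and the norm of [psi] *)

Section Estimates.
Context {R : realType}.
Local Notation mu := (@lebesgue_measure R).
Variables (n : nat) (d K m lam : R).
Hypotheses (dn : n.+1%:R <= d) (dK : d < K) (m0 : 0 < m) (lam0 : 0 < lam).
Let kap := (m + 1)^-1.
Let k01 : 0 < kap < 1. Proof. exact: kap_itv. Qed.
Let d1 : 1 <= d. Proof. by apply: le_trans dn; rewrite ler1n. Qed.
Let d0 : 0 < d. Proof. by apply: lt_le_trans d1. Qed.
Let K0 : 0 < K. Proof. by apply: lt_trans dK. Qed.
Local Notation M := (n.+3%:R : R).
Local Notation xi := (@xi R n d K).
Local Notation mass := (pwave_mass d K).
Local Notation dens := (@dens R n d K).
Local Notation minor := (@minor R n d K).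

Let mass0 : 0 <= mass. Proof. exact: (pwave_mass_ge0 dn dK). Qed.

Lemma sumsq_rem N (k : cfg R N.+1) i : sumsq k = dot3 (k i) (k i) + sumsq (rem i k).
Proof. by rewrite /sumsq (bigD1_ord i). Qed.

Lemma vsum_rem N (k : cfg R N.+1) i : vsum k = k i + vsum (rem i k).
Proof. by rewrite /vsum (bigD1_ord i). Qed.

Definition spect_const : R := 2 * (n%:R * M) + n%:R * M ^+ 2 + (n%:R * M) ^+ 2 + lam.

(** With [r = nrm (k i0)], [c^2 = 1 - kap^2] and [C] the constant [spect_const], the radicand is at
    most [c^2 r^2 + C r <= (c r + C / (2 c))^2]. Then [r >= d] turns the additive constant into a
    multiple of [r / d]. *)
Lemma Ll_le (k : cfg R n.+1) i0 : spectator_bound d K k i0 ->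
  Ll m lam k <= 2 * pi ^+ 2 * (Num.sqrt (1 - kap ^+ 2)
    + spect_const / (2 * Num.sqrt (1 - kap ^+ 2)) / d) * nrm (k i0).
Proof.
move=> [kD kM]; have /andP[k0 k1] := k01.
rewrite LlE// -[leRHS]mulrA ler_wpM2l//; first by nneg.
set c := Num.sqrt (1 - kap ^+ 2); set r := nrm (k i0).
have rd : d <= r by exact: slab_nrm kD.
have r1 : 1 <= r by exact: le_trans rd.
have c2 : c ^+ 2 = 1 - kap ^+ 2 by rewrite sqr_sqrtr// subr_ge0 expr_le1 ?ltW.
have c0 : 0 < c by rewrite sqrtr_gt0 subr_gt0 expr_lt1 ?ltW.
have C0 : 0 <= spect_const by rewrite /spect_const; nneg; exact: ltW.
have h1 := sumsq_le kM; have h2 := nrm_vsum kM.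
have nM0 : 0 <= n%:R * M by nneg.
have h3 : dot3 (vsum k) (vsum k) <= (r + n%:R * M) ^+ 2.
  rewrite -nrm_sqr ler_pXn2r ?nnegrE ?nrm_ge0 ?addr_ge0 ?nrm_ge0//.
  by rewrite (vsum_rem k i0); apply: le_trans (ler_nrmD _ _) _; rewrite lerD2l.
have h4 : sumsq k <= r ^+ 2 + n%:R * M ^+ 2 by rewrite (sumsq_rem k i0) /r nrm_sqr lerD2l.
apply: (@le_trans _ _ (c * r + spect_const / (2 * c))); last first.
  have -> : (c + spect_const / (2 * c) / d) * r =
    c * r + spect_const / (2 * c) * (r / d) by ring.
  rewrite lerD2l; apply: ler_peMr; last by rewrite ler_pdivlMr// mul1r.
  by rewrite divr_ge0// mulr_ge0// ltW.
rewrite -[leRHS]ger0_norm; last first.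
  by nneg; first [exact: ltW|exact: nrm_ge0].
rewrite -sqrtr_sqr ler_wsqrtr//.
have -> : (c * r + spect_const / (2 * c)) ^+ 2 =
    (1 - kap ^+ 2) * r ^+ 2 + spect_const * r + (spect_const / (2 * c)) ^+ 2.
  by rewrite -c2; field; rewrite gt_eqF.
apply: (@le_trans _ _ ((1 - kap ^+ 2) * r ^+ 2 + spect_const * r)); last by rewrite lerDl sqr_ge0.
apply: (@le_trans _ _ ((1 - kap) * (r ^+ 2 + n%:R * M ^+ 2 + kap * (r + n%:R * M) ^+ 2) + lam)).
  rewrite lerD2r ler_wpM2l ?subr_ge0 ?(ltW k1)//; apply: lerD => //.
  by rewrite ler_wpM2l// ltW.
rewrite /spect_const; move: (n%:R * M) (n%:R * M ^+ 2) nM0 (mulr_ge0 (ler0n R n) (sqr_ge0 M)) => x y x0 y0.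
have e1 : 0 <= (r - 1) * (y + x ^+ 2 + lam).
  by rewrite mulr_ge0 ?subr_ge0// !addr_ge0 ?sqr_ge0// ltW.
have e2 : kap * (1 - kap) <= 1 by rewrite mulr_ile1 ?subr_ge0 ?(ltW k0) ?(ltW k1)// gerBl ltW.
have e3 : 0 <= (1 - kap * (1 - kap)) * (2 * x * r + x ^+ 2).
  rewrite mulr_ge0 ?subr_ge0// addr_ge0 ?sqr_ge0// mulr_ge0 ?mulr_ge0//.
  by apply: le_trans r1.
have e4 : 0 <= kap * y by rewrite mulr_ge0// ltW.
(* The difference as a sum of terms that are nonnegative because [r >= 1] and [kap (1 - kap) <= 1];
   here [x] is [n M] and [y] is [n M^2]. *)
rewrite -subr_ge0; rewrite (_ : _ - _ = (r - 1) * (y + x ^+ 2 + lam) +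
  (1 - kap * (1 - kap)) * (2 * x * r + x ^+ 2) + kap * y); first by rewrite !addr_ge0.
by ring.
Qed.

Lemma sobolev_weight_le (k : cfg R n.+1) i0 : spectator_bound d K k i0 ->
  Num.sqrt (1 + sumsq k) <= (2 + n%:R * M ^+ 2) * nrm (k i0).
Proof.
move=> [kD kM]; set r := nrm (k i0).
have rd : d <= r by exact: slab_nrm kD.
have r1 : 1 <= r by exact: le_trans rd.
have r0 : 0 <= r by exact: le_trans r1.
have h1 := sumsq_le kM.
have y0 : 0 <= n%:R * M ^+ 2 by nneg.
rewrite -[leRHS]ger0_norm; last by rewrite mulr_ge0 ?addr_ge0.
rewrite -sqrtr_sqr ler_wsqrtr// (sumsq_rem k i0) -nrm_sqr -/r.
apply: (@le_trans _ _ (1 + (r ^+ 2 + n%:R * M ^+ 2))); first by rewrite !lerD2l.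
move: (n%:R * M ^+ 2) y0 => y y0.
have r2 : 0 <= r ^+ 2 - 1 by rewrite subr_ge0 exprn_ege1.
rewrite -subr_ge0 (_ : _ - _ = 3 * (r ^+ 2 - 1) + 2 + 4 * (y * (r ^+ 2 - 1)) + 3 * y + (y * r) ^+ 2).
  by nneg; first [exact: y0|move: r2; rewrite subr_ge0].
by ring.
Qed.

Lemma sqr_sum_le (I : finType) (a : I -> R) :
  (\sum_i a i) ^+ 2 <= #|I|%:R * \sum_i a i ^+ 2.
Proof.
have e1 : \sum_i \sum_j (a i ^+ 2 + a j ^+ 2) = 2 * (#|I|%:R * \sum_i a i ^+ 2).
  under eq_bigr do rewrite big_split/= sumr_const.
  by rewrite big_split/= sumr_const sumrMnl -mulr_natl; ring.
have e2 : (\sum_i a i) ^+ 2 = \sum_i \sum_j a i * a j.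
  by rewrite expr2 mulr_suml; under eq_bigr do rewrite mulr_sumr.
rewrite -(@ler_pM2l _ 2)// -e1 e2 mulr_sumr; apply: ler_sum => i _.
rewrite mulr_sumr; apply: ler_sum => j _.
by have := sqr_ge0 (a i - a j); nra.
Qed.

Definition resolvent (t : 'rV[R]_3) : R := ((1 - kap) * dot3 t t + lam) ^- 2.

Lemma Gl_sqr_le N (k : cfg R N) i : Gl m lam k ^+ 2 <= resolvent (k i).
Proof.
have /andP[k0 k1] := k01; rewrite /Gl /resolvent -exprVn.
have g0 : 0 < (1 - kap) * dot3 (k i) (k i) + lam.
  by rewrite ltr_wpDl// mulr_ge0 ?dot3_ge0// subr_ge0 ltW.
have h : (1 - kap) * dot3 (k i) (k i) + lam <= kin m k + lam.
  rewrite lerD2r; apply: le_trans (kin_ge m0 k); rewrite ler_wpM2l ?subr_ge0 ?(ltW k1)//.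
  exact: dot3_le_sumsq.
rewrite ler_pXn2r ?nnegrE ?invr_ge0 ?(ltW g0) ?(ltW (lt_le_trans g0 h))//.
by rewrite lef_pV2 ?posrE ?(lt_le_trans g0 h).
Qed.

Lemma measurable_resolvent e (T : measurableType e) (h : T -> 'rV[R]_3) :
  (forall c, measurable_fun setT (fun t => h t 0 c)) ->
  measurable_fun setT (fun t => resolvent (h t)).
Proof. by move=> mh; rewrite /resolvent; have h1 := measurable_dot3 mh mh; mfun. Qed.

Lemma resolvent_ge0 t : 0 <= resolvent t.
Proof. by rewrite /resolvent; nneg. Qed.

Lemma measurable_Gxi e (T : measurableType e) (h : T -> cfg R n.+2) :
  (forall i c, measurable_fun setT (fun t => h t i 0 c)) ->
  measurable_fun setT (fun t => Gxi m lam xi (h t)).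
Proof.
move=> mh; rewrite /Gxi; have h1 := measurable_Gl m lam mh.
have h2 i : measurable_fun setT (fun t => xi (rem i (h t))).
  by apply: measurable_xi => j c; exact: mh.
by mfun.
Qed.

(** In the [i]-th summand of [Gxi] the charge does not involve [k i], and [Gl ^ 2] is bounded by the
    [resolvent] of [k i] alone, so the integral factors. One power of [n + 2] comes from
    Cauchy-Schwarz, the other from the number of summands. *)
Lemma intP_psi (g0 : R) : int3 (EFin \o resolvent) = g0%:E ->
  (intP (fun k => (Gxi m lam xi k ^+ 2)%:E) <=
   (n.+2%:R ^+ 2 * g0 / d * (n.+1`!%:R * mass))%:E)%E.
Proof.
move=> gE; have g00 : 0 <= g0.
  by rewrite -lee_fin -gE; apply: int3_ge0 => t; rewrite lee_fin resolvent_ge0.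
(* Particle [i] carries the resolvent, the others the densities permuted by [s]. *)
pose h (i : 'I_n.+2) (s : 'S_n.+1) (p : 'I_n.+2) : 'rV[R]_3 -> R :=
  if unlift i p is Some l then dens (s l) else resolvent.
have hE i s (k : cfg R n.+2) : \prod_p h i s p (k p) =
    resolvent (k i) * \prod_l dens (s l) (rem i k l).
  rewrite (bigD1_ord i)//= {1}/h unlift_none; congr (_ * _).
  by apply: eq_bigr => l _; rewrite /h liftK.
have h0 i s p t : 0 <= h i s p t.
  by rewrite /h; case: (unlift i p) => [l|]; [exact: dens_ge0|exact: resolvent_ge0].
have mh i s : forall p, rmeasurable (EFin \o h i s p).
  move=> p e T q mq; apply/measurable_EFinP; rewrite /h.
  by case: (unlift i p) => [l|]; [exact: measurable_dens|exact: measurable_resolvent].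
pose c := n.+2%:R / d.
have c0 : 0 <= c by rewrite /c; nneg; exact: ltW.
have hI i s : intP (fun k => (\prod_p h i s p (k p))%:E) = (g0 * mass)%:E.
  rewrite (@intP_prod R n.+2 (h i s) (fun p => if unlift i p is Some l then
      (if s l == ord0 then mass else 1) else g0)).
  - rewrite (bigD1_ord i)//= unlift_none; congr ((_ * _)%:E).
    rewrite (eq_bigr (fun l => if s l == ord0 then mass else 1)); last first.
      by move=> l _; rewrite liftK.
    rewrite (@prod_spike_perm R n (fun j => if j == ord0 then mass else 1))//.
    by move=> j /negbTE ->.
  - exact: mh.
  - exact: h0.
  - move=> p; rewrite /h; case: (unlift i p) => [l|]; last exact: gE.
    exact: (int3_dens dn dK).
apply: (@le_trans _ _ (intP (fun k => \sum_(i < n.+2) \sum_(s : 'S_n.+1)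
    (c%:E * (\prod_p h i s p (k p))%:E))%E)); last first.
  rewrite intP_sum; last 2 first.
  - move=> i e T q mq; apply: emeasurable_sum => s; apply: measurable_funeM.
    exact: (cmeasurable_prod (mh i s)).
  - move=> i k; apply: sume_ge0 => s _; apply: mule_ge0; rewrite lee_fin//.
    by apply: prodr_ge0 => p _; exact: h0.
  rewrite (eq_bigr (fun=> (n.+1`!%:R * (c * (g0 * mass)))%:E)); last first.
    move=> i _; rewrite intP_sum; last 2 first.
    + move=> s e T q mq; apply: measurable_funeM; exact: (cmeasurable_prod (mh i s)).
    + by move=> s k; apply: mule_ge0; rewrite lee_fin//; apply: prodr_ge0 => p _; exact: h0.
    rewrite (eq_bigr (fun=> (c * (g0 * mass))%:E)); last first.
      move=> s _; rewrite intPZ; [|exact: (cmeasurable_prod (mh i s))| |exact: c0].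
        by rewrite hI -EFinM.
      by move=> k; rewrite lee_fin; apply: prodr_ge0 => p _; exact: h0.
    rewrite sumEFin sumr_const (_ : #|_| = n.+1`!); last exact: card_Sn.
    by congr EFin; rewrite [RHS]mulr_natl.
  rewrite sumEFin lee_fin sumr_const card_ord -[X in X <= _]mulr_natl.
  rewrite le_eqVlt; apply/orP; left; apply/eqP; rewrite /c; move: (n.+2%:R) (n.+1`!%:R) mass => x y z.
  by field; rewrite gt_eqF.
apply: intP_le.
- by move=> e T q mq; have h1 := measurable_Gxi mq; mfun.
- move=> e T q mq; apply: emeasurable_sum => i; apply: emeasurable_sum => s.
  by apply: measurable_funeM; exact: (cmeasurable_prod (mh i s)).
- by move=> k; rewrite lee_fin sqr_ge0.
move=> k; under eq_bigr do rewrite sumEFin; rewrite sumEFin lee_fin.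
rewrite /Gxi exprMn.
apply: (@le_trans _ _ (Gl m lam k ^+ 2 * (n.+2%:R * \sum_i xi (rem i k) ^+ 2))).
  rewrite ler_wpM2l ?sqr_ge0//; apply: le_trans (sqr_sum_le _) _.
  rewrite card_ord ler_wpM2l// le_eqVlt; apply/orP; left; apply/eqP.
  by apply: eq_bigr => i _; rewrite exprMn sqrr_sign mul1r.
rewrite mulrCA mulr_sumr mulr_sumr; apply: ler_sum => i _.
apply: (@le_trans _ _ (n.+2%:R * (resolvent (k i) *
    \sum_(s : 'S_n.+1) d^-1 * \prod_l dens (s l) (rem i k l)))).
  rewrite ler_wpM2l// ler_pM ?sqr_ge0//; first exact: Gl_sqr_le.
  exact: xi_sqr_le.
rewrite !mulr_sumr le_eqVlt; apply/orP; left; apply/eqP; apply: eq_bigr => s _.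
by rewrite hE /c; ring.
Qed.

End Estimates.

(** * Borel measurability and antisymmetry of the trial functions *)

Section BorelMeasurability.
Context {R : realType}.

Lemma borel_coord n (i : 'I_n) (c : 'I_3) :
  @measurable_fun _ _ (g_sigma_algebraType (@open (cfg R n))) R setT
    (fun k : cfg R n => k i 0 c).
Proof.
have cont : continuous (fun k : cfg R n => k i 0 c).
  move=> k; apply: (@continuous_comp _ _ _ (fun k : cfg R n => k i)
    (fun x : 'rV[R]_3 => x 0 c)).
    exact: (@proj_continuous _ (fun _ : 'I_n => 'rV[R]_3) i).
  exact: coord_continuous.
apply: (measurability _ (RGenOpens.measurableE R)).
move=> _ [_ [a [b ->] <-]]; rewrite setTI; apply: sub_sigma_algebra.
by move/continuousP: cont; apply; exact: interval_open.
Qed.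

(** The criterion is tested on the identity map of the Borel space, whose coordinates are
    continuous. *)
Lemma borel_fun_from_coords n (u : cfg R n -> R) :
  (forall e (T : measurableType e) (h : T -> cfg R n),
    (forall i c, measurable_fun setT (fun t => h t i 0 c)) ->
    measurable_fun setT (fun t => u (h t))) -> borel_fun u.
Proof. move=> mu; apply: (@mu _ (g_sigma_algebraType (@open (cfg R n))) (fun k => k)).
by move=> i c; exact: borel_coord. Qed.

Lemma sumsq_perm n (s : 'S_n) (k : cfg R n) : sumsq (fun i => k (s i)) = sumsq k.
Proof. by rewrite /sumsq [RHS](reindex_perm s). Qed.

Lemma vsum_perm n (s : 'S_n) (k : cfg R n) : vsum (fun i => k (s i)) = vsum k.
Proof. by rewrite /vsum [RHS](reindex_perm s). Qed.

Lemma Gl_perm m lam n (s : 'S_n) (k : cfg R n) :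
  Gl m lam (fun i => k (s i)) = Gl m lam k.
Proof. by rewrite /Gl !kinE sumsq_perm vsum_perm. Qed.

(* The alternating sum is the determinant bordered by a column of ones. *)
Lemma Gxi_antisym m lam n (f : 'I_n.+1 -> 'rV[R]_3 -> R) :
  antisym (Gxi m lam (slater f)).
Proof.
pose g (j : 'I_n.+2) : 'rV[R]_3 -> R := if unlift ord0 j is Some l then f l else cst 1.
have E k : \sum_(i < n.+2) (-1) ^+ i * slater f (rem i k) = slater g k.
  rewrite /slater (expand_det_col _ ord0); apply: eq_bigr => i _.
  rewrite mxE {1}/g unlift_none mul1r /cofactor addn0; congr (_ * \det _).
  by apply/matrixP => j l; rewrite !mxE /g liftK.
by move=> s k; rewrite /Gxi Gl_perm !E slater_antisym mulrCA.
Qed.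

End BorelMeasurability.

(** * The cross term as p-wave exchange plus spectator exchange *)

Section CrossDecomposition.
Context {R : realType}.
Local Notation mu := (@lebesgue_measure R).
Variables (n : nat) (d K m lam : R).
Hypotheses (dn : n.+1%:R <= d) (dK : d < K) (m0 : 0 < m) (lam0 : 0 < lam).
Let d1 : 1 <= d. Proof. by apply: le_trans dn; rewrite ler1n. Qed.
Let d0 : 0 < d. Proof. by apply: lt_le_trans d1. Qed.
Let K0 : 0 < K. Proof. by apply: lt_trans dK. Qed.
Local Notation xid := (@xi R n d K).
Local Notation mass := (pwave_mass d K).
Local Notation dens := (@dens R n d K).
Local Notation orb := (@fam R n d K).
Local Notation minor := (@minor R n d K).
Let P k : R := minor ord0 k ^+ 2.
Local Notation part := (cross_part m lam d K P).

Lemma maxr_posneg (x : R) : x = Num.max x 0 - Num.max (- x) 0.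
Proof.
have [h|h] := orP (le_total x 0).
  by rewrite max_r// max_l ?oppr_ge0// sub0r opprK.
by rewrite max_l// max_r ?oppr_le0// subr0.
Qed.

Lemma consP_eta N (q : cfg R N.+1) : consP (q ord0) (rem ord0 q) = q.
Proof.
apply/funext => i; case: (unliftP ord0 i) => [j ->|->]; last by rewrite consP0.
by rewrite consPS.
Qed.

(** The terms [j > 0] of [slater_cons_mul]. They are nonnegative, hence of the unfavourable sign,
    but the p-wave sits unweighted in their minors, so that they total [O(J / d)]. *)
Definition spectator_cross (q : cfg R n.+2) : R :=
  \sum_(i < n) orb (lift ord0 i) (q ord0) * orb (lift ord0 i) (q (ord_1 n)) *
    minor (lift ord0 i) (rem ord0 (rem ord0 q)) ^+ 2 * Gl m lam q.

Lemma crossE q :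
  cross m lam xid (fun=> 0) q = part 1 q - part (-1) q + spectator_cross q.
Proof.
rewrite /cross mulr0 addr0.
have qE : q = consP (q ord0) (consP (q (ord_1 n)) (rem ord0 (rem ord0 q))).
  by rewrite -{1}(consP_eta q) -{1}(consP_eta (rem ord0 q)).
have e1 : rem (ord_1 n) q = consP (q ord0) (rem ord0 (rem ord0 q)).
  by rewrite {1}qE rem1_cons.
have e2 : rem ord0 q = consP (q (ord_1 n)) (rem ord0 (rem ord0 q)).
  exact: (esym (consP_eta (rem ord0 q))).
rewrite (congr2 (fun a b => xid a * xid b) e1 e2); clear e1 e2 qE.
rewrite /xi slater_cons_mul; last exact: fam_ortho.
rewrite big_ord_recl mulrDl mulr_suml; congr (_ + _).
rewrite /cross_part {1 2}/fam eqxx -!mulrBl mul1r mulN1r; congr (_ * _ * _).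
exact: maxr_posneg.
Qed.

Lemma spectator_cross_ge0 q : 0 <= spectator_cross q.
Proof.
apply: sumr_ge0 => i _; rewrite /fam /=.
by nneg; first [exact: cell_ge0|rewrite ltW// Gl_gt0].
Qed.

Lemma measurable_spectator_cross e (T : measurableType e) (h : T -> cfg R n.+2) :
  (forall i c, measurable_fun setT (fun t => h t i 0 c)) ->
  measurable_fun setT (fun t => spectator_cross (h t)).
Proof.
move=> mh; rewrite /spectator_cross; have h1 := measurable_Gl m lam mh.
have h2 j i : measurable_fun setT (fun t => orb j (h t i)).
  by apply: measurable_fam => c; exact: mh.
have h3 j : measurable_fun setT (fun t => minor j (rem ord0 (rem ord0 (h t)))).
  by apply: measurable_minor => i c; exact: mh.
by mfun.
Qed.

Lemma intP_spectator_cross :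
  (intP (EFin \o spectator_cross) <= (n%:R * (n`!%:R * ((lam * d)^-1 * mass)))%:E)%E.
Proof.
have c0 : 0 <= (lam * d)^-1 by rewrite invr_ge0 mulr_ge0// ltW.
pose A (i : 'I_n) (s : 'S_n) (q : cfg R n.+2) : R :=
  cell (lift ord0 i)%:R (q ord0) * (cell (lift ord0 i)%:R (rem ord0 q ord0) *
   \prod_l dens (lift (lift ord0 i) (s l)) (rem ord0 (rem ord0 q) l)).
have A0 i s q : 0 <= A i s q.
  rewrite /A; apply: mulr_ge0; first exact: cell_ge0.
  apply: mulr_ge0; first exact: cell_ge0.
  by apply: prodr_ge0 => l _; exact: dens_ge0.
have mA i s : cmeasurable (EFin \o A i s).
  move=> e T h mh; apply/measurable_EFinP; rewrite /A.
  have h1 j : measurable_fun setT (fun t => cell (lift ord0 i)%:R (h t j)).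
    by apply: measurable_cell => c; exact: mh.
  have h2 j l : measurable_fun setT (fun t => dens j (rem ord0 (rem ord0 (h t)) l)).
    by apply: measurable_dens => c; exact: mh.
  apply: measurable_fun_mulr; first exact: h1.
  by apply: measurable_fun_mulr; [exact: h1|apply: measurable_fun_prodr => l; exact: h2].
have mcell j : rmeasurable (EFin \o @cell R j).
  by move=> e T h mh; apply/measurable_EFinP; exact: measurable_cell.
have AI i s : intP (EFin \o A i s) = mass%:E.
  have j0 : lift ord0 i != ord0 by [].
  pose Q (k : cfg R n) := \prod_l dens (lift (lift ord0 i) (s l)) (k l).
  have Q0 k : 0 <= Q k by apply: prodr_ge0 => l _; exact: dens_ge0.
  have mQ : cmeasurable (EFin \o Q) by exact: cmeasurable_dens.
  have QI : intP (EFin \o Q) = mass%:E by exact: (intP_minor_dens dn dK s j0).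
  pose Q1 (k : cfg R n.+1) := cell (lift ord0 i)%:R (k ord0) * Q (rem ord0 k).
  have Q10 k : 0 <= Q1 k by apply: mulr_ge0; [exact: cell_ge0|exact: Q0].
  have mQ1 : cmeasurable (EFin \o Q1).
    move=> e T h mh; apply/measurable_EFinP; apply: measurable_fun_mulr.
      by apply: measurable_cell => c; exact: mh.
    by apply/measurable_EFinP; apply: mQ => l c; exact: mh.
  have Q1I : intP (EFin \o Q1) = mass%:E.
    have := intP_cons_mul (mcell _) mQ (@cell_ge0 R (lift ord0 i)%:R) Q0 QI.
    by rewrite (_ : int3 _ = 1%:E) ?mule1//; exact: int3_cell.
  have := intP_cons_mul (mcell _) mQ1 (@cell_ge0 R (lift ord0 i)%:R) Q10 Q1I.
  by rewrite (_ : int3 _ = 1%:E) ?mule1//; exact: int3_cell.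
pose c := (lam * d)^-1.
apply: (@le_trans _ _ (intP (fun q => \sum_(i < n) \sum_(s : 'S_n)
    (c%:E * (A i s q)%:E))%E)); last first.
  rewrite intP_sum; last 2 first.
  - by move=> i e T q mq; apply: emeasurable_sum => s; apply: measurable_funeM; exact: mA.
  - by move=> i k; apply: sume_ge0 => s _; apply: mule_ge0; rewrite lee_fin.
  rewrite (eq_bigr (fun=> (n`!%:R * (c * mass))%:E)); last first.
    move=> i _; rewrite intP_sum; last 2 first.
    + by move=> s e T q mq; apply: measurable_funeM; exact: mA.
    + by move=> s k; apply: mule_ge0; rewrite lee_fin.
    rewrite (eq_bigr (fun=> (c * mass)%:E)); last first.
      move=> s _; rewrite intPZ; [|exact: mA| |exact: c0]; first by rewrite AI -EFinM.
      by move=> k; rewrite lee_fin.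
    rewrite sumEFin sumr_const (_ : #|_| = n`!); last exact: card_Sn.
    by congr EFin; rewrite [RHS]mulr_natl.
  by rewrite sumEFin lee_fin sumr_const card_ord [X in _ <= X]mulr_natl.
apply: intP_le.
- by move=> e T h mh; apply/measurable_EFinP; exact: measurable_spectator_cross.
- move=> e T h mh; apply: emeasurable_sum => i; apply: emeasurable_sum => s.
  by apply: measurable_funeM; exact: mA.
- by move=> q; rewrite lee_fin spectator_cross_ge0.
move=> q; under eq_bigr do rewrite sumEFin; rewrite sumEFin lee_fin.
apply: ler_sum => i _; have j0 : lift ord0 i != ord0 by [].
rewrite {1 2}/fam (negbTE j0).
set x := cell _ _; set y := cell _ _.
have x0 : 0 <= x by exact: cell_ge0.
have y0 : 0 <= y by exact: cell_ge0.
apply: (@le_trans _ _ (x * y * (\sum_(s : 'S_n) d^-1 *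
   \prod_l dens (lift (lift ord0 i) (s l)) (rem ord0 (rem ord0 q) l)) * lam^-1)).
  apply: ler_pM; last exact: Gl_le.
  - by rewrite mulr_ge0 ?sqr_ge0// mulr_ge0.
  - by rewrite ltW// Gl_gt0.
  - by apply: ler_wpM2l; [rewrite mulr_ge0|exact: minor_sqr_le].
rewrite mulr_sumr mulr_suml le_eqVlt; apply/orP; left; apply/eqP.
apply: eq_bigr => s _; rewrite /A -/x -/y /c invfM.
by move: (\prod_l _) => z; ring.
Qed.

(** Finiteness by crude bounds: [Gl <= 1 / lam], and [pwave] is absolutely integrable because the
    slab is bounded in the first coordinate. *)
Lemma intP_part_lty h : h = 1 \/ h = -1 -> (intP (EFin \o part h) < +oo)%E.
Proof.
move=> hh.
have mp : rmeasurable (fun t => (`|pwave d K t|)%:E).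
  by move=> e T q mq; have h1 := @measurable_pwave R d K _ _ _ mq; mfun.
have [w wE] : exists w, int3 (fun t => (`|pwave d K t|)%:E) = w%:E.
  have : int3 (fun t => (`|pwave d K t|)%:E) \is a fin_num.
    rewrite ge0_fin_numE; last by apply: int3_ge0 => t; rewrite lee_fin.
    (* At least 1 for [|x| <= K], and integrable in closed form. *)
    pose p (x : R) := 2 * K ^+ 2 * ((x + 0) ^+ 2 + K ^+ 2)^-1.
    have p0 x : 0 <= p x by rewrite /p; nneg.
    have mpp : measurable_fun setT p by rewrite /p; mfun.
    have K2 : 0 < K ^+ 2 by rewrite exprn_gt0.
    apply: (@le_lt_trans _ _ (\int[mu]_x (2 * pi * p x)%:E)%E); last first.
      rewrite integralZ//; last by nneg.
      rewrite integralZ; [|by mfun|by move=> x; nneg|by nneg].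
      by rewrite integral_inv_sqr// -!EFinM ltry.
    apply: le_trans (int3_slab mpp p0); apply: int3_le.
    - exact: mp.
    - by move=> e T q mq; have := measurable_nrm mq => h1; rewrite /p; mfun.
    - by move=> t; rewrite lee_fin.
    move=> t; rewrite lee_fin /pwave; case: (boolP (slab d K t)) => tD; last first.
      by rewrite mul0r normr0; apply: mulr_ge0; [exact: p0|nneg; exact: nrm_ge0].
    rewrite mul1r normrM normfV normrX (ger0_norm (nrm_ge0 t)); apply: ler_peMl.
      by nneg; exact: nrm_ge0.
    have /andP[_ h2] := tD; rewrite /p addr0 ler_pdivlMr ?mul1r; last first.
      by rewrite ltr_wpDl ?sqr_ge0.
    have : t 0 0 ^+ 2 <= K ^+ 2.
      by rewrite -(real_normK (num_real (t 0 0))) ler_pXn2r ?nnegrE ?(ltW K0).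
    by lra.
  by move=> /fineK <-; eexists.
have w0 : 0 <= w by rewrite -lee_fin -wE; apply: int3_ge0 => t; rewrite lee_fin.
have P0 k : 0 <= P k by exact: sqr_ge0.
have mP : cmeasurable (EFin \o P).
  by move=> e T q mq; have h1 := @measurable_minor R n d K ord0 _ _ _ mq; apply/measurable_EFinP;
    apply: measurable_fun_exprn.
have PI : intP (EFin \o P) = (n`!%:R)%:E by exact: intP_minor0.
have n0 (t : 'rV[R]_3) : 0 <= `|pwave d K t| by [].
pose Q1 (k : cfg R n.+1) := `|pwave d K (k ord0)| * P (rem ord0 k).
have Q10 k : 0 <= Q1 k by rewrite mulr_ge0.
have mQ1 : cmeasurable (EFin \o Q1).
  move=> e T q mq; apply/measurable_EFinP; apply: measurable_fun_mulr.
    by apply/measurable_EFinP; apply: (mp _ _ (fun t => q t ord0)) => c; exact: mq.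
  by apply/measurable_EFinP; apply: (mP _ _ (fun t => rem ord0 (q t))) => l c; exact: mq.
have Q1I : intP (EFin \o Q1) = (n`!%:R * w)%:E.
  by have := intP_cons_mul mp mP n0 P0 PI; rewrite wE -EFinM.
have Q2I := intP_cons_mul mp mQ1 n0 Q10 Q1I.
pose Q2 (q : cfg R n.+2) : R := `|pwave d K (q ord0)| * Q1 (rem ord0 q).
have mQ2 : cmeasurable (EFin \o Q2).
  move=> e T q mq; apply/measurable_EFinP; apply: measurable_fun_mulr.
    by apply/measurable_EFinP; apply: (mp _ _ (fun t => q t ord0)) => c; exact: mq.
  by apply/measurable_EFinP; apply: (mQ1 _ _ (fun t => rem ord0 (q t))) => l c; exact: mq.
apply: (@le_lt_trans _ _ (intP (fun q => (lam^-1)%:E * (Q2 q)%:E)%E)); last first.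
  rewrite intPZ; [|exact: mQ2| |by rewrite invr_ge0 ltW]; last first.
    by move=> q; rewrite lee_fin mulr_ge0.
  by rewrite Q2I wE -!EFinM ltry.
apply: intP_le.
- exact: cmeasurable_cross_part.
- by move=> e T q mq; apply: measurable_funeM; exact: mQ2.
- by move=> q; rewrite lee_fin; exact: cross_part_ge0.
move=> q; rewrite -EFinM lee_fin /cross_part /Q2 /Q1 mulrC.
apply: ler_pM; [by rewrite ltW// Gl_gt0|by nneg; exact: P0|exact: Gl_le|].
rewrite [leRHS]mulrA; apply: ler_wpM2r; first exact: P0.
rewrite -normrM ge_max normr_ge0 andbT.
by case: hh => ->; rewrite ?mul1r ?mulN1r ?ler_norm// -normrN ler_norm.
Qed.

End CrossDecomposition.

(** * Finiteness and upper bound of the cross integral *)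

Section TrialEnergy.
Context {R : realType}.
Variables (n : nat) (d K m lam : R).
Hypotheses (dn : n.+1%:R <= d) (dK : d < K) (m0 : 0 < m) (lam0 : 0 < lam).

Let J := pwave_mass d K.
Let J0 : 0 <= J. Proof. exact: pwave_mass_ge0 dn dK. Qed.
Let d1 : 1 <= d. Proof. by apply: le_trans dn; rewrite -[1]/(1%:R) ler_nat. Qed.
Let d0 : 0 < d. Proof. exact: lt_le_trans d1. Qed.
Let P (k : cfg R n) : R := minor d K ord0 k ^+ 2.
Let part := cross_part m lam d K P.
Let c : cfg R n.+2 -> R := cross m lam (xi d K) (fun=> 0).

Let P0 k : 0 <= P k. Proof. exact: sqr_ge0. Qed.
Let mP : cmeasurable (EFin \o P).
Proof.
move=> e T q mq; have h1 := @measurable_minor R n d K ord0 _ _ _ mq.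
by apply/measurable_EFinP; apply: measurable_fun_exprn.
Qed.
Let mpart h : cmeasurable (EFin \o part h). Proof. exact: cmeasurable_cross_part. Qed.
Let part0 h q : 0 <= part h q. Proof. exact: cross_part_ge0. Qed.
Let s := @spectator_cross R n d K m lam.
Let s0 q : 0 <= s q. Proof. exact: spectator_cross_ge0. Qed.
Let ms : cmeasurable (EFin \o s).
Proof. by move=> e T q mq; apply/measurable_EFinP; exact: measurable_spectator_cross. Qed.
Let cE q : c q = part 1 q - part (-1) q + s q. Proof. exact: crossE. Qed.
Let mc : cmeasurable (EFin \o c).
Proof.
move=> e T q mq; apply/measurable_EFinP.
rewrite (_ : (fun t => c (q t)) = fun t => part 1 (q t) - part (-1) (q t) + s (q t)); last first.
  by apply/funext => t; exact: cE.
apply: measurable_fun_addr; last exact: measurable_spectator_cross.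
by apply: measurable_funB; apply/measurable_EFinP; apply: mpart.
Qed.

Lemma intP_abs_cross_lty :
  (intP (fun q => `|cross m lam (@xi R n d K) (fun=> 0) q|%:E) < +oo)%E.
Proof.
pose u := EFin \o part 1; pose v := EFin \o part (-1); pose w := EFin \o s.
have uv0 q : (0 <= (u \+ v) q)%E by rewrite /u /v /= -EFinD lee_fin addr_ge0.
have muv : cmeasurable (u \+ v)%E.
  by move=> e T q mq; apply: emeasurable_funD; apply: mpart.
apply: (@le_lt_trans _ _ (intP ((u \+ v) \+ w)%E)).
  apply: intP_le.
  - move=> e T q mq; apply/measurable_EFinP; apply: measurableT_comp => //.
    by apply/measurable_EFinP; exact: mc.
  - by move=> e T q mq; apply: emeasurable_funD; [exact: muv|exact: ms].
  - by move=> q; rewrite lee_fin.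
  move=> q; rewrite /u /v /w /= -!EFinD lee_fin -/(c q) cE.
  have a1 := part0 1 q; have a2 := part0 (-1) q; have a3 := s0 q.
  by rewrite ler_norml; apply/andP; split; lra.
rewrite intPD; [|exact: muv|exact: ms|exact: uv0|by move=> q; rewrite lee_fin].
rewrite intPD; [|exact: mpart|exact: mpart|by move=> q; rewrite lee_fin|by move=> q; rewrite lee_fin].
apply: lte_add_pinfty; [apply: lte_add_pinfty|].
- exact: (intP_part_lty dn dK m0 lam0 (or_introl erefl)).
- exact: (intP_part_lty dn dK m0 lam0 (or_intror erefl)).
by apply: le_lt_trans (intP_spectator_cross dn dK m0 lam0) _; rewrite ltry.
Qed.

Let fin_nonneg (x : \bar R) : (0 <= x)%E -> (x < +oo)%E -> exists2 r, 0 <= r & x = r%:E.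
Proof. by case: x => [r|//|//] r0 _; exists r. Qed.

(** [rint] splits the whole integrand by sign, [crossE] only its p-wave part. Pointwise
    [cp + part (-1) = cm + (part 1 + s)]; integrating this identity of nonnegative functions with
    finite integrals carries [cross_main] over to [rint]. *)
Lemma rint_cross_le : exists2 r : R, rint (cross m lam (@xi R n d K) (fun=> 0)) = r%:E &
  r <= n`!%:R * ((n%:R / lam + loss_coef m n n.+3%:R) / d * J + loss_const m
    - gain_coef m lam n n.+3%:R d * J).
Proof.
pose cp q := Num.max (c q) 0; pose cm q := Num.max (- c q) 0.
have cp0 q : 0 <= cp q by rewrite le_max lexx orbT.
have cm0 q : 0 <= cm q by rewrite le_max lexx orbT.
have mcp : cmeasurable (EFin \o cp).
  move=> e T q mq; apply/measurable_EFinP; apply: measurable_maxr => //.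
  by apply/measurable_EFinP; exact: mc.
have mcm : cmeasurable (EFin \o cm).
  move=> e T q mq; apply/measurable_EFinP; apply: measurable_maxr => //.
  by apply: measurable_funN; apply/measurable_EFinP; exact: mc.
have mac : cmeasurable (fun q => `|c q|%:E).
  move=> e T q mq; apply/measurable_EFinP; apply: measurableT_comp => //.
  by apply/measurable_EFinP; exact: mc.
have [a a0 aE] : exists2 a, 0 <= a & intP (EFin \o cp) = a%:E.
  apply: fin_nonneg; first by apply: intP_ge0 => q; rewrite lee_fin.
  apply: le_lt_trans intP_abs_cross_lty; apply: intP_le;
    [exact: mcp|exact: mac|by move=> q; rewrite lee_fin|].
  by move=> q; rewrite lee_fin /cp ge_max ler_norm normr_ge0.
have [b b0 bE] : exists2 b, 0 <= b & intP (EFin \o cm) = b%:E.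
  apply: fin_nonneg; first by apply: intP_ge0 => q; rewrite lee_fin.
  apply: le_lt_trans intP_abs_cross_lty; apply: intP_le;
    [exact: mcm|exact: mac|by move=> q; rewrite lee_fin|].
  by move=> q; rewrite lee_fin /cm ge_max -normrN ler_norm normr_ge0.
have [p _ pE] : exists2 p, 0 <= p & intP (EFin \o part 1) = p%:E.
  apply: fin_nonneg; first by apply: intP_ge0 => q; rewrite lee_fin.
  exact: (intP_part_lty dn dK m0 lam0 (or_introl erefl)).
have [p' _ p'E] : exists2 p, 0 <= p & intP (EFin \o part (-1)) = p%:E.
  apply: fin_nonneg; first by apply: intP_ge0 => q; rewrite lee_fin.
  exact: (intP_part_lty dn dK m0 lam0 (or_intror erefl)).
have sle := intP_spectator_cross dn dK m0 lam0.
have [t _ tE] : exists2 t, 0 <= t & intP (EFin \o s) = t%:E.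
  apply: fin_nonneg; first by apply: intP_ge0 => q; rewrite lee_fin.
  by apply: le_lt_trans sle _; rewrite ltry.
have ms' : cmeasurable ((EFin \o part 1) \+ (EFin \o s))%E.
  by move=> e T q mq; apply: emeasurable_funD; [exact: mpart|exact: ms].
have e1 : intP ((EFin \o cp) \+ (EFin \o part (-1)))%E = (a + p')%:E.
  by rewrite intPD; [rewrite aE p'E|exact: mcp|exact: mpart|
    move=> q; rewrite lee_fin|move=> q; rewrite lee_fin].
have e2 : intP ((EFin \o cm) \+ ((EFin \o part 1) \+ (EFin \o s)))%E = (b + (p + t))%:E.
  rewrite intPD; [|exact: mcm|exact: ms'|by move=> q; rewrite lee_fin|].
    by rewrite intPD; [rewrite bE pE tE|exact: mpart|exact: ms|
      move=> q; rewrite lee_fin|move=> q; rewrite lee_fin].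
  by move=> q; rewrite /= -EFinD lee_fin addr_ge0.
have e3 : a + p' = b + (p + t).
  apply: EFin_inj; rewrite -e1 -e2; apply: (congr1 (@intP R n.+2)); apply/funext => q.
  rewrite /= -!EFinD; congr EFin.
  have := maxr_posneg (c q); rewrite -/(cp q) -/(cm q) {1}cE; lra.
have dJ : int3 (EFin \o pwave_density d K) = J%:E by exact: int3_pwave.
have := cross_main m0 lam0 (ler0n R n.+3) d1 dK mP P0 (intP_minor0 dn dK)
  (@minor0_nrm R n d K dn) dJ.
rewrite -/part pE p'E -!EFinD lee_fin => main.
move: sle; rewrite -/s tE lee_fin => sle.
exists (a - b); first by rewrite /rint -/c -[X in (X - _)%E]/(intP (EFin \o cp))
  -[X in (_ - X)%E]/(intP (EFin \o cm)) aE bE.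
have -> : n`!%:R * ((n%:R / lam + loss_coef m n n.+3%:R) / d * J + loss_const m
    - gain_coef m lam n n.+3%:R d * J) =
  n%:R * (n`!%:R * ((lam * d)^-1 * J)) +
  n`!%:R * (loss_coef m n n.+3%:R / d * J + loss_const m)
  - n`!%:R * (gain_coef m lam n n.+3%:R d * J).
  by rewrite invfM; ring.
by move: main sle e3; rewrite -/J; lra.
Qed.

End TrialEnergy.

(** * The trial state: domain and energy *)

Section TrialState.
Context {R : realType}.
Variables (n : nat) (d K m lam : R).
Hypotheses (dn : n.+1%:R <= d) (dK : d < K) (m0 : 0 < m) (lam0 : 0 < lam).

Let kap := (m + 1)^-1.
Let J1 : R := n.+1`!%:R * pwave_mass d K.
Let u : cfg R n.+1 -> R := xi d K.
Let psi : cfg R n.+2 -> R := Gxi m lam u.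
Let d0 : 0 < d. Proof. by apply: lt_le_trans dn; rewrite ltr0n. Qed.
Let k01 : 0 < kap < 1. Proof. exact: kap_itv. Qed.

Lemma Gxi0 (k : cfg R n.+2) : Gxi m lam (fun=> 0) k = 0.
Proof. by rewrite /Gxi big1 ?mulr0// => i _; rewrite mulr0. Qed.

Lemma nrm2_real N (f : cfg R N -> R) :
  nrm2 f (fun=> 0) = intP (fun k => (f k ^+ 2)%:E).
Proof.
apply: (congr1 (@intP R N)); apply/funext => k.
by rewrite expr0n addr0.
Qed.

Lemma wint_real N (w f : cfg R N -> R) :
  wint w f (fun=> 0) = intP (fun k => (w k * f k ^+ 2)%:E).
Proof.
apply: (congr1 (@intP R N)); apply/funext => k.
by rewrite expr0n addr0.
Qed.

Lemma phi_trial : phiR m lam psi u = fun=> 0.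
Proof. by apply/funext => k; rewrite /phiR /psi subrr. Qed.

Lemma phi_zero : phiR m lam (fun=> 0 : R) (fun=> 0 : R) = fun _ : cfg R n.+2 => 0.
Proof. by apply/funext => k; rewrite /phiR Gxi0 subr0. Qed.

Lemma wint_zero N (w : cfg R N -> R) : wint w (fun=> 0) (fun=> 0) = 0%E.
Proof.
rewrite wint_real -[RHS](intP_0 N); apply: (congr1 (@intP R N)); apply/funext => k.
by rewrite expr0n mulr0.
Qed.

Lemma nrm2_zero N : nrm2 (fun _ : cfg R N => 0 : R) (fun=> 0) = 0%E.
Proof.
rewrite nrm2_real -[RHS](intP_0 N); apply: (congr1 (@intP R N)); apply/funext => k.
by rewrite expr0n.
Qed.

Lemma trial_psi_le (g0 : R) : int3 (EFin \o resolvent m lam) = g0%:E ->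
  (nrm2 psi (fun=> 0%R) <= (n.+2%:R ^+ 2 * g0 / d * J1)%:E)%E.
Proof. by rewrite nrm2_real; exact: intP_psi. Qed.

Lemma trial_FDom : FDom m lam psi (fun=> 0) u (fun=> 0).
Proof.
have /andP[k0 k1] := k01.
have bz N : @borel_fun R N (fun=> 0).
  by apply: borel_fun_from_coords => e T h mh; exact: measurable_cst.
have az N : @antisym R N (fun=> 0) by move=> s k; rewrite mulr0.
split.
- split=> //.
  + by apply: borel_fun_from_coords => e T h mh; exact: measurable_Gxi.
  + exact: Gxi_antisym.
  have [|g0 g00 g0E] := @int3_inv_sqr2 R (1 - kap) lam _ lam0; first by rewrite subr_gt0.
  by apply: le_lt_trans (trial_psi_le g0E) _; rewrite ltry.
- split=> //.
  + by apply: borel_fun_from_coords => e T h mh; exact: measurable_xi.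
  + exact: slater_antisym.
  rewrite wint_real; apply: le_lt_trans (intP_weight dn dK
    (c := 2 + n%:R * n.+3%:R ^+ 2) _ _ _ _) _.
  + by nneg.
  + by move=> k; exact: sqrtr_ge0.
  + move=> e T h mh; apply/measurable_EFinP; apply: measurable_fun_sqrtr.
    by apply: measurable_fun_addr; [exact: measurable_cst|exact: measurable_sumsq].
  + by move=> k i0; exact: sobolev_weight_le.
  by rewrite ltry.
- by rewrite phi_trial phi_zero wint_zero ltry.
exact: intP_abs_cross_lty.
Qed.

Lemma trial_xi_le : (nrm2 u (fun=> 0%R) <= (d^-1 * J1)%:E)%E.
Proof.
rewrite nrm2_real.
have -> : intP (fun k => (u k ^+ 2)%:E) = intP (fun k => (1 * u k ^+ 2)%:E).
  by apply: (congr1 (@intP R n.+1)); apply/funext => k; rewrite mul1r.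
apply: (intP_weight dn dK (W := fun=> 1)).
- by rewrite invr_ge0 ltW.
- by [].
- by move=> e T h mh; exact: measurable_cst.
by move=> k i0 [kD _]; rewrite ler_pdivlMl// mulr1; exact: slab_nrm kD.
Qed.

Lemma trial_Ll_le : (wint (@Ll R m lam n.+1) u (fun=> 0%R) <=
  (2 * pi ^+ 2 * (Num.sqrt (1 - kap ^+ 2)
    + spect_const n lam / (2 * Num.sqrt (1 - kap ^+ 2)) / d) * J1)%:E)%E.
Proof.
rewrite wint_real; apply: intP_weight => //.
- by rewrite /spect_const; nneg; exact: ltW.
- by move=> k; rewrite /Ll; nneg.
- move=> e T h mh; apply/measurable_EFinP; rewrite /Ll.
  have h1 := measurable_sumsq mh; have h2 := measurable_sumdot mh.
  by mfun.
by move=> k i0; exact: Ll_le.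
Qed.

Let fin_nonneg (x : \bar R) r : (0 <= x)%E -> (x <= r%:E)%E ->
  exists2 y, 0 <= y <= r & x = y%:E.
Proof. by case: x => [y|//|//] y0 yr; exists y; [rewrite -!lee_fin y0|]. Qed.

(** From here on the argument takes place in [R]. Upper bounds suffice for [w] and [r], while [x]
    and [y] get multiplied by constants of either sign and are bounded on both sides. *)
Lemma trial_Fform alpha (g0 : R) : int3 (EFin \o resolvent m lam) = g0%:E ->
  exists x y w r, [/\ nrm2 psi (fun=> 0) = x%:E,
    Fform m lam alpha psi (fun=> 0) u (fun=> 0) =
      (- (lam * x) + n.+2%:R * (alpha * y + w + n.+1%:R * r))%:E &
    [/\ 0 <= x <= n.+2%:R ^+ 2 * g0 / d * J1, 0 <= y <= d^-1 * J1,
      w <= 2 * pi ^+ 2 * (Num.sqrt (1 - kap ^+ 2)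
        + spect_const n lam / (2 * Num.sqrt (1 - kap ^+ 2)) / d) * J1 &
      r <= n`!%:R * ((n%:R / lam + loss_coef m n n.+3%:R) / d * pwave_mass d K
        + loss_const m - gain_coef m lam n n.+3%:R d * pwave_mass d K)]].
Proof.
move=> g0E.
have [|x xx xE] := fin_nonneg _ (trial_psi_le g0E).
  by apply: intP_ge0 => k; rewrite lee_fin addr_ge0 ?sqr_ge0.
have [|y yy yE] := fin_nonneg _ trial_xi_le.
  by apply: intP_ge0 => k; rewrite lee_fin addr_ge0 ?sqr_ge0.
have [|w /andP[_ wle] wE] := fin_nonneg _ trial_Ll_le.
  by apply: intP_ge0 => k; rewrite lee_fin mulr_ge0 ?addr_ge0 ?sqr_ge0// /Ll; nneg.
have [r rE rle] := rint_cross_le dn dK m0 lam0.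
exists x, y, w, r; split=> //.
rewrite /Fform phi_trial phi_zero wint_zero nrm2_zero mule0 add0e add0e /Phi.
by rewrite -/u in rE *; rewrite xE yE wE rE.
Qed.

End TrialState.

(** From [1 / (1 + x) >= 1 - x]: the deficit of the gain becomes linear in [1 / d], like the other
    errors. *)
Lemma gain_coef_ge (R : realType) (m lam : R) (n : nat) (M d : R) :
  0 < m -> 0 < lam -> 0 <= M -> 0 < d -> 0 <= angular ((m + 1)^-1) ->
  4 * pi * (m + 1)^-1 * angular ((m + 1)^-1) * (1 - kernel_const m lam n M / d)
    <= gain_coef m lam n M d.
Proof.
move=> m0 lam0 M0 d0 a0; have /andP[k0 k1] := kap_itv m0.
have x0 : 0 <= kernel_const m lam n M / d.
  apply: divr_ge0; last exact: ltW.
  apply: divr_ge0; first by nneg; exact: ltW.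
  by rewrite subr_ge0 expr_le1 // ltW.
rewrite /gain_coef; apply: ler_wpM2l; first by nneg; exact: ltW.
rewrite -[leRHS]mul1r ler_pdivlMr; last by lra.
by move: (kernel_const m lam n M / d) x0 => x x0; nra.
Qed.

(* N = n.+2 >= 2 particles; mstar is the unique solution of Lambda(m,2) = 1. *)
Theorem mainTheorem2 (R : realType) (n : nat) (m mstar : R) :
  0 < m -> 0 < mstar -> LambdaMN mstar 2 = 1 -> m < mstar ->
  forall alpha lam : R, 0 < lam ->
  forall C : R,
  exists (psiR psiI : cfg R n.+2 -> R) (xiR xiI : cfg R n.+1 -> R),
    FDom m lam psiR psiI xiR xiI /\
    (Fform m lam alpha psiR psiI xiR xiI < (- C)%:E * nrm2 psiR psiI)%E.
Proof.
move=> m0 _ mstarE mlt alpha lam lam0 C.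
have /andP[k0 k1] := kap_itv m0; set kap := (m + 1)^-1 in k0 k1.
have pi0 : 0 < pi :> R := pi_gt0 R.
have kap2 : 0 < 1 - kap ^+ 2 by rewrite subr_gt0 expr_lt1 // ltW.
pose c0 : R := Num.sqrt (1 - kap ^+ 2).
have c00 : 0 < c0 by rewrite sqrtr_gt0.
have lam1 : pi * c0 < 2 * kap * angular kap := LambdaMN2_gt1 m0 mlt mstarE.
have ang0 : 0 <= angular kap.
  have : 0 < 2 * kap * angular kap by apply: lt_trans lam1; exact: mulr_gt0.
  by rewrite pmulr_rgt0; [exact: ltW|exact: mulr_gt0].
have [|g0 g00 g0E] := @int3_inv_sqr2 R (1 - kap) lam _ lam0; first by rewrite subr_gt0.
pose g := 4 * pi * kap * angular kap.
(* Cross minus diagonal coefficient of the p-wave mass; it is [2 pi] times the difference of the two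
   sides of [lam1]. *)
pose gap := g - 2 * pi ^+ 2 * c0.
have gap0 : 0 < gap.
  have -> : gap = 2 * pi * (2 * kap * angular kap - pi * c0) by rewrite /gap /g; ring.
  by apply: mulr_gt0; [exact: mulr_gt0|rewrite subr_gt0].
pose kc := kernel_const m lam n n.+3%:R.
pose lc := loss_coef m n n.+3%:R.
pose l0 := loss_const m.
pose S := 2 * pi ^+ 2 * (spect_const n lam / (2 * c0)).
have kc0 : 0 <= kc by apply: divr_ge0; [by nneg; exact: ltW|exact: ltW].
have l00 : 0 <= l0 by rewrite /l0 /loss_const -/kap; nneg; exact: ltW.
have lc0 : 0 <= lc by rewrite /lc /loss_coef -/kap; nneg; exact: ltW.
have S0 : 0 <= S by rewrite /S /spect_const; nneg; exact: ltW.
have gg0 : 0 <= g by rewrite /g; nneg; exact: ltW.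
pose N : R := n.+2%:R.
have N1 : 1 <= N by rewrite -[1]/(1%:R) ler_nat.
(* All coefficients of errors of order [J1 / d], in order: the norm of [psi], the term in [alpha],
   the diagonal weight, the spectator exchange, the shift by the spectators, the deficit of the
   gain. *)
pose E := `|C - lam| * (N * g0) + `|alpha| + S + n%:R / lam + lc + g * kc.
have E0 : 0 <= E by rewrite /E; nneg; first [exact: ltW|lra].
(* The first summand keeps the slab away from the cells, the second makes [E / d] at most half of
   [gap]. *)
pose d := n.+1%:R + 2 * E / gap.
have dn : n.+1%:R <= d by rewrite lerDl; nneg; exact: ltW.
have d0 : 0 < d by apply: lt_le_trans dn; rewrite ltr0n.
have Ed : E / d <= gap / 2.
  have e1 : 2 * E / gap <= d by rewrite lerDr.
  by rewrite ler_pdivrMr//; move: e1; rewrite ler_pdivrMr//; lra.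
(* The other half of [gap], times [T], must exceed the cut-off loss [l0]; the summand 1 makes this
   strict. *)
pose T := 1 + 2 * l0 / gap.
have T0 : 0 < T by rewrite ltr_wpDr//; nneg; exact: ltW.
(* So that [ln (K / d) = T], whence [J = (4 pi / 3) T >= T]. *)
pose K := d * expR T.
have dK : d < K by rewrite ltr_pMr// expR_gt1.
pose J := pwave_mass d K.
have JT : T <= J.
  have -> : J = 4 * pi / 3 * T.
    by rewrite /J /pwave_mass /K [d * _]mulrC mulfK ?gt_eqF// expRK.
  by apply: ler_peMl; [exact: ltW|have := pi_ge2 R; lra].
have Jl : l0 < J * (gap / 2).
  apply: (@lt_le_trans _ _ (T * (gap / 2))); last by apply: ler_wpM2r => //; lra.
  have -> : T * (gap / 2) = gap / 2 + l0 by rewrite /T; field; rewrite gt_eqF.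
  lra.
have J0 : 0 < J by exact: lt_le_trans JT.
pose F1 : R := n.+1`!%:R.
have F10 : 0 < F1 by rewrite ltr0n fact_gt0.
have [x [y [w [r [xE FE [/andP[x0 xle] /andP[y0 yle] wle rle]]]]]] :=
  trial_Fform dn dK m0 lam0 alpha g0E.
(* The four witnesses are left open and determined by unification with [trial_FDom]. *)
do 4 eexists; split; first exact: (trial_FDom dn dK m0 lam0).
rewrite FE xE -EFinM lte_fin.
pose J1 := F1 * J.
have J10 : 0 < J1 by exact: mulr_gt0.
have gc : g * (1 - kc / d) <= gain_coef m lam n n.+3%:R d.
  by apply: gain_coef_ge => //; exact: ler0n.
have hx : (C - lam) * x <= N * (`|C - lam| * (N * g0) / d * J1).
  apply: (@le_trans _ _ (`|C - lam| * x)); first by rewrite ler_wpM2r// ler_norm.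
  apply: (le_trans (ler_wpM2l (normr_ge0 _) xle)).
  by rewrite -/F1 -/J -/J1 -/N le_eqVlt; apply/orP; left; apply/eqP; ring.
have hy : alpha * y <= `|alpha| / d * J1.
  apply: (@le_trans _ _ (`|alpha| * y)); first by rewrite ler_wpM2r// ler_norm.
  by rewrite -mulrA; exact: ler_wpM2l.
have hw : w <= 2 * pi ^+ 2 * c0 * J1 + S / d * J1.
  apply: (le_trans wle); rewrite -/kap -/c0 -/F1 -/J -/J1 /S le_eqVlt.
  by apply/orP; left; apply/eqP; ring.
have hr : n.+1%:R * r <=
    (n%:R / lam + lc) / d * J1 + F1 * l0 - (g - g * kc / d) * J1.
  apply: (le_trans (ler_wpM2l (ler0n _ _) rle)).
  (* By [(n + 1) n! = (n + 1)!] the cross term has the multiplicity of the diagonal term, so that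
     the coefficients can be compared in [gap]. *)
  rewrite mulrA -natrM -factS -/F1 -/J -/lc -/l0.
  have : g * (1 - kc / d) * J1 <= gain_coef m lam n n.+3%:R d * J1.
    by apply: ler_wpM2r => //; exact: ltW.
  rewrite /J1; move: (gain_coef _ _ _ _ _) => G; lra.
have hE : J1 * (E / d) <= J1 * (gap / 2) by apply: ler_wpM2l => //; exact: ltW.
have hJ : F1 * l0 < J1 * (gap / 2) by rewrite /J1 -mulrA ltr_pM2l.
(* By [hx], the product [N * Z] bounds the energy plus [C] times the squared norm of [psi]. *)
pose Z := `|C - lam| * (N * g0) / d * J1 + (alpha * y + w + n.+1%:R * r).
have Z0 : Z < 0.
  move: hE; rewrite /E /Z /gap in hJ *; lra.
have : N * Z < 0 by rewrite pmulr_rlt0//; lra.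
by rewrite /Z mulrDr -/N; lra.
Qed.
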